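(* Let $0<\sigma<1$. The function $$\Psi_x^\sigma(z,y)=\frac{1}{\Gamma(\sigma)}\int_0^\infty K_t(x,z)e^{-\frac{y^2}{4t}}\,\frac{dt}{t^{1-\sigma}},\qquad x,z\in\Omega,\ y>0,$$ satisfies the equation $-L\Psi_x^\sigma+\frac{1-2\sigma}{y}\,\partial_y\Psi_x^\sigma+\partial_{yy}\Psi_x^\sigma=0$ in $\Omega\times(0,\infty)$ (in the variables $(z,y)$), $\Psi_x^\sigma(z,y)=\Psi_z^\sigma(x,y)$, and, for $f\in L^2(\Omega)$, $$\lim_{y\to0^+}\left\langle\frac{1}{2\sigma}\,y^{1-2\sigma}\partial_y\Psi_x^\sigma(\cdot,y),f(\cdot)\right\rangle_{L^2(\Omega)}=\frac{\Gamma(-\sigma)}{4^\sigma\Gamma(\sigma)}f(x).$$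
   Context: Setting: $\Omega\subset\mathbb{R}^n$ ($n\ge1$) is open, $d\eta$ is a positive measure on $\Omega$, and $L$ is a linear second order partial differential operator which is nonnegative, densely defined and self-adjoint in $L^2(\Omega)=L^2(\Omega,d\eta)$. $e^{-tL}$, $t\ge0$, is the heat semigroup defined by the spectral theorem. Standing assumptions on the heat semigroup: $e^{-tL}f(x)=\int_\Omega K_t(x,z)f(z)\,d\eta(z)$ for $t>0$, with a nonnegative heat kernel $K_t(x,z)=K_t(z,x)$; the heat kernel belongs to the domain of $L$ and $\partial_tK_t(x,z)=-LK_t(x,z)$, the $t$-derivative being classical, so that $\partial_t\int_\Omega K_t(x,z)f(z)\,d\eta(z)=\int_\Omega\partial_tK_t(x,z)f(z)\,d\eta(z)$ for $f\in L^2(\Omega)$; and given $x$ there exist a constant $C_x$ and $\varepsilon>0$ such that $\|K_t(x,\cdot)\|_{L^2(\Omega)}+\|\partial_tK_t(x,\cdot)\|_{L^2(\Omega)}\le C_x(1+t^\varepsilon)t^{-\varepsilon}$. $\Gamma(-\sigma):=\Gamma(1-\sigma)/(-\sigma)$.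
   Formalization: The integral defining Ψ_x can diverge (−d²/dx² on R, σ≥1/2), so the equation and limit assume it converges for all z and y>0; the equation holds in the operator sense if Ψ_x(·,y) is in L², else weakly against the domain of L; the limit is for a.e. x; L² is real-valued. *)

(* Defs.v *)
From HB Require Import structures.
From mathcomp Require Import all_boot all_order all_algebra.
From mathcomp Require Import all_classical all_reals all_analysis.

Set Implicit Arguments.
Unset Strict Implicit.
Unset Printing Implicit Defensive.

Import Order.TTheory GRing.Theory Num.Theory.
Import numFieldNormedType.Exports.

Local Open Scope classical_set_scope.
Local Open Scope ring_scope.

(* R^n with its Borel sigma-algebra. *)
Definition borelRn (R : realType) (n : nat) :=
  g_sigma_algebraType (@open 'rV[R]_n).

(* A positive measure on Omega is represented by a Borel measure eta on R^n of
   which only the restriction to Omega is ever used. Elements of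
   L^2(Omega, eta) are represented by real-valued functions on R^n, considered
   only on Omega and up to eta-a.e. equality there. *)
Section L2.
Context {R : realType} {n : nat}.
Variables (Omega : set (borelRn R n)).
Variable (eta : {measure set (borelRn R n) -> \bar R}).
Implicit Types f g : borelRn R n -> R.

Definition L2 : set (borelRn R n -> R) :=
  [set f : borelRn R n -> R | measurable_fun Omega f /\
           eta.-integrable Omega (fun z => (f z ^+ 2)%:E)].

Definition inner f g : R := \int[eta]_(z in Omega) (f z * g z).

Definition L2norm f : R := Num.sqrt (inner f f).

(* A linear operator in L^2(Omega), not necessarily bounded. *)
Record operator := Operator {
  dom : set (borelRn R n -> R) ;
  act :> (borelRn R n -> R) -> borelRn R n -> R }.

Definition linear_operator (L : operator) : Prop :=
  [/\ dom L `<=` L2,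
      (forall u, dom L u -> L2 (L u)),
      (forall u v, dom L u -> L2 v -> ae_eq eta Omega u v ->
         dom L v /\ ae_eq eta Omega (L u) (L v)),
      dom L (fun=> 0) &
      forall (a : R) u v, dom L u -> dom L v ->
        dom L (fun z => a * u z + v z) /\
        ae_eq eta Omega (L (fun z => a * u z + v z))
                        (fun z => a * L u z + L v z)].

Definition densely_defined (L : operator) : Prop :=
  forall f (e : R), L2 f -> 0 < e ->
    exists u, dom L u /\ L2norm (fun z => f z - u z) < e.

(* L coincides with its adjoint, domains included: the right-hand side says
   that u is in the domain of the adjoint, which maps it to v. *)
Definition self_adjoint (L : operator) : Prop :=
  forall u v, L2 u -> L2 v ->
    ((dom L u /\ ae_eq eta Omega (L u) v) <->
     (forall phi, dom L phi -> inner u (L phi) = inner v phi)).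

Definition nonnegative (L : operator) : Prop :=
  forall u, dom L u -> 0 <= inner (L u) u.

(* Differentiation along the i-th coordinate. *)
Definition partial (i : 'I_n) (u : 'rV[R]_n -> R) : 'rV[R]_n -> R :=
  fun z => 'D_(delta_mx 0 i) u z.

Definition C2 (u : 'rV[R]_n -> R) : Prop :=
  forall z, Omega z ->
    {for z, continuous u} /\
    (forall i, derivable u z (delta_mx 0 i) /\ {for z, continuous (partial i u)}) /\
    (forall i j, derivable (partial i u) z (delta_mx 0 j) /\
                 {for z, continuous (partial j (partial i u))}).

(* L acts on the C^2 elements of its domain as a linear differential expression
   of order two, with a principal symbol which is not identically zero. *)
Definition second_order_pdo (L : operator) : Prop :=
  exists (a : 'I_n -> 'I_n -> 'rV[R]_n -> R) (b : 'I_n -> 'rV[R]_n -> R)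
         (c : 'rV[R]_n -> R),
    (exists z (xi : 'rV[R]_n), Omega z /\
       \sum_(i < n) \sum_(j < n) a i j z * xi 0 i * xi 0 j != 0) /\
    forall u, dom L u -> C2 u ->
      ae_eq eta Omega (L u) (fun z =>
        \sum_(i < n) \sum_(j < n) a i j z * partial j (partial i u) z +
        \sum_(i < n) b i z * partial i u z + c z * u z).

(* The integral of phi against the (signed) measure <E(.)f, g>, where
   nu f = <E(.)f, f>; by polarization. *)
Definition spectral_form
    (nu : (borelRn R n -> R) -> {measure set (measurableTypeR R) -> \bar R})
    (phi : R -> R) f g : R :=
  (\int[nu (fun z => f z + g z)]_l phi l -
   \int[nu (fun z => f z - g z)]_l phi l) / 4.

(* E is a resolution of the identity carried by [0, +oo[, nu f is the measure
   <E(.)f, f>, and L is the integral of l dE(l). *)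
Definition spectral_resolution (L : operator)
    (E : set (measurableTypeR R) -> (borelRn R n -> R) -> borelRn R n -> R)
    (nu : (borelRn R n -> R) -> {measure set (measurableTypeR R) -> \bar R}) :
    Prop :=
  [/\ (forall B f, measurable B -> L2 f -> L2 (E B f)),
      (forall B f g, measurable B -> L2 f -> L2 g ->
         inner (E B f) g = inner f (E B g)),
      (forall B C f, measurable B -> measurable C -> L2 f ->
         ae_eq eta Omega (E (B `&` C) f) (E B (E C f))),
      (forall f, L2 f -> ae_eq eta Omega (E setT f) f) &
      (forall B f, measurable B -> L2 f -> nu f B = (inner (E B f) f)%:E)] /\
  [/\ (forall f, L2 f -> nu f [set l : R | l < 0] = 0%E),
      (forall u, dom L u <-> L2 u /\ (\int[nu u]_l (l ^+ 2)%:E < +oo)%E) &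
      (forall u v, dom L u -> dom L v ->
         inner (L u) v = spectral_form nu id u v)].

(* T t = e^{-tL}, defined through the spectral resolution of L. *)
Definition heat_semigroup (L : operator)
    (T : R -> (borelRn R n -> R) -> borelRn R n -> R) : Prop :=
  exists E nu, spectral_resolution L E nu /\
    forall (t : R) f, 0 <= t -> L2 f ->
      L2 (T t f) /\
      forall g, L2 g ->
        inner (T t f) g = spectral_form nu (fun l => expR (- (t * l))) f g.

Definition dtK (K : R -> borelRn R n -> borelRn R n -> R) (t : R)
    (x z : borelRn R n) : R := derive1 (fun s : R => K s x z) t.

Definition heat_kernel (L : operator)
    (T : R -> (borelRn R n -> R) -> borelRn R n -> R)
    (K : R -> borelRn R n -> borelRn R n -> R) : Prop :=
  [/\ (forall (t : R) f, 0 < t -> L2 f ->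
         {ae eta, forall x, Omega x -> T t f x = inner (K t x) f}),
      (forall (t : R) x z, 0 < t -> Omega x -> Omega z -> 0 <= K t x z) &
      (forall (t : R) x z, 0 < t -> Omega x -> Omega z -> K t x z = K t z x)] /\
  [/\ (forall (t : R) x, 0 < t -> Omega x -> dom L (K t x)),
      (forall (t : R) x z, 0 < t -> Omega x -> Omega z ->
         derivable (fun s : R => K s x z) t 1),
      (forall (t : R) x, 0 < t -> Omega x -> L2 (dtK K t x) /\
         ae_eq eta Omega (dtK K t x) (fun z => - L (K t x) z)),
      (forall (t : R) x f, 0 < t -> Omega x -> L2 f ->
         is_derive t 1 (fun s : R => inner (K s x) f) (inner (dtK K t x) f)) &
      (forall x, Omega x -> exists C eps : R, 0 < eps /\
         forall t : R, 0 < t ->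
           L2norm (K t x) + L2norm (dtK K t x)
             <= C * (1 + t `^ eps) * t `^ (- eps))].

End L2.

Arguments operator R n : clear implicits.

Definition Gamma {R : realType} (s : R) : R :=
  \int[@lebesgue_measure R]_(t in `]0, +oo[) (t `^ (s - 1) * expR (- t)).

(* Gamma (- s) for 0 < s < 1. *)
Definition Gamma_opp {R : realType} (s : R) : R := Gamma (1 - s) / (- s).

Section Psi.
Context {R : realType} {n : nat}.
Variables (K : R -> borelRn R n -> borelRn R n -> R) (s : R).

Definition Psi_integrand (x z : borelRn R n) (y t : R) : R :=
  K t x z * expR (- (y ^+ 2 / (4 * t))) / t `^ (1 - s).

Definition Psi (x z : borelRn R n) (y : R) : R :=
  (Gamma s)^-1 *
  \int[@lebesgue_measure R]_(t in `]0, +oo[) Psi_integrand x z y t.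

(* The integral defining Psi x z y converges for all z in Omega and y > 0.
   The bound on K t x assumed for t -> +oo does not imply this (it fails for
   the Laplacian on R when s >= 1/2), and Psi x would be +oo without it. *)
Definition Psi_converges (Omega : set (borelRn R n)) (x : borelRn R n) : Prop :=
  forall z (y : R), Omega z -> 0 < y ->
    (@lebesgue_measure R).-integrable `]0, +oo[
      (fun t => (Psi_integrand x z y t)%:E).

End Psi.

(* Main.v *)
Require Import Defs.
From HB Require Import structures.
From mathcomp Require Import all_boot all_order all_algebra finmap.
From mathcomp Require Import all_classical all_reals all_analysis.
From mathcomp Require Import measurable_realfun ring lra zify.

Set Implicit Arguments.
Unset Strict Implicit.
Unset Printing Implicit Defensive.

Import Order.TTheory GRing.Theory Num.Theory.
Import numFieldNormedType.Exports.

Local Open Scope classical_set_scope.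
Local Open Scope ring_scope.

(**
  Put [c = y^2 / 4] and [w t = t^(s-1) e^(-c/t)], so that
  [Gamma s * Psi x z y] is the integral of [K t x z * w t]. Differentiating
  under the integral, [(1-2s)/y d_y Psi + d_yy Psi] is [1 / Gamma s] times the
  integral of [K t x z * w' t]. Against [phi] in the domain of [L], Fubini and
  an integration by parts move the derivative onto [<K t x, phi>], whose
  derivative is [- <K t x, L phi>]; the integral of [K w] converges at infinity
  only in the improper sense, and positivity of [K] allows dominated
  convergence by [Psi * |L phi|]. Self-adjointness turns this weak identity
  into the strong one when [Psi] is in L2.

  With [g t = <K t x, f> = (e^(-tL) f) x], the weighted normal derivative is a
  constant times [c^(1-s)] times the integral of [t^(s-2) e^(-c/t) g t], an
  approximate identity at [t = 0]. For [f = e^(-rL) f0] the function [g] is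
  continuous up to [t = 0], which gives the limit. These [f] are dense, and the
  limit extends to every [f] for almost every [x] by a maximal inequality for
  the averages of [e^(-tL) f], valid for positive self-adjoint contraction
  semigroups (Stein): linearizing the maximum as [S], positivity gives
  [|S* g|^2 <= 4 <g, M g>], hence a bound on the norm of the maximal operator
  [M] in terms of its own square root.
*)

(** Near [t = 0] the hypotheses bound [K t x] in L2 only by a negative power of [t], so for a
    general [f] nothing controls [<K t x, f>] there pointwise: this forces a maximal inequality and
    a conclusion for almost every [x]. The exceptional set must not depend on [y], whereas
    [T t f x = <K t x, f>] is granted off a null set depending on [t]; identities are therefore
    imposed at countably many times and extended by continuity in [t].

    The maximal inequality is proved for finitely many discrete averages on a mesh [d], because the
    bootstrap must start from some finite bound; it ends with a constant free of the mesh and of the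
    number of averages. With [2^j] terms per average, a product of two averages is at most twice a
    single one, whence the [4]; and [6] is the least positive integer [c] with [4 (c + 2) <= c^2].

    The semigroup law is extracted from the spectral resolution, which describes [T t] only through
    the measures [nu]; signed identities are kept as equalities between sums of positive
    measures. *)

Lemma measurable_open_borelRn (R : realType) (n : nat) (A : set (borelRn R n)) :
  @open 'rV[R]_n A -> measurable A.
Proof. by move=> oA; exact: sub_sigma_algebra. Qed.

(** * The space L2 *)

Section L2_theory.
Context {R : realType} {n : nat} {Omega : set (borelRn R n)}.
Context {eta : {measure set (borelRn R n) -> \bar R}}.
Hypothesis mO : measurable Omega.
Implicit Types f g h u v : borelRn R n -> R.

Local Notation L2 := (L2 Omega eta).
Local Notation inner := (inner Omega eta).
Local Notation L2norm := (L2norm Omega eta).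

Lemma L2_meas f : L2 f -> measurable_fun Omega f. Proof. by case. Qed.

Lemma L2_mul_integrable f g : L2 f -> L2 g ->
  eta.-integrable Omega (EFin \o (fun z => f z * g z)).
Proof.
move=> [mf f2] [mg g2].
apply: (@le_integrable _ _ _ _ _ mO _ (fun z => (f z ^+ 2)%:E + (g z ^+ 2)%:E)%E).
- by apply/measurable_EFinP; exact: measurable_funM.
- move=> z _ /=; rewrite lee_fin normrM [leRHS]ger0_norm; last first.
    by rewrite addr_ge0// sqr_ge0.
  by rewrite -(real_normK (num_real (f z))) -(real_normK (num_real (g z))); nra.
- exact: integrableD.
Qed.

Lemma L2_le f g : measurable_fun Omega f ->
  (forall z, Omega z -> `|f z| <= `|g z|) -> L2 g -> L2 f.
Proof.
move=> mf fg [mg g2]; split=> //.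
apply: (@le_integrable _ _ _ _ _ mO _ _ _ _ g2).
- by apply/measurable_EFinP; exact: measurable_funX.
- move=> z Oz /=; rewrite lee_fin !normrX ler_pXn2r ?nnegrE//.
  exact: fg.
Qed.

Lemma L2_eq f g : (forall z, Omega z -> f z = g z) -> L2 f -> L2 g.
Proof.
move=> fg Lf; apply: (@L2_le _ f) => //.
- by apply: eq_measurable_fun (L2_meas Lf) => z /set_mem; exact: fg.
- by move=> z Oz; rewrite fg.
Qed.

Lemma L2_add f g : L2 f -> L2 g -> L2 (fun z => f z + g z).
Proof.
move=> Lf Lg; split; first exact: measurable_funD (L2_meas Lf) (L2_meas Lg).
have fg := L2_mul_integrable Lf Lg.
have h := integrableD mO (integrableD mO Lf.2 Lg.2) (integrableZl mO 2 fg).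
apply: eq_integrable h => //= z _.
by rewrite -EFinM -!EFinD /=; congr EFin; ring.
Qed.

Lemma L2_scale (k : R) f : L2 f -> L2 (fun z => k * f z).
Proof.
move=> Lf; split.
  by apply: measurable_funM (L2_meas Lf) => //.
apply: eq_integrable (integrableZl mO (k ^+ 2) Lf.2) => //= z _.
by rewrite -EFinM exprMn.
Qed.

Lemma L2_0 : L2 (fun=> 0).
Proof.
split; first exact: measurable_cst.
by rewrite expr0n; exact: integrable0.
Qed.

Lemma L2_sub f g : L2 f -> L2 g -> L2 (fun z => f z - g z).
Proof.
move=> Lf Lg; have := L2_add Lf (L2_scale (-1) Lg).
by apply: L2_eq => z _; rewrite mulN1r.
Qed.

Lemma L2_norm f : L2 f -> L2 (fun z => `|f z|).
Proof.
move=> Lf; apply: (L2_le _ _ Lf).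
- exact: measurableT_comp (L2_meas Lf).
- by move=> z _; rewrite normr_id.
Qed.

Lemma L2_sum (I : Type) (r : seq I) (P : pred I) (F : I -> borelRn R n -> R) :
  (forall i, L2 (F i)) -> L2 (fun z => \sum_(i <- r | P i) F i z).
Proof.
move=> LF; elim: r => [|i r IH].
  by apply: L2_eq L2_0 => z _; rewrite big_nil.
case Pi: (P i).
- by apply: L2_eq (L2_add (LF i) IH) => z _; rewrite big_cons Pi.
- by apply: L2_eq IH => z _; rewrite big_cons Pi.
Qed.

Lemma L2_max f g : L2 f -> L2 g -> L2 (fun z => Order.max (f z) (g z)).
Proof.
move=> Lf Lg.
apply: (@L2_le _ (fun z => `|f z| + `|g z|)).
- exact: measurable_maxr (L2_meas Lf) (L2_meas Lg).
- move=> z _; rewrite [leRHS]ger0_norm ?addr_ge0//.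
  by rewrite /Order.max; case: ifP => _; rewrite ?lerDl ?lerDr.
- exact: L2_add (L2_norm Lf) (L2_norm Lg).
Qed.

Lemma innerC f g : inner f g = inner g f.
Proof. by apply: eq_Rintegral => z _; rewrite mulrC. Qed.

Lemma eq_inner f f' g g' : (forall z, Omega z -> f z = f' z) ->
  (forall z, Omega z -> g z = g' z) -> inner f g = inner f' g'.
Proof. by move=> ff' gg'; apply: eq_Rintegral => z /set_mem Oz; rewrite ff'// gg'. Qed.

Lemma innerDl f g h : L2 f -> L2 g -> L2 h ->
  inner (fun z => f z + g z) h = inner f h + inner g h.
Proof.
move=> Lf Lg Lh; rewrite -[RHS]RintegralD//; try exact: L2_mul_integrable.
by apply: eq_Rintegral => z _; rewrite mulrDl.
Qed.

Lemma innerZl k f h : L2 f -> L2 h ->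
  inner (fun z => k * f z) h = k * inner f h.
Proof.
move=> Lf Lh; rewrite -RintegralZl//; last exact: L2_mul_integrable.
by apply: eq_Rintegral => z _; rewrite mulrA.
Qed.

Lemma innerBl f g h : L2 f -> L2 g -> L2 h ->
  inner (fun z => f z - g z) h = inner f h - inner g h.
Proof.
move=> Lf Lg Lh; rewrite -[RHS]RintegralB//; try exact: L2_mul_integrable.
by apply: eq_Rintegral => z _; rewrite mulrBl.
Qed.

Lemma inner0l h : inner (fun=> 0) h = 0.
Proof.
rewrite /Defs.inner /Rintegral integral0_eq// => z _.
by rewrite mul0r.
Qed.

Lemma inner_suml (I : Type) (r : seq I) (P : pred I) (F : I -> borelRn R n -> R) h :
  (forall i, L2 (F i)) -> L2 h ->
  inner (fun z => \sum_(i <- r | P i) F i z) h = \sum_(i <- r | P i) inner (F i) h.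
Proof.
move=> LF Lh; elim: r => [|i r IH].
  rewrite big_nil -[RHS](inner0l h); apply: eq_inner => // z _.
  by rewrite big_nil.
rewrite big_cons -IH; case Pi: (P i).
- rewrite -innerDl//; last exact: L2_sum.
  by apply: eq_inner => // z _; rewrite big_cons Pi.
- by apply: eq_inner => // z _; rewrite big_cons Pi.
Qed.

Lemma innerDr f g h : L2 f -> L2 g -> L2 h ->
  inner h (fun z => f z + g z) = inner h f + inner h g.
Proof. by move=> Lf Lg Lh; rewrite !(innerC h) innerDl. Qed.

Lemma innerBr f g h : L2 f -> L2 g -> L2 h ->
  inner h (fun z => f z - g z) = inner h f - inner h g.
Proof. by move=> Lf Lg Lh; rewrite !(innerC h) innerBl. Qed.

Lemma innerZr k f h : L2 f -> L2 h ->
  inner h (fun z => k * f z) = k * inner h f.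
Proof. by move=> Lf Lh; rewrite !(innerC h) innerZl. Qed.

Lemma inner_sumr (I : Type) (r : seq I) (P : pred I) (F : I -> borelRn R n -> R) h :
  (forall i, L2 (F i)) -> L2 h ->
  inner h (fun z => \sum_(i <- r | P i) F i z) = \sum_(i <- r | P i) inner h (F i).
Proof.
move=> LF Lh; rewrite innerC inner_suml//.
by apply: eq_bigr => i _; rewrite innerC.
Qed.

Lemma inner_ge0 f : 0 <= inner f f.
Proof. by apply: Rintegral_ge0 => z _; rewrite -expr2 sqr_ge0. Qed.

Lemma L2norm_ge0 f : 0 <= L2norm f. Proof. exact: sqrtr_ge0. Qed.

Lemma L2norm_sqr f : L2norm f ^+ 2 = inner f f.
Proof. exact: sqr_sqrtr (inner_ge0 f). Qed.

Lemma eq_L2norm f g : (forall z, Omega z -> f z = g z) -> L2norm f = L2norm g.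
Proof. by move=> fg; rewrite /Defs.L2norm (@eq_inner f g f g). Qed.

Lemma ae_eq_inner f f' h : L2 f -> L2 f' -> L2 h -> ae_eq eta Omega f f' ->
  inner f h = inner f' h.
Proof.
move=> Lf Lf' Lh ff'; congr fine; apply: ae_eq_integral => //.
- by apply/measurable_EFinP; exact: measurable_funM (L2_meas Lf) (L2_meas Lh).
- by apply/measurable_EFinP; exact: measurable_funM (L2_meas Lf') (L2_meas Lh).
- apply: filterS ff' => z /= h1 Oz; by rewrite h1.
Qed.

Lemma ae_le_inner f f' h : L2 f -> L2 f' -> L2 h ->
  {ae eta, forall z, Omega z -> f z * h z <= f' z * h z} ->
  inner f h <= inner f' h.
Proof.
move=> Lf Lf' Lh le; rewrite -subr_ge0 -innerBl//.
pose q z := (f' z - f z) * h z.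
have mq : measurable_fun Omega (EFin \o q).
  apply/measurable_EFinP; apply: measurable_funM (L2_meas Lh).
  exact: measurable_funB (L2_meas Lf') (L2_meas Lf).
(* [q] is nonnegative only almost everywhere; it is replaced by [|q|], which is so everywhere. *)
have -> : inner (fun z => f' z - f z) h = \int[eta]_(z in Omega) `|q z|.
  congr fine; apply: ae_eq_integral => //.
    by apply/measurable_EFinP; do 1 apply: measurableT_comp => //; exact/measurable_EFinP.
  apply: filterS le => z /= h1 Oz.
  by rewrite ger0_norm// /q mulrBl subr_ge0 h1.
by apply: Rintegral_ge0.
Qed.

Lemma inner_pos f g : L2 f -> L2 g ->
  {ae eta, forall z, Omega z -> 0 <= f z} -> (forall z, Omega z -> 0 <= g z) ->
  0 <= inner f g.
Proof.
move=> Lf Lg f0 g0; rewrite -(inner0l g); apply: ae_le_inner => //.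
  exact: L2_0.
by apply: filterS f0 => z h Oz; rewrite mul0r mulr_ge0 ?h ?g0.
Qed.

Lemma L2_CauchySchwarz f g : L2 f -> L2 g -> `|inner f g| <= L2norm f * L2norm g.
Proof.
move=> Lf Lg.
rewrite -(@ler_pXn2r _ 2)// ?nnegrE ?mulr_ge0 ?L2norm_ge0//.
rewrite exprMn !L2norm_sqr real_normK ?num_real//.
have quad k : 0 <= inner f f - 2 * k * inner f g + k ^+ 2 * inner g g.
  have Lkg := L2_scale k Lg.
  suff <- : inner (fun z => f z - k * g z) (fun z => f z - k * g z) =
    inner f f - 2 * k * inner f g + k ^+ 2 * inner g g by exact: inner_ge0.
  rewrite innerBl ?innerBr ?innerZl ?innerZr//; try exact: L2_sub.
  by rewrite (innerC g f); ring.
have gg := inner_ge0 g.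
have [g0|gn0] := eqVneq (inner g g) 0.
  have [fg0|fgn0] := eqVneq (inner f g) 0; first by rewrite g0 fg0 mulr0 expr0n.
  (* With [<g, g> = 0] the quadratic is affine in [k]; this [k] gives it the value [-1]. *)
  have := quad ((inner f f + 1) / (2 * inner f g)).
  rewrite g0 mulr0 addr0.
  have -> : 2 * ((inner f f + 1) / (2 * inner f g)) * inner f g = inner f f + 1.
    by field.
  lra.
have := quad (inner f g / inner g g).
have -> : inner f f - 2 * (inner f g / inner g g) * inner f g +
   (inner f g / inner g g) ^+ 2 * inner g g = inner f f - inner f g ^+ 2 / inner g g.
  by field.
rewrite subr_ge0 ler_pdivrMr ?lt0r ?gn0//.
Qed.

Lemma inner_le f g : L2 f -> L2 g -> inner f g <= L2norm f * L2norm g.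
Proof. by move=> Lf Lg; exact: le_trans (ler_norm _) (L2_CauchySchwarz Lf Lg). Qed.

Lemma L2norm_add f g : L2 f -> L2 g ->
  L2norm (fun z => f z + g z) <= L2norm f + L2norm g.
Proof.
move=> Lf Lg.
rewrite -(@ler_pXn2r _ 2)// ?nnegrE ?addr_ge0 ?L2norm_ge0//.
rewrite sqrrD !L2norm_sqr innerDl ?innerDr//; try exact: L2_add.
rewrite (innerC g f); have := inner_le Lf Lg; lra.
Qed.

Lemma L2norm_scale k f : L2 f -> L2norm (fun z => k * f z) = `|k| * L2norm f.
Proof.
move=> Lf; rewrite /Defs.L2norm innerZl ?innerZr//; try exact: L2_scale.
by rewrite mulrA -expr2 sqrtrM ?sqr_ge0// sqrtr_sqr.
Qed.

Lemma L2norm0 : L2norm (fun=> 0) = 0.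
Proof. by rewrite /Defs.L2norm inner0l sqrtr0. Qed.

Lemma L2norm_sum (I : Type) (r : seq I) (F : I -> borelRn R n -> R) :
  (forall i, L2 (F i)) ->
  L2norm (fun z => \sum_(i <- r) F i z) <= \sum_(i <- r) L2norm (F i).
Proof.
move=> LF; elim: r => [|i r IH].
  rewrite big_nil (@eq_L2norm _ (fun=> 0)) ?L2norm0// => z _.
  by rewrite big_nil.
rewrite big_cons (@eq_L2norm _ (fun z => F i z + \sum_(j <- r) F j z)); last first.
  by move=> z _; rewrite big_cons.
apply: (le_trans (L2norm_add (LF i) (L2_sum r xpredT LF))).
by rewrite lerD2l.
Qed.

Lemma L2norm_le f g : L2 f -> L2 g -> (forall z, Omega z -> `|f z| <= `|g z|) ->
  L2norm f <= L2norm g.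
Proof.
move=> Lf Lg fg; rewrite /Defs.L2norm ler_wsqrtr//.
apply: le_Rintegral => //; try exact: L2_mul_integrable.
move=> z Oz; rewrite -!expr2 -(real_normK (num_real (f z))) -(real_normK (num_real (g z))).
by rewrite ler_pXn2r ?nnegrE// fg.
Qed.

Lemma L2norm_norm f : L2norm (fun z => `|f z|) = L2norm f.
Proof.
congr Num.sqrt; apply: eq_Rintegral => z _.
by rewrite -!expr2 real_normK// num_real.
Qed.

(** Besides weak-type bounds, this gives finite measure to the level sets from which [ksupp] is
    assembled. *)
Lemma L2_Chebyshev f (l : R) : L2 f -> 0 < l ->
  (eta (Omega `&` [set z | (l <= f z)%R]) <= (inner f f / l ^+ 2)%:E)%E.
Proof.
move=> Lf l0; have mf := L2_meas Lf.
have l20 : 0 < l ^+ 2 by rewrite exprn_gt0.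
have h := @le_integral_abse _ _ _ eta Omega mO (fun z => (f z ^+ 2)%:E) (l ^+ 2)
  (measurable_int eta Lf.2) l20.
have mA : measurable (Omega `&` [set z | (l <= f z)%R]).
  have := mf mO _ (measurable_itv `[l, +oo[); congr measurable.
  by congr (_ `&` _); apply/seteqP; split => z /=; rewrite in_itv/= andbT.
have mB : measurable (Omega `&` [set x | ((l ^+ 2)%:E <= `|(f x ^+ 2)%:E|)%E]).
  apply: emeasurable_fun_c_infty => //.
  apply: measurableT_comp => //; exact: measurable_int Lf.2.
have sub : (eta (Omega `&` [set z | (l <= f z)%R]) <=
     eta (Omega `&` [set x | ((l ^+ 2)%:E <= `|(f x ^+ 2)%:E|)%E]))%E.
  apply: le_measure; rewrite ?inE//.
  move=> z [Oz /= lz]; split=> //=; rewrite lee_fin ger0_norm ?sqr_ge0//.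
  by rewrite ler_pXn2r ?nnegrE ?(ltW l0)// (le_trans (ltW l0)).
apply: (le_trans sub).
rewrite (mulrC (inner f f)) [leRHS]EFinM lee_pdivlMl//; apply: (le_trans h).
rewrite le_eqVlt; apply/orP; left; apply/eqP.
rewrite /Defs.inner /Rintegral fineK; last first.
  exact: (integrable_fin_num mO (L2_mul_integrable Lf Lf)).
by apply: eq_integral => z _ /=; rewrite ger0_norm ?sqr_ge0// expr2.
Qed.

Lemma inner_eq0 f : L2 f -> inner f f = 0 -> ae_eq eta Omega f (fun=> 0).
Proof.
move=> Lf f0.
have /(ae_eq_integral_abs eta mO (measurable_int eta Lf.2)) h :
    (\int[eta]_(z in Omega) `|(f z ^+ 2)%:E| = 0)%E.
  have fin := integrable_fin_num mO (L2_mul_integrable Lf Lf).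
  have := fineK fin; rewrite -[fine _]/(inner f f) f0 => e.
  rewrite [RHS]e; apply: eq_integral => z _ /=.
  by rewrite ger0_norm ?sqr_ge0// expr2.
apply: filterS h => z /= h Oz; have := h Oz => -[] /eqP.
by rewrite sqrf_eq0 => /eqP.
Qed.

Lemma ae_eq_of_inner u v : L2 u -> L2 v ->
  (forall g, L2 g -> inner u g = inner v g) -> ae_eq eta Omega u v.
Proof.
move=> Lu Lv uv.
have := inner_eq0 (L2_sub Lu Lv); rewrite innerBl//; last exact: L2_sub.
rewrite uv ?subrr; last exact: L2_sub.
move=> /(_ erefl); apply: filterS => z h Oz.
by apply/eqP; rewrite -subr_eq0; apply/eqP; exact: h.
Qed.

End L2_theory.

(** * The semigroup law *)

Section weighted_integrals.
Import HBNNSimple.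
Context d (T : measurableType d) (R : realType).
Local Open Scope ereal_scope.

Lemma ge0_integral_nnsfunM (m : {measure set T -> \bar R}) (a : T -> R)
    (h : {nnsfun T >-> R}) :
  measurable_fun setT a -> (forall x, (0 <= a x)%R) ->
  \int[m]_x ((h x * a x)%:E) =
  \sum_(r \in range h) (r%:E * \int[m]_(x in h @^-1` [set r]) (a x)%:E).
Proof.
move=> ma a0.
have e x : ((h x * a x)%:E) =
    \sum_(r \in range h) (r%:E * (((EFin \o a) \_ (h @^-1` [set r])) x)).
  rewrite -(@fsbig_widen _ _ _ _ [set h x] (range h)) /=.
  - rewrite fsbig_set1 /= /patch ifT ?EFinM//.
    by rewrite inE.
  - by move=> r /= ->; exists x.
  - move=> r [_ /= hx]; rewrite /patch ifF ?mule0//.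
    by apply/negbTE/negP; rewrite inE /= => h'; apply: hx; rewrite h'.
under eq_integral do rewrite e.
have mh r : measurable (h @^-1` [set r]).
  exact: measurable_funPTI.
have ma' r : measurable_fun setT ((EFin \o a) \_ (h @^-1` [set r])).
  apply/(measurable_restrictT _ (mh r)).1; apply: measurable_funTS.
  exact/measurable_EFinP.
have a0' r x : 0 <= ((EFin \o a) \_ (h @^-1` [set r])) x.
  by rewrite /patch; case: ifP => _ //=; rewrite lee_fin.
rewrite fsbig_finite//=.
(* Exchanging sum and integral asks for nonnegative terms at every real [r]; [max r 0] provides this
   and equals [r] on the range of [h]. *)
transitivity (\sum_(r <- fset_set (range h))
   \int[m]_x ((Order.max r 0%R)%:E * ((EFin \o a) \_ (h @^-1` [set r])) x)).
  rewrite -ge0_integral_sum//.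
  - apply: eq_integral => x _; rewrite fsbig_finite//=.
    rewrite big_seq [RHS]big_seq; apply: eq_bigr => r.
    by rewrite in_fset_set// inE => -[y _ <-]; rewrite max_l.
  - by move=> r; apply: measurable_funeM.
  - move=> r x _; apply: mule_ge0 => //; rewrite lee_fin.
    by rewrite le_max lexx orbT.
rewrite big_seq [RHS]big_seq; apply: eq_bigr => r.
rewrite in_fset_set// inE => -[y _ <-]; rewrite max_l//.
rewrite ge0_integralZl//; last by rewrite lee_fin.
by rewrite [in RHS]integral_mkcond.
Qed.

Lemma cvg_ge0_integral_nnsfunM (m : {measure set T -> \bar R}) (a phi : T -> R)
    (mphi : measurable_fun setT (EFin \o phi)) :
  measurable_fun setT a -> (forall x, (0 <= a x)%R) ->
  (forall x, (0 <= phi x)%R) ->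
  \int[m]_x (nnsfun_approx measurableT mphi k x * a x)%:E @[k --> \oo] -->
  \int[m]_x ((phi x * a x)%:E).
Proof.
move=> ma a0 phi0.
have -> : \int[m]_x ((phi x * a x)%:E) =
  \int[m]_x limn (fun k => (nnsfun_approx measurableT mphi k x * a x)%:E).
  apply: eq_integral => x _; apply/esym/cvg_lim => //.
  have c : EFin \o (nnsfun_approx measurableT mphi)^~ x @ \oo --> (phi x)%:E.
    by apply: cvg_nnsfun_approx => // y _; rewrite lee_fin.
  have af : (a x)%:E \is a fin_num by [].
  exact: (cvgeZr af c).
apply: cvg_monotone_convergence => //.
- by move=> k; apply/measurable_EFinP/measurable_funM.
- by move=> k x _; rewrite lee_fin mulr_ge0.
- move=> x _ i j ij; rewrite lee_fin ler_wpM2r//.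
  exact/lefP/nd_nnsfun_approx.
Qed.

(* Additive form of an identity between signed combinations of measures with
   densities: it extends from indicators to nonnegative functions. *)
Lemma eq_weighted_integrals (m1 m2 m3 m4 : {measure set T -> \bar R})
    (a1 a2 a3 a4 phi : T -> R) :
  measurable_fun setT a1 -> measurable_fun setT a2 ->
  measurable_fun setT a3 -> measurable_fun setT a4 ->
  (forall x, (0 <= a1 x)%R) -> (forall x, (0 <= a2 x)%R) ->
  (forall x, (0 <= a3 x)%R) -> (forall x, (0 <= a4 x)%R) ->
  (forall B, measurable B ->
     \int[m1]_(x in B) (a1 x)%:E + \int[m2]_(x in B) (a2 x)%:E =
     \int[m3]_(x in B) (a3 x)%:E + \int[m4]_(x in B) (a4 x)%:E) ->
  measurable_fun setT phi -> (forall x, (0 <= phi x)%R) ->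
  \int[m1]_x (phi x * a1 x)%:E + \int[m2]_x (phi x * a2 x)%:E =
  \int[m3]_x (phi x * a3 x)%:E + \int[m4]_x (phi x * a4 x)%:E.
Proof.
move=> ma1 ma2 ma3 ma4 a10 a20 a30 a40 H mphi phi0.
have mp : measurable_fun setT (EFin \o phi) by exact/measurable_EFinP.
have pos (m : {measure set T -> \bar R}) (a : T -> R) :
    (forall x, (0 <= a x)%R) -> 0 <= \int[m]_x (phi x * a x)%:E.
  by move=> a0; apply: integral_ge0 => x _; rewrite lee_fin mulr_ge0.
have def (m m' : {measure set T -> \bar R}) (a a' : T -> R) :
    (forall x, (0 <= a x)%R) -> (forall x, (0 <= a' x)%R) ->
    \int[m]_x (phi x * a x)%:E +? \int[m']_x (phi x * a' x)%:E.
  by move=> a0 a'0; rewrite ge0_adde_def// inE pos.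
have c1 := cvgeD (def m1 m2 _ _ a10 a20) (@cvg_ge0_integral_nnsfunM m1 _ _ mp ma1 a10 phi0)
  (@cvg_ge0_integral_nnsfunM m2 _ _ mp ma2 a20 phi0).
have c2 := cvgeD (def m3 m4 _ _ a30 a40) (@cvg_ge0_integral_nnsfunM m3 _ _ mp ma3 a30 phi0)
  (@cvg_ge0_integral_nnsfunM m4 _ _ mp ma4 a40 phi0).
rewrite -(cvg_lim _ (c1 _))// -(cvg_lim _ (c2 _))//.
(* It remains to compare simple functions; on each of their level sets the hypothesis [H]
   applies. *)
congr (limn _); apply/funext => k /=.
rewrite !ge0_integral_nnsfunM// !fsbig_finite//= -!big_split/=.
rewrite big_seq [RHS]big_seq; apply: eq_bigr => r.
rewrite in_fset_set// inE => -[y _ <-].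
rewrite -!ge0_muleDr; first last.
- by apply: integral_ge0 => x _; rewrite lee_fin.
- by apply: integral_ge0 => x _; rewrite lee_fin.
- by apply: integral_ge0 => x _; rewrite lee_fin.
- by apply: integral_ge0 => x _; rewrite lee_fin.
rewrite H//; exact: measurable_funPTI.
Qed.

End weighted_integrals.

(** * Spectral measures, the semigroup law and strong continuity *)

Section semigroup.
Context {R : realType} {n : nat} {Omega : set (borelRn R n)}.
Context {eta : {measure set (borelRn R n) -> \bar R}}.
Hypothesis mO : measurable Omega.
Variables (L : operator R n) (T : R -> (borelRn R n -> R) -> borelRn R n -> R).
Variables (E : set (measurableTypeR R) -> (borelRn R n -> R) -> borelRn R n -> R)
  (nu : (borelRn R n -> R) -> {measure set (measurableTypeR R) -> \bar R}).
Hypothesis hE : spectral_resolution Omega eta L E nu.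
Hypothesis hT : forall (t : R) f, 0 <= t -> L2 Omega eta f ->
      L2 Omega eta (T t f) /\
      forall g, L2 Omega eta g ->
        inner Omega eta (T t f) g = spectral_form nu (fun l => expR (- (t * l))) f g.
Implicit Types f g h u v : borelRn R n -> R.

Local Notation L2 := (L2 Omega eta).
Local Notation inner := (inner Omega eta).
Local Notation L2norm := (L2norm Omega eta).
Local Notation phi t := (fun l : R => expR (- (t * l))).

Lemma spectral_L2 B f : measurable B -> L2 f -> L2 (E B f).
Proof. by case: hE => -[h *]; exact: h. Qed.

Lemma spectral_sym B f g : measurable B -> L2 f -> L2 g ->
  inner (E B f) g = inner f (E B g).
Proof. by case: hE => -[_ h *]; exact: h. Qed.

Lemma spectral_inter B C f g : measurable B -> measurable C -> L2 f -> L2 g ->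
  inner (E (B `&` C) f) g = inner (E B (E C f)) g.
Proof.
case: hE => -[_ _ h _ _] _ mB mC Lf Lg; apply: ae_eq_inner => //.
- by apply: spectral_L2 => //; exact: measurableI.
- by do 2 apply: spectral_L2 => //.
- exact: h.
Qed.

Lemma spectral_setT f g : L2 f -> L2 g -> inner (E setT f) g = inner f g.
Proof.
case: hE => -[_ _ _ h _] _ Lf Lg; apply: ae_eq_inner => //.
- exact: spectral_L2.
- exact: h.
Qed.

Lemma spectral_nuE B f : measurable B -> L2 f -> nu f B = (inner (E B f) f)%:E.
Proof. by case: hE => -[_ _ _ _ h] _; exact: h. Qed.

(** Linearity of [E B] is recovered in weak form, by moving [E B] onto the other factor with
    [spectral_sym]. The additive form avoids subtracting extended reals. *)
Lemma spectral_polarization B u v : measurable B -> L2 u -> L2 v ->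
  (nu (fun z => (u z + v z)%R) B =
   nu (fun z => (u z - v z)%R) B + (4 * inner (E B u) v)%:E)%E.
Proof.
move=> mB Lu Lv.
have Ls := L2_add mO Lu Lv; have Ld := L2_sub mO Lu Lv.
have Eu := spectral_L2 mB Lu; have Ev := spectral_L2 mB Lv.
rewrite !spectral_nuE// -EFinD; congr EFin.
have Es w : L2 w -> inner (E B (fun z => u z + v z)) w = inner (E B u) w + inner (E B v) w.
  move=> Lw; have Ew := spectral_L2 mB Lw.
  by rewrite (spectral_sym mB Ls Lw) innerDl// (spectral_sym mB Lu Lw) (spectral_sym mB Lv Lw).
have Ed w : L2 w -> inner (E B (fun z => u z - v z)) w = inner (E B u) w - inner (E B v) w.
  move=> Lw; have Ew := spectral_L2 mB Lw.
  by rewrite (spectral_sym mB Ld Lw) innerBl// (spectral_sym mB Lu Lw) (spectral_sym mB Lv Lw).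
rewrite Es// Ed// !innerBr// !innerDr//.
have -> : inner (E B v) u = inner (E B u) v by rewrite (spectral_sym mB Lv Lu) innerC.
by ring.
Qed.

Lemma measurable_phi (t : R) : measurable_fun setT (phi t).
Proof.
apply: measurableT_comp => //; apply: measurableT_comp => //.
Qed.

Lemma nu_neg f : L2 f -> nu f [set l : R | l < 0] = 0%E.
Proof. by case: hE => _ [h _ _]; exact: h. Qed.

Lemma nu_phi_le1 t f : 0 <= t -> L2 f ->
  {ae nu f, forall l : R, expR (- (t * l)) <= 1}.
Proof.
move=> t0 Lf; exists [set l : R | l < 0]; split=> //.
- rewrite [X in measurable X](_ : _ = `]-oo, 0[%classic)//.
- exact: nu_neg.
- move=> l /= h; rewrite ltNge; apply/negP => l0; apply: h.
  by rewrite -expR0 ler_expR oppr_le0 mulr_ge0.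
Qed.

Lemma nu_integral_phi_le t f : 0 <= t -> L2 f ->
  (\int[nu f]_l (expR (- (t * l)))%:E <= (inner f f)%:E)%E.
Proof.
move=> t0 Lf; apply: (@le_trans _ _ (\int[nu f]_l (cst 1) l)%E); last first.
  by rewrite integral_cst// mul1e (spectral_nuE measurableT Lf) spectral_setT.
apply: ae_ge0_le_integral => //.
- by apply/measurable_EFinP; exact: measurable_phi.
- have [N [mN N0 sN]] := nu_phi_le1 t0 Lf; exists N; split=> // l /= hl.
  by apply: sN => /= h; apply: hl => _; rewrite lee_fin.
Qed.

Lemma nu_integral_phi_fin t f : 0 <= t -> L2 f ->
  (\int[nu f]_l (expR (- (t * l)))%:E)%E \is a fin_num.
Proof.
move=> t0 Lf; rewrite ge0_fin_numE; last first.
  by apply: integral_ge0 => l _; rewrite lee_fin expR_ge0.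
by apply: le_lt_trans (nu_integral_phi_le t0 Lf) _; rewrite ltry.
Qed.

Lemma nu_integral_phiM_le t (a : R -> R) f : 0 <= t -> L2 f ->
  measurable_fun setT a -> (forall l, 0 <= a l <= 1) ->
  (\int[nu f]_l (expR (- (t * l)) * a l)%:E)%E \is a fin_num.
Proof.
move=> t0 Lf ma a01; rewrite ge0_fin_numE; last first.
  by apply: integral_ge0 => l _; case/andP: (a01 l) => a0 _; rewrite lee_fin mulr_ge0 ?expR_ge0.
apply: le_lt_trans (le_lt_trans (nu_integral_phi_le t0 Lf) (ltry _)).
apply: ge0_le_integral => //.
- by move=> l _; case/andP: (a01 l) => a0 _; rewrite lee_fin mulr_ge0 ?expR_ge0.
- by apply/measurable_EFinP; apply: measurable_funM => //; exact: measurable_phi.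
- by apply/measurable_EFinP; exact: measurable_phi.
- by move=> l _; case/andP: (a01 l) => _ a1; rewrite lee_fin ler_piMr ?expR_ge0.
Qed.

(** In signed form: [<E B f, T r g>] is the integral of [e^(-rl)] over [B] against [<E(.)f, g>]. The
    reason is that [<E C g, E B f> = <E (C & B) f, g>] for every Borel set [C], with [&] the
    intersection. *)
Lemma inner_spectral_heat B r f g : measurable B -> 0 <= r -> L2 f -> L2 g ->
  (\int[nu (fun z => (f z - g z)%R)]_(l in B) (expR (- (r * l)))%:E +
   (4 * inner (E B f) (T r g))%:E =
   \int[nu (fun z => (f z + g z)%R)]_(l in B) (expR (- (r * l)))%:E)%E.
Proof.
move=> mB r0 Lf Lg.
have EBf := spectral_L2 mB Lf.
rewrite innerC (hT r0 Lg).2// /spectral_form /Rintegral.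
set Np := nu (fun z => g z + E B f z); set Nm := nu (fun z => g z - E B f z).
set P := nu (fun z => f z + g z); set Q := nu (fun z => f z - g z).
have Ls := L2_add mO Lf Lg; have Ld := L2_sub mO Lf Lg.
have Lps := L2_add mO Lg EBf; have Lms := L2_sub mO Lg EBf.
have m1B : measurable_fun setT (\1_B : _ -> R) by exact: measurable_indic.
have i01 (l : R) : 0 <= (\1_B l : R) <= 1.
  by rewrite indicE; case: (l \in B); rewrite /= ?lexx ?ler01.
(* The signed identity [Np - Nm = 1_B (P - Q)], with its negative terms moved across. *)
have key := @eq_weighted_integrals _ _ _ Np Q Nm P (cst 1) (\1_B) (cst 1) (\1_B)
  (phi r) (@measurable_cst _ _ _ _ _ _) m1B (@measurable_cst _ _ _ _ _ _) m1B
  (fun=> ler01) (fun l => proj1 (andP (i01 l))) (fun=> ler01)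
  (fun l => proj1 (andP (i01 l))) _ (measurable_phi r) (fun l => expR_ge0 _).
have ind (mm : {measure set (measurableTypeR R) -> \bar R}) :
   (\int[mm]_l (expR (- (r * l)) * \1_B l)%:E =
    \int[mm]_(l in B) (expR (- (r * l)))%:E)%E.
  rewrite [RHS]integral_mkcond; apply: eq_integral => l _.
  rewrite /patch indicE; case: (l \in B); by rewrite ?mulr1 ?mulr0.
rewrite -!ind.
have fins := nu_integral_phiM_le r0 Ls m1B i01.
have find := nu_integral_phiM_le r0 Ld m1B i01.
have finp := nu_integral_phi_fin r0 Lps.
have finm := nu_integral_phi_fin r0 Lms.
have {key} : (\int[Np]_x (expR (- (r * x)) * cst 1 x)%:E +
    \int[Q]_x (expR (- (r * x)) * \1_B x)%:E =
    \int[Nm]_x (expR (- (r * x)) * cst 1 x)%:E +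
    \int[P]_x (expR (- (r * x)) * \1_B x)%:E)%E.
  apply: key => C mC.
  have mCB : measurable (B `&` C) by exact: measurableI.
  rewrite !(integral_cst _ mC 1) !mul1e !integral_indic//.
  rewrite /Np (spectral_polarization mC Lg EBf) -/Nm.
  rewrite /P (spectral_polarization mCB Lf Lg) -/Q -addeA; congr (_ + _)%E.
  rewrite addeC; congr (_ + (_ * _)%:E)%E.
  rewrite (spectral_sym mC Lg EBf) innerC setIC (spectral_inter mC mB)//.
have e1 (mm : {measure set (measurableTypeR R) -> \bar R}) :
   (\int[mm]_l (expR (- (r * l)) * cst 1 l)%:E =
    \int[mm]_l (expR (- (r * l)))%:E)%E.
  by apply: eq_integral => l _; rewrite mulr1.
rewrite !e1.
move: fins find finp finm; rewrite -/P -/Q -/Np -/Nm => fins find finp finm.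
rewrite -(fineK fins) -(fineK find) -(fineK finp) -(fineK finm) -!EFinD /=.
by move=> [h]; congr EFin; lra.
Qed.

(** By [inner_spectral_heat], the measure [<E(.)f, T r g>] has density [e^(-rl)] with respect to
    [<E(.)f, g>]; integrating [e^(-tl)] against it multiplies the exponentials. *)
Lemma heat_semigroup_law t r f g : 0 <= t -> 0 <= r -> L2 f -> L2 g ->
  inner (T t f) (T r g) = inner (T (t + r) f) g.
Proof.
move=> t0 r0 Lf Lg; have tr0 : 0 <= t + r by rewrite addr_ge0.
have Lh := (hT r0 Lg).1.
rewrite (hT t0 Lf).2// (hT tr0 Lf).2// /spectral_form /Rintegral.
set h := T r g.
have Ls := L2_add mO Lf Lg; have Ld := L2_sub mO Lf Lg.
have Lsh := L2_add mO Lf Lh; have Ldh := L2_sub mO Lf Lh.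
have key := @eq_weighted_integrals _ _ _ (nu (fun z => f z + h z))
  (nu (fun z => f z - g z)) (nu (fun z => f z - h z)) (nu (fun z => f z + g z))
  (cst 1) (phi r) (cst 1) (phi r) (phi t)
  (@measurable_cst _ _ _ _ _ _) (measurable_phi r)
  (@measurable_cst _ _ _ _ _ _) (measurable_phi r)
  (fun=> ler01) (fun l => expR_ge0 _) (fun=> ler01) (fun l => expR_ge0 _)
  _ (measurable_phi t) (fun l => expR_ge0 _).
have {key} := key _.
have e (mm : {measure set (measurableTypeR R) -> \bar R}) :
   (\int[mm]_l (expR (- (t * l)) * expR (- (r * l)))%:E =
    \int[mm]_l (expR (- ((t + r) * l)))%:E)%E.
  by apply: eq_integral => l _; rewrite -expRD mulrDl opprD.
rewrite !e.
have e1 (mm : {measure set (measurableTypeR R) -> \bar R}) :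
   (\int[mm]_l (expR (- (t * l)) * cst 1 l)%:E =
    \int[mm]_l (expR (- (t * l)))%:E)%E.
  by apply: eq_integral => l _; rewrite mulr1.
rewrite !e1 => key.
have fins := nu_integral_phi_fin tr0 Ls.
have find := nu_integral_phi_fin tr0 Ld.
have finp := nu_integral_phi_fin t0 Lsh.
have finm := nu_integral_phi_fin t0 Ldh.
suff : (\int[nu (fun z => f z + h z)%R]_l (expR (- (t * l)))%:E +
  \int[nu (fun z => f z - g z)%R]_l (expR (- ((t + r) * l)))%:E =
  \int[nu (fun z => f z - h z)%R]_l (expR (- (t * l)))%:E +
  \int[nu (fun z => f z + g z)%R]_l (expR (- ((t + r) * l)))%:E)%E.
  rewrite -(fineK fins) -(fineK find) -(fineK finp) -(fineK finm) -!EFinD /=.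
  by move=> [h']; congr (_ / _); lra.
apply: key => B mB.
rewrite !(integral_cst _ mB 1) !mul1e.
rewrite (spectral_polarization mB Lf Lh) -addeA; congr (_ + _)%E.
by rewrite addeC inner_spectral_heat.
Qed.

Lemma heat_inner_le t f : 0 <= t -> L2 f -> inner (T t f) f <= inner f f.
Proof.
move=> t0 Lf; have Lff := L2_add mO Lf Lf.
rewrite (hT t0 Lf).2// /spectral_form ler_pdivrMr//.
(* Polarization with [g = f] leaves the measures of [2f] and of [0]: the second integral is dropped
   by sign, and the first measure has mass [4 <f, f>]. *)
rewrite -[leRHS]subr0 lerB//; last first.
  by apply: Rintegral_ge0 => l _; exact: expR_ge0.
have := nu_integral_phi_le t0 Lff.
rewrite -(fineK (nu_integral_phi_fin t0 Lff)) lee_fin => /le_trans; apply.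
rewrite innerDl ?innerDr//; lra.
Qed.

(** The square of the left-hand side is [<T (2t) f, f>] by the semigroup law. *)
Lemma heat_contraction t f : 0 <= t -> L2 f -> L2norm (T t f) <= L2norm f.
Proof.
move=> t0 Lf; rewrite /Defs.L2norm ler_wsqrtr// heat_semigroup_law//.
by apply: heat_inner_le => //; rewrite addr_ge0.
Qed.

Lemma cvg_heat_inner (r : nat -> R) f : (forall k, 0 <= r k) ->
  r k @[k --> \oo] --> 0 -> L2 f ->
  inner (T (r k) f) f @[k --> \oo] --> inner f f.
Proof.
move=> r0 r_to0 Lf; have Lff := L2_add mO Lf Lf; have Lf0 := L2_sub mO Lf Lf.
pose P := nu (fun z => f z + f z); pose Q := nu (fun z => f z - f z).
(* The second measure in the polarization is that of [f - f], of total mass [0]. *)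
have ee k : inner (T (r k) f) f = (\int[P]_l expR (- (r k * l))) / 4.
  rewrite (hT (r0 k) Lf).2// /spectral_form -/P; congr (_ / _).
  rewrite -[RHS]subr0; congr (_ - _).
  have := nu_integral_phi_le (r0 k) Lf0.
  rewrite (@eq_inner _ _ _ _ _ (fun=> 0) _ (fun=> 0)); last 2 first.
  - by move=> z _; rewrite subrr.
  - by move=> z _; rewrite subrr.
  rewrite inner0l => h.
  by apply/eqP; rewrite eq_le; apply/andP; split;
    [rewrite -lee_fin fineK ?nu_integral_phi_fin|
     apply: Rintegral_ge0 => l _; exact: expR_ge0].
have PT : P setT = (4 * inner f f)%:E.
  rewrite /P (spectral_nuE measurableT Lff) spectral_setT//; congr EFin.
  by rewrite innerDl ?innerDr//; ring.
have -> : inner f f = fine (\int[P]_l (cst 1%E l)) / 4.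
  by rewrite integral_cst// mul1e PT /=; field.
under eq_fun do rewrite ee.
apply: cvgMl; apply: fine_cvg.
rewrite fineK; last by rewrite integral_cst// mul1e PT.
have h1 : {ae P, forall l, setT l ->
    (expR (- (r k * l)))%:E @[k --> \oo] --> (cst 1%E l : \bar R)}.
  apply: aeW => l _; apply: cvg_EFin; first exact: nearW.
  rewrite -[X in _ --> X]/(1%R) -expR0; apply: continuous_cvg.
    exact: continuous_expR.
  rewrite -[X in _ --> X]oppr0; apply: cvgN.
  by rewrite -[X in _ --> X](mul0r l); apply: cvgMl.
have h2 : P.-integrable setT (cst 1%E).
  apply/integrableP; split => //.
  under eq_integral do rewrite abse1.
  by rewrite integral_cst// mul1e PT ltry.
have h3 : {ae P, forall l k, setT l -> (`|(expR (- (r k * l)))%:E| <= cst 1%E l)%E}.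
  exists [set l : R | l < 0]; split.
  + by rewrite [X in measurable X](_ : _ = `]-oo, 0[%classic).
  + exact: nu_neg.
  + move=> l /= h; rewrite ltNge; apply/negP => l0; apply: h => k _.
    rewrite lee_fin ger0_norm ?expR_ge0//.
    by rewrite -expR0 ler_expR oppr_le0 mulr_ge0.
have mphi k : measurable_fun [set: measurableTypeR R] (fun l => (expR (- (r k * l)))%:E).
  by apply/measurable_EFinP; exact: measurable_phi.
have [_ _] := @dominated_convergence _ _ _ P setT measurableT _ _ _ mphi
  (@measurable_cst _ _ _ _ _ _) h1 h2 h3.
exact.
Qed.

(** Strong continuity from weak: the square expands as [<f, f> - 2 <T r f, f> + <T (2r) f, f>], and
    all three pairings tend to [<f, f>]. *)
Lemma cvg_heat_L2norm (r : nat -> R) f : (forall k, 0 <= r k) ->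
  r k @[k --> \oo] --> 0 -> L2 f ->
  inner (fun z => f z - T (r k) f z) (fun z => f z - T (r k) f z)
    @[k --> \oo] --> 0.
Proof.
move=> r0 r_to0 Lf.
have e k : inner (fun z => f z - T (r k) f z) (fun z => f z - T (r k) f z) =
   inner f f - inner (T (r k) f) f *+ 2 + inner (T (r k + r k) f) f.
  have LT := (hT (r0 k) Lf).1.
  rewrite innerBl ?innerBr//; try exact: L2_sub.
  by rewrite heat_semigroup_law// (innerC f (T _ _)) mulr2n; ring.
under eq_fun do rewrite e.
have z : inner f f - inner f f *+ 2 + inner f f = 0 by ring.
rewrite -z; apply: cvgD.
- apply: cvgB; first exact: cvg_cst.
  by rewrite mulr2n; under eq_fun do rewrite mulr2n; apply: cvgD; exact: cvg_heat_inner.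
- apply: cvg_heat_inner => //.
  + by move=> k; rewrite addr_ge0.
  + by rewrite -[X in _ --> X](addr0 0); apply: cvgD.
Qed.

End semigroup.

(** * The maximal inequality *)

(** Nonnegative terms on both sides of a window are added; this is how time-shifted averages are
    compared with unshifted ones. *)
Lemma ler_sum_shift (R : realType) (F : nat -> R) (s N M : nat) :
  (forall k, 0 <= F k) -> (s + N <= M)%N ->
  \sum_(k < N) F (k + s)%N <= \sum_(k < M) F k.
Proof.
move=> F0 sNM.
rewrite -(big_mkord xpredT (fun k => F (k + s)%N)) -(big_mkord xpredT F).
have -> : \sum_(0 <= k < N) F (k + s)%N = \sum_(s <= k < N + s) F k.
  by rewrite -[in RHS](add0n s) big_addn addnK.
rewrite (@big_cat_nat _ _ _ s 0 M)//=; last exact: leq_trans (leq_addr _ _) sNM.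
rewrite (@big_cat_nat _ _ _ (N + s)%N s M)//=; last 2 first.
- exact: leq_addl.
- by rewrite addnC.
rewrite addrCA lerDl addr_ge0//; exact: sumr_ge0.
Qed.

Section maximal_inequality.
Context {R : realType} {n : nat} {Omega : set (borelRn R n)}.
Context {eta : {measure set (borelRn R n) -> \bar R}}.
Hypothesis mO : measurable Omega.
Variable T : R -> (borelRn R n -> R) -> borelRn R n -> R.
Implicit Types f g h u v : borelRn R n -> R.

Local Notation L2 := (L2 Omega eta).
Local Notation inner := (inner Omega eta).
Local Notation L2norm := (L2norm Omega eta).

Hypothesis T_L2 : forall (t : R) f, 0 < t -> L2 f -> L2 (T t f).
Hypothesis T_law : forall (t r : R) f g, 0 < t -> 0 < r -> L2 f -> L2 g ->
  inner (T t f) (T r g) = inner (T (t + r) f) g.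
Hypothesis T_contraction : forall (t : R) f, 0 < t -> L2 f -> L2norm (T t f) <= L2norm f.
Hypothesis T_pos : forall (t : R) f g, 0 < t -> L2 f -> L2 g ->
  (forall z, Omega z -> 0 <= f z) -> (forall z, Omega z -> 0 <= g z) ->
  0 <= inner (T t f) g.

(** Splitting [t] into two halves makes the expression symmetric: both sides are
    [<T (t/2) f, T (t/2) g>]. *)
Lemma T_sym t f g : 0 < t -> L2 f -> L2 g -> inner (T t f) g = inner f (T t g).
Proof.
move=> t0 Lf Lg; have t20 : 0 < t / 2 by rewrite divr_gt0.
have e : t = t / 2 + t / 2 by lra.
by rewrite [RHS]innerC e -!T_law// innerC.
Qed.

Variable d : R.
Hypothesis d0 : 0 < d.

(** A Riemann sum, at the times [d, 2d, ..., 2^j d], for the mean of the semigroup over []0, 2^j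
    d]]. Lengths are powers of two so that a product of two averages is controlled by the next
    length. *)
Definition avg (j : nat) f : borelRn R n -> R :=
  fun x => (2 ^ j)%N%:R^-1 * \sum_(k < 2 ^ j) T (k.+1%:R * d) f x.

(** The recursion starts at [0] so that the maximum is nonnegative for every [f], hence can be fed
    back into the maximal operator. *)
Fixpoint maxavg (m : nat) f : borelRn R n -> R :=
  if m is m'.+1 then fun x => Order.max (maxavg m' f x) (avg m' f x)
  else fun=> 0.

Lemma kd_gt0 k : 0 < k.+1%:R * d. Proof. by rewrite mulr_gt0. Qed.

Lemma two_pow_gt0 j : 0 < (2 ^ j)%N%:R :> R. Proof. by rewrite ltr0n expn_gt0. Qed.

Lemma avg_L2 j f : L2 f -> L2 (avg j f).
Proof.
move=> Lf; apply: L2_scale => //; apply: L2_sum => // k.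
exact: T_L2 (kd_gt0 k) Lf.
Qed.

Lemma inner_avg j f g : L2 f -> L2 g ->
  inner (avg j f) g = (2 ^ j)%N%:R^-1 * \sum_(k < 2 ^ j) inner (T (k.+1%:R * d) f) g.
Proof.
move=> Lf Lg.
have LT (k : 'I_(2 ^ j)) : L2 (T (k.+1%:R * d) f) by exact: T_L2 (kd_gt0 k) Lf.
rewrite /avg innerZl//; last exact: L2_sum.
by rewrite inner_suml.
Qed.

Lemma avg_sym j f g : L2 f -> L2 g -> inner (avg j f) g = inner f (avg j g).
Proof.
move=> Lf Lg; rewrite [RHS]innerC !inner_avg//; congr (_ * _).
apply: eq_bigr => k _; rewrite [RHS]innerC T_sym//; exact: kd_gt0.
Qed.

Lemma avg_pos j f g : L2 f -> L2 g ->
  (forall z, Omega z -> 0 <= f z) -> (forall z, Omega z -> 0 <= g z) ->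
  0 <= inner (avg j f) g.
Proof.
move=> Lf Lg f0 g0; rewrite inner_avg// mulr_ge0 ?invr_ge0//.
by apply: sumr_ge0 => k _; apply: T_pos => //; exact: kd_gt0.
Qed.

Lemma avg_contraction j f : L2 f -> L2norm (avg j f) <= L2norm f.
Proof.
move=> Lf.
have LT (k : 'I_(2 ^ j)) : L2 (T (k.+1%:R * d) f) by exact: T_L2 (kd_gt0 k) Lf.
rewrite /avg L2norm_scale//; last exact: L2_sum.
rewrite ger0_norm ?invr_ge0// ler_pdivrMl ?two_pow_gt0//.
apply: le_trans (L2norm_sum mO _ LT) _.
have -> : (2 ^ j)%N%:R * L2norm f = \sum_(k < 2 ^ j) L2norm f.
  by rewrite sumr_const card_ord mulr_natl.
by apply: ler_sum => k _; apply: T_contraction => //; exact: kd_gt0.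
Qed.

Lemma maxavg_L2 m f : L2 f -> L2 (maxavg m f).
Proof.
move=> Lf; elim: m => [|m IH] /=; first exact: L2_0.
by apply: L2_max => //; exact: avg_L2.
Qed.

Lemma maxavg_ge0 m f z : 0 <= maxavg m f z.
Proof. by elim: m => [|m IH] //=; rewrite le_max IH. Qed.

Lemma le_maxavg m j f z : (j < m)%N -> avg j f z <= maxavg m f z.
Proof.
elim: m => [//|m IH] /=; rewrite ltnS leq_eqVlt => /orP[/eqP ->|jm].
  by rewrite le_max lexx orbT.
by rewrite le_max IH.
Qed.

Lemma L2_if (b : borelRn R n -> bool) f g : measurable_fun Omega b ->
  L2 f -> L2 g -> L2 (fun z => if b z then f z else g z).
Proof.
move=> mb Lf Lg; apply: (@L2_le _ _ _ _ mO _ (fun z => `|f z| + `|g z|)).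
- apply: measurable_fun_if => //.
  + by apply: measurable_funS (L2_meas Lf).
  + by apply: measurable_funS (L2_meas Lg).
- move=> z _; rewrite [leRHS]ger0_norm ?addr_ge0//.
  by case: (b z); rewrite ?lerDl ?lerDr.
- by apply: L2_add => //; exact: L2_norm.
Qed.

(* Linearization of the maximum: [H j] is the part of [h] living where the
   [j]-th average is the largest one. *)
Lemma maxavg_selection m f h : L2 f -> L2 h -> (forall z, Omega z -> 0 <= h z) ->
  exists H : nat -> borelRn R n -> R,
  [/\ forall j, L2 (H j), forall j z, Omega z -> 0 <= H j z,
      forall z, Omega z -> \sum_(j < m) H j z <= h z &
      forall z, Omega z -> \sum_(j < m) avg j f z * H j z = maxavg m f z * h z].
Proof.
move=> Lf Lh h0; elim: m => [|m [H [LH H0 Hh HM]]].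
  exists (fun _ _ => 0); split=> //.
  - by move=> _; exact: L2_0.
  - by move=> z Oz; rewrite big_ord0 h0.
  - by move=> z Oz; rewrite big_ord0 mul0r.
pose b z := maxavg m f z < avg m f z.
have mb : measurable_fun Omega b.
  exact: measurable_fun_ltr (L2_meas (maxavg_L2 m Lf)) (L2_meas (avg_L2 m Lf)).
exists (fun j z => if b z then (if j == m then h z else 0)
                   else (if j == m then 0 else H j z)).
split.
- move=> j; apply: L2_if => //; case: (j == m) => //; exact: L2_0.
- by move=> j z Oz; case: (b z); case: (j == m); rewrite ?h0 ?H0.
- move=> z Oz; rewrite big_ord_recr /= eqxx; case: (b z).
  + rewrite big1 ?add0r// => j _; by rewrite ltn_eqF.
  + rewrite addr0; apply: le_trans (Hh z Oz); apply: ler_sum => j _.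
    by rewrite ltn_eqF.
- move=> z Oz; rewrite big_ord_recr /= eqxx.
  have [bz|bz] := boolP (b z).
  + rewrite big1 ?add0r; last by move=> j _; rewrite ltn_eqF// mulr0.
    by rewrite (max_r (ltW bz)).
  + rewrite mulr0 addr0 max_l; last by rewrite leNgt.
    by rewrite -HM//; apply: eq_bigr => j _; rewrite ltn_eqF.
Qed.

(** The semigroup law turns the product into a double sum at the times [(k + l + 2) d]. For each [l]
    these lie among the first [2^(i+1)] multiples of [d], and positivity allows all of those to be
    included; the factor [2] is [2^(i+1) / 2^i]. *)
Lemma inner_avg_avg i j u v : (j <= i)%N -> L2 u -> L2 v ->
  (forall z, Omega z -> 0 <= u z) -> (forall z, Omega z -> 0 <= v z) ->
  inner (avg i u) (avg j v) <= 2 * inner (avg i.+1 u) v.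
Proof.
move=> ji Lu Lv u0 v0.
pose q m := inner (T (m.+1%:R * d) u) v.
have q0 m : 0 <= q m by apply: T_pos => //; exact: kd_gt0.
have LT m w : L2 w -> L2 (T (m.+1%:R * d) w) by move=> Lw; exact: T_L2 (kd_gt0 m) Lw.
have -> : inner (avg i u) (avg j v) =
   (2 ^ i)%N%:R^-1 * ((2 ^ j)%N%:R^-1 *
      \sum_(l < 2 ^ j) \sum_(k < 2 ^ i) q (k + l.+1)%N).
  rewrite inner_avg//; last exact: avg_L2.
  congr (_ * _).
  transitivity (\sum_(k < 2 ^ i) (2 ^ j)%N%:R^-1 * \sum_(l < 2 ^ j) q (k + l.+1)%N).
    apply: eq_bigr => k _; rewrite innerC inner_avg//; last exact: LT.
    congr (_ * _); apply: eq_bigr => l _.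
    rewrite innerC T_law//; try exact: kd_gt0.
    by rewrite /q -mulrDl -natrD addSn.
  by rewrite -mulr_sumr exchange_big.
rewrite inner_avg// [leRHS]mulrA -(_ : (2 ^ i)%N%:R^-1 = 2 / (2 ^ i.+1)%N%:R); last first.
  have := two_pow_gt0 i; rewrite lt0r => /andP[i0 _].
  by rewrite expnS natrM invfM mulrA divff// mul1r.
rewrite ler_pM2l ?invr_gt0 ?two_pow_gt0//.
rewrite ler_pdivrMl ?two_pow_gt0//.
have -> : (2 ^ j)%N%:R * \sum_(k < 2 ^ i.+1) inner (T (k.+1%:R * d) u) v =
  \sum_(l < 2 ^ j) \sum_(k < 2 ^ i.+1) q k.
  by rewrite sumr_const card_ord mulr_natl.
apply: ler_sum => l _; apply: ler_sum_shift => //.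
(* The shift is [l + 1], and [l + 1 <= 2^j <= 2^i]. *)
rewrite expnS mul2n -addnn leq_add2r.
by apply: leq_trans (ltn_ord l) _; rewrite leq_exp2l.
Qed.

Definition maxavg_bound (m : nat) (c : R) := forall f, L2 f ->
  (forall z, Omega z -> 0 <= f z) -> L2norm (maxavg m f) <= c * L2norm f.

Lemma maxavgS_norm m f : L2 f ->
  L2norm (maxavg m.+1 f) <= L2norm (maxavg m f) + L2norm f.
Proof.
move=> Lf; have LM := maxavg_L2 m Lf; have LA := avg_L2 m Lf.
have h1 := L2_norm mO LM; have h2 := L2_norm mO LA.
apply: (@le_trans _ _ (L2norm (fun z => `|maxavg m f z| + `|avg m f z|))).
  apply: L2norm_le => //.
  - exact: maxavg_L2.
  - exact: L2_add.
  - move=> z _ /=; rewrite [leRHS]ger0_norm ?addr_ge0//.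
    by rewrite /Order.max; case: ifP => _; rewrite ?lerDl ?lerDr.
apply: (le_trans (L2norm_add mO h1 h2)).
by rewrite !L2norm_norm lerD2l; exact: avg_contraction.
Qed.

(** The maximum is at most the sum of [m] contractions. The bound depends on [m], but it is finite,
    and the bootstrap needs no more to start. *)
Lemma maxavg_bound_trivial m : maxavg_bound m m%:R.
Proof.
move=> f Lf f0; elim: m => [|m IH]; first by rewrite mul0r L2norm0.
apply: (le_trans (maxavgS_norm m Lf)).
by rewrite -natr1 mulrDl mul1r lerD2r.
Qed.

(* A T T* argument: the bound [c + 1] for the maximal function gives the bound
   [2 * sqrt (c + 2) <= c]. *)
Lemma maxavg_bound_improve m (c : R) : 6 <= c -> maxavg_bound m (c + 1) ->
  maxavg_bound m c.
Proof.
move=> c6 bnd f Lf f0.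
set h := maxavg m f.
have Lh : L2 h by exact: maxavg_L2.
have h0 z : Omega z -> 0 <= h z by move=> _; exact: maxavg_ge0.
have [H [LH H0 Hh HM]] := maxavg_selection m Lf Lh h0.
(* The adjoint of the linearized maximum, applied to [h]; hence [<f, S> = <h, h>] below. *)
pose S z := \sum_(j < m) avg j (H j) z.
have LA (j : nat) : L2 (avg j (H j)) by exact: avg_L2.
have LS : L2 S by exact: L2_sum.
have LMh : L2 (maxavg m.+1 h) by exact: maxavg_L2.
have e1 : inner h h = inner f S.
  rewrite /S inner_sumr//.
  transitivity (\sum_(j < m) inner (avg j f) (H j)); last first.
    by apply: eq_bigr => j _; rewrite avg_sym.
  have e2 : inner h h = \int[eta]_(z in Omega) (\sum_(j < m) avg j f z * H j z).
    by apply: eq_Rintegral => z /set_mem Oz; rewrite HM.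
  rewrite e2 /Rintegral.
  under eq_integral do rewrite -sumEFin.
  have int (j : 'I_m) : eta.-integrable Omega (fun z => (avg j f z * H j z)%:E).
    by apply: L2_mul_integrable => //; exact: avg_L2.
  rewrite integral_sum//.
  rewrite [X in fine X](_ : _ = (\sum_(j < m) (inner (avg j f) (H j))%:E)%E).
    by rewrite sumEFin.
  apply: eq_bigr => j _; rewrite /Defs.inner /Rintegral fineK//.
  exact: integrable_fin_num.
have e3 : inner S S <= 4 * inner h (maxavg m.+1 h).
  rewrite {1}/S inner_suml//.
  (* Only the term of larger index is needed for each pair; keeping both makes the double sum
     symmetric, at the price of the factor [4]. *)
  apply: (@le_trans _ _ (\sum_(i < m) \sum_(j < m)
     (2 * inner (avg i.+1 (H i)) (H j) + 2 * inner (avg j.+1 (H j)) (H i)))).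
    apply: ler_sum => i _; rewrite /S inner_sumr//; apply: ler_sum => j _.
    have p1 : 0 <= 2 * inner (avg i.+1 (H i)) (H j).
      by rewrite mulr_ge0//; apply: avg_pos => //; exact: H0.
    have p2 : 0 <= 2 * inner (avg j.+1 (H j)) (H i).
      by rewrite mulr_ge0//; apply: avg_pos => //; exact: H0.
    have [ji|/ltnW ij] := leqP j i.
    - have := inner_avg_avg ji (LH i) (LH j) (H0 i) (H0 j).
      move=> /le_trans; apply; by rewrite lerDl.
    - rewrite innerC; have := inner_avg_avg ij (LH j) (LH i) (H0 j) (H0 i).
      move=> /le_trans; apply; by rewrite lerDr.
  have -> : \sum_(i < m) \sum_(j < m)
     (2 * inner (avg i.+1 (H i)) (H j) + 2 * inner (avg j.+1 (H j)) (H i)) =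
     4 * \sum_(i < m) \sum_(j < m) inner (avg i.+1 (H i)) (H j).
    transitivity (2 * \sum_(i < m) \sum_(j < m) inner (avg i.+1 (H i)) (H j) +
      2 * \sum_(i < m) \sum_(j < m) inner (avg j.+1 (H j)) (H i)).
      rewrite !mulr_sumr -big_split; apply: eq_bigr => i _.
      by rewrite !mulr_sumr -big_split.
    by rewrite [in X in _ + X]exchange_big /=; ring.
  rewrite ler_pM2l//.
  apply: (@le_trans _ _ (\sum_(i < m) inner (H i) (maxavg m.+1 h))).
    apply: ler_sum => i _.
    rewrite -inner_sumr//; last exact: avg_L2.
    (* Positivity of the average lets [h] replace the smaller function [\sum_j H j]. *)
    apply: (@le_trans _ _ (inner (avg i.+1 (H i)) h)).
      rewrite -subr_ge0 -innerBr//; [|exact: L2_sum|exact: avg_L2].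
      apply: avg_pos => //; [|exact: H0|].
      - by apply: L2_sub => //; exact: L2_sum.
      - by move=> z Oz; rewrite subr_ge0 Hh.
    rewrite avg_sym// innerC [leRHS]innerC; apply: ae_le_inner => //.
      exact: avg_L2.
    apply: aeW => z Oz; rewrite ler_wpM2r ?H0//.
    (* Multiplying averages raised the scale from [i] to [i + 1], at most [m]: hence [m.+1] in the
       maximal function. *)
    by apply: le_maxavg; rewrite ltnS.
  rewrite -inner_suml//.
  apply: ae_le_inner => //; first exact: L2_sum.
  apply: aeW => z Oz; rewrite ler_wpM2r ?Hh//; exact: maxavg_ge0.
set N := L2norm h; have N0 : 0 <= N by exact: L2norm_ge0.
have e4 : L2norm (maxavg m.+1 h) <= (c + 2) * N.
  apply: (le_trans (maxavgS_norm m Lh)).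
  have := bnd h Lh h0; rewrite -/N; lra.
have e5 : L2norm S <= c * N.
  have c0 : 0 <= c by lra.
  rewrite -(@ler_pXn2r _ 2)// ?nnegrE ?mulr_ge0 ?L2norm_ge0//.
  rewrite L2norm_sqr; apply: (le_trans e3).
  have := inner_le mO Lh LMh; rewrite -/N => h1.
  have h2 : N * L2norm (maxavg m.+1 h) <= N * ((c + 2) * N) by rewrite ler_wpM2l.
  (* The inequality [4 (c + 2) <= c^2], true from [c = 6] on. *)
  nra.
have e6 : N ^+ 2 <= (c * L2norm f) * N.
  rewrite /N L2norm_sqr e1; apply: (le_trans (inner_le mO Lf LS)).
  have ff0 : 0 <= L2norm f by exact: L2norm_ge0.
  rewrite -/N; nra.
have [NN|NN] := eqVneq N 0.
  by rewrite NN mulr_ge0 ?L2norm_ge0//; lra.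
by move: e6; rewrite expr2 ler_pM2r// lt0r NN.
Qed.

(** From the trivial bound, weakened to [m + 6], the constant descends by unit steps, each allowed
    while the target is at least [6]. The result depends neither on [m] nor on [d]. *)
Lemma maxavg_bound6 m : maxavg_bound m 6.
Proof.
have desc k : maxavg_bound m (k%:R + 6) -> maxavg_bound m 6.
  elim: k => [|k IH]; first by rewrite add0r.
  rewrite -natr1 addrAC => h; apply/IH/maxavg_bound_improve => //.
  by rewrite lerDr.
apply: (desc m) => f Lf f0; apply: (le_trans (@maxavg_bound_trivial m f Lf f0)).
by rewrite ler_wpM2r ?L2norm_ge0// lerDl.
Qed.

Lemma maxavg_weak m f (l : R) : L2 f -> (forall z, Omega z -> 0 <= f z) -> 0 < l ->
  (eta (Omega `&` [set z | (l <= maxavg m f z)%R]) <=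
   (36 * inner f f / l ^+ 2)%:E)%E.
Proof.
move=> Lf f0 l0; apply: (le_trans (L2_Chebyshev mO (maxavg_L2 m Lf) l0)).
rewrite lee_fin ler_pM2r ?invr_gt0 ?exprn_gt0//.
rewrite -!L2norm_sqr -[36](_ : 6 ^+ 2 = 36 :> R); last by ring.
rewrite -exprMn ler_pXn2r ?nnegrE ?mulr_ge0 ?L2norm_ge0//.
exact: maxavg_bound6.
Qed.

End maximal_inequality.

(** * Fubini's theorem for the heat kernel *)

Section restricted_fubini.
Context d (T : measurableType d) (R : realType).
Variables (eta : {measure set T -> \bar R}) (S : set T) (mS : measurable S).
Variables (F : (set T)^nat).
Hypothesis SF : S = \bigcup_i F i.
Hypothesis mF : forall i, measurable (F i).
Hypothesis finF : forall i, (eta (F i) < +oo)%E.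
Variables (D : set (measurableTypeR R)) (mD : measurable D).
Local Notation leb := (@lebesgue_measure R).
Local Open Scope ereal_scope.

(** The complement of [S] is null for the restricted measure, so adding it to the pieces [F] covers
    the whole space. *)
Lemma sigma_finite_mrestr : sigma_finite setT (mrestr eta mS).
Proof.
exists (fun i => if i is j.+1 then F j else ~` S).
  apply/seteqP; split => // z _; have [Sz|nSz] := pselect (S z).
    by move: (Sz); rewrite SF => -[j _ Fj]; exists j.+1.
  by exists 0%N.
move=> [|j]; split.
- exact: measurableC.
- by rewrite /mrestr setICl measure0 ltry.
- exact: mF.
- rewrite /mrestr (_ : F j `&` S = F j)//; apply/setIidPl => z Fz.
  by rewrite SF; exists j.
Qed.

Lemma integral_mrestr (f : T -> \bar R) :
  \int[mrestr eta mS]_(z in S) f z = \int[eta]_(z in S) f z.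
Proof.
apply: eq_measure_integral => A mA AS /=; rewrite /mrestr.
by rewrite (_ : A `&` S = A)//; apply/setIidPl.
Qed.

Let m2 : {sigma_finite_measure set T -> \bar R} :=
  HB.pack_for (SigmaFiniteMeasure.type T R) (mrestr eta mS)
    (@Measure_isSigmaFinite.Build _ _ _ (mrestr eta mS) sigma_finite_mrestr).

Let patchE (G : measurableTypeR R * T -> \bar R) t z :
  (G \_ (D `*` S)) (t, z) = ((fun t => ((fun z => G (t, z)) \_ S) z) \_ D) t.
Proof.
by rewrite /patch in_setX /=; case: (t \in D); case: (z \in S).
Qed.

Let patchE2 (G : measurableTypeR R * T -> \bar R) t z :
  (G \_ (D `*` S)) (t, z) = ((fun z => ((fun t => G (t, z)) \_ D) t) \_ S) z.
Proof.
by rewrite /patch in_setX /=; case: (t \in D); case: (z \in S).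
Qed.

Let int12 (G : measurableTypeR R * T -> \bar R) :
  \int[leb]_t \int[m2]_z (G \_ (D `*` S)) (t, z) =
  \int[leb]_(t in D) \int[eta]_(z in S) G (t, z).
Proof.
rewrite [RHS]integral_mkcond; apply: eq_integral => t _.
under eq_integral do rewrite patchE.
rewrite /patch; case: ifPn => tD; last first.
  by rewrite integral0.
rewrite -(integral_mrestr (fun z => G (t, z))).
by rewrite [RHS]integral_mkcond.
Qed.

Let int21 (G : measurableTypeR R * T -> \bar R) :
  \int[m2]_z \int[leb]_t (G \_ (D `*` S)) (t, z) =
  \int[eta]_(z in S) \int[leb]_(t in D) G (t, z).
Proof.
rewrite -(integral_mrestr (fun z => \int[leb]_(t in D) G (t, z))).
rewrite [RHS]integral_mkcond; apply: eq_integral => z _.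
under eq_integral do rewrite patchE2.
rewrite /patch; case: ifPn => zS; last first.
  by rewrite integral0.
by rewrite [RHS]integral_mkcond.
Qed.

Let mpatch (G : measurableTypeR R * T -> \bar R) :
  measurable_fun (D `*` S) G -> measurable_fun setT (G \_ (D `*` S)).
Proof. by move=> mG; apply/(measurable_restrictT _ _).1 => //; exact: measurableX. Qed.

Lemma restricted_tonelli (G : measurableTypeR R * T -> \bar R) :
  measurable_fun (D `*` S) G -> (forall p, (D `*` S) p -> 0 <= G p) ->
  \int[leb]_(t in D) \int[eta]_(z in S) G (t, z) =
  \int[eta]_(z in S) \int[leb]_(t in D) G (t, z).
Proof.
move=> mG G0; rewrite -int12 -int21 fubini_tonelli//; first exact: mpatch.
by move=> p; rewrite /patch; case: ifPn => // /set_mem; exact: G0.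
Qed.

Lemma measurable_restricted_tonelli (G : measurableTypeR R * T -> \bar R) :
  measurable_fun (D `*` S) G -> (forall p, (D `*` S) p -> 0 <= G p) ->
  measurable_fun S (fun z => \int[leb]_(t in D) G (t, z)).
Proof.
move=> mG G0.
have m1 : measurable_fun setT (fun z => \int[leb]_t (G \_ (D `*` S)) (t, z)).
  apply: (measurable_fun_fubini_tonelli_G (G \_ (D `*` S))).
  - exact: mpatch.
  - by move=> p; rewrite /patch; case: ifPn => // /set_mem; exact: G0.
apply: eq_measurable_fun (measurable_funTS m1) => z zS.
under eq_integral do rewrite patchE2.
by rewrite {1}/patch zS [RHS]integral_mkcond.
Qed.

Lemma measurable_restricted_tonelli_F (G : measurableTypeR R * T -> \bar R) :
  measurable_fun (D `*` S) G -> (forall p, (D `*` S) p -> 0 <= G p) ->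
  measurable_fun D (fun t => \int[eta]_(z in S) G (t, z)).
Proof.
move=> mG G0.
have m1 : measurable_fun setT (fun t => \int[m2]_z (G \_ (D `*` S)) (t, z)).
  apply: (measurable_fun_fubini_tonelli_F (G \_ (D `*` S))).
  - exact: mpatch.
  - by move=> p; rewrite /patch; case: ifPn => // /set_mem; exact: G0.
apply: eq_measurable_fun (measurable_funTS m1) => t tD.
rewrite -(integral_mrestr (fun z => G (t, z))) [RHS]integral_mkcond.
by apply: eq_integral => z _; rewrite patchE {1}/patch tD.
Qed.

Lemma restricted_fubini (G : measurableTypeR R * T -> \bar R) :
  measurable_fun (D `*` S) G ->
  \int[leb]_(t in D) \int[eta]_(z in S) `|G (t, z)| < +oo ->
  \int[leb]_(t in D) \int[eta]_(z in S) G (t, z) =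
  \int[eta]_(z in S) \int[leb]_(t in D) G (t, z).
Proof.
move=> mG fin; rewrite -int12 -int21.
apply: Fubini; apply/integrable12ltyP; first exact: mpatch.
rewrite -(int12 (abse \o G)) in fin; apply: le_lt_trans fin.
rewrite le_eqVlt; apply/orP; left; apply/eqP.
apply: eq_integral => t _; apply: eq_integral => z _.
by rewrite /patch; case: ifPn => //= _; exact: abse0.
Qed.

End restricted_fubini.

(** * Weighted time integrals of a kernel, as elements of L2 *)

Section kernel.
Context {R : realType} {n : nat} {Omega : set (borelRn R n)}.
Context {eta : {measure set (borelRn R n) -> \bar R}}.
Hypothesis mO : measurable Omega.
Implicit Types f g h u v : borelRn R n -> R.

Local Notation L2 := (L2 Omega eta).
Local Notation inner := (inner Omega eta).
Local Notation L2norm := (L2norm Omega eta).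
Local Notation leb := (@lebesgue_measure R).

Variable k : R -> borelRn R n -> R.
Hypothesis k_L2 : forall t : R, 0 < t -> L2 (k t).
Hypothesis k_cont : forall (t : R) z, 0 < t -> Omega z -> {for t, continuous (k^~ z)}.
Hypothesis k_ge0 : forall (t : R) z, 0 < t -> Omega z -> 0 <= k t z.

(** A rational time of denominator [p + 1], at most [1 / (p + 1)] to the right of [t >= 0]; the
    successor in the numerator keeps it positive. *)
Definition grid (p : nat) (t : R) : R := (Num.truncn (t * p.+1%:R)).+1%:R / p.+1%:R.

Lemma grid_gt0 p t : 0 < grid p t.
Proof. by rewrite /grid divr_gt0. Qed.

Lemma cvg_grid (t : R) : 0 < t -> grid p t @[p --> \oo] --> t.
Proof.
move=> t0; apply: (@squeeze_cvgr _ _ _ _ (fun=> t) (fun p => t + p.+1%:R^-1)).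
- apply: nearW => p.
  have /truncn_itv/andP[h1 h2] : 0 <= t * p.+1%:R by rewrite mulr_ge0// ltW.
  rewrite /grid ler_pdivlMr// (ltW h2) /= ler_pdivrMr// mulrDl mulVf//.
  by rewrite -natr1 lerD2r.
- exact: cvg_cst.
- rewrite -[X in _ --> X](addr0 t); apply: cvgD; first exact: cvg_cst.
  exact: cvg_harmonic.
Qed.

Lemma cvg_k_grid (t : R) z : 0 < t -> Omega z -> k (grid p t) z @[p --> \oo] --> k t z.
Proof.
move=> t0 Oz; have c := k_cont t0 Oz.
exact: (cvg_comp _ _ (cvg_grid t0) c).
Qed.

(* [eta] need not be sigma-finite, but [k t] vanishes for all [t > 0] off a
   countable union of sets of finite measure, because [k t z] is continuous in
   [t] and each [k t] is in L2. *)
Definition ksupp_piece (i : nat) : set (borelRn R n) :=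
  if @choice.unpickle (nat * nat * nat)%type i is Some (m, p, l)
  then Omega `&` [set z | (l.+1%:R^-1 <= k (m.+1%:R / p.+1%:R) z)%R]
  else set0.

Definition ksupp := \bigcup_i ksupp_piece i.

Lemma measurable_ksupp_piece i : measurable (ksupp_piece i).
Proof.
rewrite /ksupp_piece; case: choice.unpickle => [[[m p] l]|//].
have h : 0 < m.+1%:R / p.+1%:R :> R by rewrite divr_gt0.
have := L2_meas (k_L2 h) mO (measurable_itv `[l.+1%:R^-1, +oo[).
congr measurable; congr (_ `&` _).
by apply/seteqP; split => z /=; rewrite in_itv/= andbT.
Qed.

Lemma fin_ksupp_piece i : (eta (ksupp_piece i) < +oo)%E.
Proof.
rewrite /ksupp_piece; case: choice.unpickle => [[[m p] l]|]; last by rewrite measure0.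
have h : 0 < m.+1%:R / p.+1%:R :> R by rewrite divr_gt0.
apply: le_lt_trans (L2_Chebyshev mO (k_L2 h) _) (ltry _).
by rewrite invr_gt0.
Qed.

Lemma measurable_ksupp : measurable ksupp.
Proof. by apply: bigcupT_measurable; exact: measurable_ksupp_piece. Qed.

Lemma ksupp_sub : ksupp `<=` Omega.
Proof.
by move=> z [i _]; rewrite /ksupp_piece; case: choice.unpickle => [[[m p] l]|//] [].
Qed.

Lemma k_eq0 (t : R) z : 0 < t -> Omega z -> ~ ksupp z -> k t z = 0.
Proof.
move=> t0 Oz nS.
have grid0 p : k (grid p t) z = 0.
  apply/eqP; rewrite eq_le k_ge0 ?grid_gt0// andbT leNgt; apply/negP => kp.
  apply: nS; set v := k (grid p t) z in kp *.
  (* With these indices [1 / (l + 1) <= v] and [(m + 1) / (p + 1) = grid p t], so [z] lies in the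
     piece coded by [(m, p, l)]. *)
  pose l := Num.truncn v^-1; pose m := Num.truncn (t * p.+1%:R).
  exists (choice.pickle (m, p, l)) => //; rewrite /ksupp_piece choice.pickleK; split=> //=.
  rewrite -/(grid p t) -/v invf_ple ?posrE//; exact/ltW/truncnS_gt.
have c := cvg_k_grid t0 Oz.
have e : (fun p => k (grid p t) z) = cst 0 by apply/funext => p; exact: grid0.
by have := cvg_lim (@Rhausdorff R) c; rewrite e lim_cst// => <-.
Qed.

Local Notation Rpos := (`]0, +oo[%classic : set (measurableTypeR R)).

(** Sampled at grid times, [k] is constant in [t] on each cell, so preimages are countable unions of
    rectangles; by continuity in [t], [k] is the pointwise limit of the samples. *)
Lemma measurable_k_joint :
  measurable_fun (Rpos `*` Omega) (fun p : measurableTypeR R * borelRn R n => k p.1 p.2).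
Proof.
pose kp (q : nat) (p : measurableTypeR R * borelRn R n) := k (grid q p.1) p.2.
apply: (@measurable_fun_cvg _ _ _ _ kp); last first.
  move=> [t z] [/= t0 Oz]; apply: cvg_k_grid => //.
  by move: t0; rewrite in_itv/= andbT.
move=> q mRO B mB.
have -> : (Rpos `*` Omega) `&` kp q @^-1` B =
  \bigcup_m ((`]0, +oo[ `&` `[m%:R / q.+1%:R, m.+1%:R / q.+1%:R[) `*`
             (Omega `&` k (m.+1%:R / q.+1%:R) @^-1` B)).
  apply/seteqP; split => [[t z] [[/= t0 Oz] Bk]|[t z] [m _ [[/= t0 tm] [Oz Bk]]]].
    exists (Num.truncn (t * q.+1%:R)) => //; split => //=; split=> //.
    rewrite in_itv/= ler_pdivrMr// ltr_pdivlMr// truncn_itv//.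
    by move: t0; rewrite in_itv/= andbT => /ltW t0; rewrite mulr_ge0.
  split=> //=; rewrite /kp /grid/= (@truncn_def _ _ m)//.
  by move: tm; rewrite in_itv/= ler_pdivrMr// ltr_pdivlMr.
apply: bigcupT_measurable => m; apply: measurableX.
  by apply: measurableI; exact: measurable_itv.
have h : 0 < m.+1%:R / q.+1%:R :> R by rewrite divr_gt0.
exact: L2_meas (k_L2 h) mO _ mB.
Qed.

Variables (C eps : R).
Hypothesis C0 : 0 <= C.
Hypothesis k_bnd : forall t : R, 0 < t -> L2norm (k t) <= C * (1 + t `^ (- eps)).

Variables (D : set (measurableTypeR R)) (w : R -> R).
Hypothesis mD : measurable D.
Hypothesis D_pos : forall t, D t -> 0 < t.
Hypothesis mw : measurable_fun D w.
Hypothesis w0 : forall t, D t -> 0 <= w t.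
Hypothesis kw_int : forall z, Omega z -> leb.-integrable D (fun t => (k t z * w t)%:E).

Definition kernel_int (z : borelRn R n) : R := \int[leb]_(t in D) (k t z * w t).

Let Sp := ksupp.
Let mSp : measurable Sp. Proof. exact: measurable_ksupp. Qed.

Let DRpos : D `<=` Rpos.
Proof. by move=> t /D_pos t0; rewrite /= in_itv/= andbT. Qed.

Let mkDS : measurable_fun (D `*` Sp) (fun p : measurableTypeR R * borelRn R n => k p.1 p.2).
Proof.
apply: (measurable_funS _ _ measurable_k_joint).
- by apply: measurableX => //; exact: measurable_itv.
- by move=> [t z] [/= Dt Sz]; split => /=; [exact: DRpos|exact: ksupp_sub].
Qed.

Let mwDS : measurable_fun (D `*` Sp) (fun p : measurableTypeR R * borelRn R n => w p.1).
Proof.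
apply: (@measurable_comp _ _ _ _ _ _ D) => //.
- by move=> _ [[t z] [/= Dt _] <-].
- by apply: measurable_funTS; exact: measurable_fst.
Qed.

Let mfDS f : measurable_fun Omega f ->
  measurable_fun (D `*` Sp) (fun p : measurableTypeR R * borelRn R n => f p.2).
Proof.
move=> mf; apply: (@measurable_comp _ _ _ _ _ _ Omega) => //.
- by move=> _ [[t z] [/= _ Sz] <-]; exact: ksupp_sub.
- by apply: measurable_funTS; exact: measurable_snd.
Qed.

Lemma kernel_int_supp z : Omega z -> ~ ksupp z -> kernel_int z = 0.
Proof.
move=> Oz nS; rewrite /kernel_int /Rintegral integral0_eq// => t Dt.
by rewrite k_eq0 ?mul0r//; exact: D_pos.
Qed.

Lemma measurable_kernel_int : measurable_fun Omega kernel_int.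
Proof.
(* Measurability on [ksupp] comes from Tonelli's theorem; on the rest of [Omega] the integral is
   [0]. *)
have -> : Omega = Sp `|` (Omega `\` Sp) by rewrite setDUK//; exact: ksupp_sub.
have mOS : measurable (Omega `\` Sp) by exact: measurableD.
apply/measurable_funU => //; split.
- have h := @measurable_restricted_tonelli _ _ _ Sp mSp D mD
    (fun p => (k p.1 p.2 * w p.1)%:E) _ _.
  apply: (@measurableT_comp _ _ _ _ _ _ fine) => //; apply: h.
  + by apply/measurable_EFinP; exact: measurable_funM.
  + move=> [t z] [/= Dt /ksupp_sub Sz]; rewrite lee_fin mulr_ge0 ?w0//.
    by rewrite k_ge0// D_pos.
- have m0 : measurable_fun (Omega `\` Sp) (fun=> 0 : R) by exact: measurable_cst.
  apply: eq_measurable_fun m0 => z /set_mem [Oz nS].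
  by rewrite kernel_int_supp.
Qed.

Let integral_supp (F : borelRn R n -> \bar R) :
  (forall z, Omega z -> ~ ksupp z -> F z = 0%E) ->
  (\int[eta]_(z in Omega) F z = \int[eta]_(z in Sp) F z)%E.
Proof.
move=> F0; rewrite integral_mkcond [RHS]integral_mkcond; apply: eq_integral => z _.
rewrite /patch; case: ifPn => zO; case: ifPn => zS //.
- by apply: F0; [exact: set_mem|move=> h; move: zS; rewrite mem_set].
- by move: zS => /set_mem /ksupp_sub /mem_set; rewrite (negbTE zO).
Qed.

(** The Cauchy-Schwarz inequality for the measure [w t dt]; the last integral may be infinite for
    individual [z], hence the extended reals. *)
Lemma kernel_int_sqr z : Omega z -> leb.-integrable D (EFin \o w) ->
  ((kernel_int z ^+ 2)%:E <=
   (\int[leb]_(t in D) w t)%:E * \int[leb]_(t in D) (k t z ^+ 2 * w t)%:E)%E.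
Proof.
move=> Oz w_int; set A := \int[leb]_(t in D) w t; set B := kernel_int z.
have mkD : measurable_fun D (k^~ z).
  apply: (@measurable_funS _ _ _ _ Rpos) => //.
  apply: open_continuous_measurable_fun; first exact: interval_open.
  move=> t; rewrite inE /= in_itv/= andbT => t0; exact: k_cont.
have k2w0 t : D t -> 0 <= k t z ^+ 2 * w t by move=> Dt; rewrite mulr_ge0 ?sqr_ge0 ?w0.
set c := (\int[leb]_(t in D) (k t z ^+ 2 * w t)%:E)%E.
have c0 : (0 <= c)%E by apply: integral_ge0 => t Dt; rewrite lee_fin k2w0.
have A0 : 0 <= A by exact: Rintegral_ge0.
have [->|cfin] := eqVneq c +oo%E.
  (* The convention [0 * +oo = 0] makes this case delicate: [w] vanishes almost everywhere, and so
     must [B]. *)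
  have [A00|A00] := eqVneq A 0.
    suff -> : B = 0 by rewrite expr0n /= A00 mul0e.
    have h : ae_eq leb D (EFin \o w) (cst 0%E).
      apply/(ae_eq_integral_abs _ mD); first exact/measurable_EFinP.
      rewrite -[RHS]/(0%:E) -A00 /A /Rintegral fineK; last exact: integrable_fin_num.
      by apply: eq_integral => t /set_mem Dt /=; rewrite ger0_norm// w0.
    rewrite /B /kernel_int /Rintegral (@ae_eq_integral _ _ _ _ D (cst 0%E))//.
    - by rewrite integral0.
    - by apply/measurable_EFinP; exact: measurable_funM.
    - apply: filterS h => t /= h Dt; have := h Dt => -[->]; by rewrite mulr0.
  by rewrite gt0_muley ?leey// lte_fin lt0r A00.
have cf : c \is a fin_num by rewrite ge0_fin_numE// ltey.
have k2int : leb.-integrable D (fun t => (k t z ^+ 2 * w t)%:E).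
  apply/integrableP; split.
    by apply/measurable_EFinP; apply: measurable_funM => //; exact: measurable_funX.
  under eq_integral => t /set_mem Dt do rewrite /= ger0_norm ?k2w0//.
  by rewrite ltey.
rewrite -(fineK cf) -EFinM lee_fin; set c' := fine c.
have quad l : 0 <= c' - 2 * l * B + l ^+ 2 * A.
  have -> : c' - 2 * l * B + l ^+ 2 * A =
     \int[leb]_(t in D) ((k t z - l) ^+ 2 * w t).
    rewrite /B /kernel_int /A -!RintegralZl//; last exact: kw_int.
    have i1 : leb.-integrable D (EFin \o (fun t => 2 * l * (k t z * w t))).
      apply: eq_integrable (integrableZl mD (2 * l) (kw_int Oz)) => // t _.
    have i2 : leb.-integrable D (EFin \o (fun t => l ^+ 2 * w t)).
      apply: eq_integrable (integrableZl mD (l ^+ 2) w_int) => // t _.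
    rewrite -RintegralB// -RintegralD//.
      by apply: eq_Rintegral => t _; ring.
    apply: eq_integrable (integrableB mD k2int i1) => // t _ /=.
  by apply: Rintegral_ge0 => t Dt; rewrite mulr_ge0 ?sqr_ge0 ?w0.
have [A00|An0] := eqVneq A 0.
  have [B0|Bn0] := eqVneq B 0; first by rewrite A00 B0 mul0r expr0n.
  have := quad ((c' + 1) / (2 * B)); rewrite A00 mulr0 addr0.
  have -> : 2 * ((c' + 1) / (2 * B)) * B = c' + 1 by field.
  lra.
have := quad (B / A).
have -> : c' - 2 * (B / A) * B + (B / A) ^+ 2 * A = c' - B ^+ 2 / A by field.
by rewrite subr_ge0 ler_pdivrMr ?lt0r ?An0// mulrC.
Qed.

(** Integrating [kernel_int_sqr] over [z] and exchanging integrals by Tonelli leaves the integral of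
    [w t |k t|^2], which [k_bnd] controls. *)
Lemma L2_kernel_int : leb.-integrable D (EFin \o w) ->
  leb.-integrable D (fun t => (w t * (1 + t `^ (- eps)) ^+ 2)%:E) -> L2 kernel_int.
Proof.
move=> w_int w2_int; split; first exact: measurable_kernel_int.
apply/integrableP; split.
  by apply/measurable_EFinP/measurable_funX; exact: measurable_kernel_int.
have -> : (\int[eta]_(z in Omega) `|(kernel_int z ^+ 2)%:E| =
           \int[eta]_(z in Sp) (kernel_int z ^+ 2)%:E)%E.
  rewrite -integral_supp; last by move=> z Oz nS; rewrite kernel_int_supp// expr0n.
  by apply: eq_integral => z _ /=; rewrite ger0_norm ?sqr_ge0.
set A := \int[leb]_(t in D) w t.
have A0 : 0 <= A by exact: Rintegral_ge0.
pose G (p : measurableTypeR R * borelRn R n) := (k p.1 p.2 ^+ 2 * w p.1)%:E.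
have mG : measurable_fun (D `*` Sp) G.
  by apply/measurable_EFinP; apply: measurable_funM => //; exact: measurable_funX.
have G0 p : (D `*` Sp) p -> (0 <= G p)%E.
  by case: p => t z [/= Dt _]; rewrite lee_fin mulr_ge0 ?sqr_ge0 ?w0.
have mI := @measurable_restricted_tonelli _ _ _ Sp mSp D mD G mG G0.
apply: (@le_lt_trans _ _ (\int[eta]_(z in Sp) (A%:E * \int[leb]_(t in D) G (t, z)))%E).
  apply: ge0_le_integral => //.
  - by move=> z _; rewrite lee_fin sqr_ge0.
  - apply/measurable_EFinP/measurable_funX.
    by apply: measurable_funS measurable_kernel_int => //; exact: ksupp_sub.
  - exact: measurable_funeM.
  - by move=> z /ksupp_sub Oz; exact: kernel_int_sqr.
rewrite ge0_integralZl//; last by move=> z Sz; apply: integral_ge0 => t Dt; exact: G0.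
rewrite -(@restricted_tonelli _ _ _ eta Sp mSp ksupp_piece erefl
  measurable_ksupp_piece fin_ksupp_piece D mD G mG G0).
apply: lte_mul_pinfty => //.
apply: (@le_lt_trans _ _ (\int[leb]_(t in D)
   ((C ^+ 2)%:E * (w t * (1 + t `^ (- eps)) ^+ 2)%:E))%E); last first.
  rewrite integralZl//; apply: lte_mul_pinfty => //; first by rewrite lee_fin sqr_ge0.
  by move/integrableP: (w2_int) => [_]; apply: le_lt_trans; apply: le_integral => //;
    [exact: integrable_abse|move=> t _; exact: lee_abs].
have inn t : D t -> (\int[eta]_(z in Sp) G (t, z) = (w t * inner (k t) (k t))%:E)%E.
  move=> Dt; rewrite -integral_supp; last first.
    by move=> z Oz nS; rewrite /G /= k_eq0 ?expr0n ?mul0r//; exact: D_pos.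
  have kk := L2_mul_integrable mO (k_L2 (D_pos Dt)) (k_L2 (D_pos Dt)).
  rewrite EFinM /Defs.inner /Rintegral fineK; last exact: integrable_fin_num.
  rewrite -integralZl//; apply: eq_integral => z _; rewrite /G /=.
  by rewrite -EFinM; congr EFin; ring.
apply: ge0_le_integral => //.
- by move=> t Dt; apply: integral_ge0 => z Sz; exact: G0.
- exact: (@measurable_restricted_tonelli_F _ _ _ eta Sp mSp ksupp_piece erefl
    measurable_ksupp_piece fin_ksupp_piece D mD G mG G0).
- apply: measurable_funeM; exact: measurable_int w2_int.
- move=> t Dt; rewrite inn// -EFinM lee_fin mulrCA -exprMn ler_wpM2l ?w0//.
  rewrite -L2norm_sqr ler_pXn2r ?nnegrE ?L2norm_ge0//; first exact: k_bnd (D_pos Dt).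
  by rewrite mulr_ge0// addr_ge0 ?powR_ge0.
Qed.

(** Fubini's theorem; absolute convergence follows from [<k t, |f|> <= |k t| |f|] and [k_bnd]. *)
Lemma inner_kernel_int f : L2 f ->
  leb.-integrable D (fun t => (w t * (1 + t `^ (- eps)))%:E) ->
  inner kernel_int f = \int[leb]_(t in D) (w t * inner (k t) f).
Proof.
move=> Lf w1_int; have mf := L2_meas Lf.
pose G (p : measurableTypeR R * borelRn R n) := (k p.1 p.2 * w p.1 * f p.2)%:E.
have mG : measurable_fun (D `*` Sp) G.
  apply/measurable_EFinP; apply: measurable_funM; first exact: measurable_funM.
  exact: mfDS.
have inn g t : L2 g -> D t ->
    (\int[eta]_(z in Sp) (k t z * w t * g z)%:E = (w t * inner (k t) g)%:E)%E.
  move=> Lg Dt; rewrite -integral_supp; last first.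
    by move=> z Oz nS; rewrite k_eq0 ?mul0r//; exact: D_pos.
  have kk := L2_mul_integrable mO (k_L2 (D_pos Dt)) Lg.
  rewrite EFinM /Defs.inner /Rintegral fineK; last exact: integrable_fin_num.
  rewrite -integralZl//; apply: eq_integral => z _.
  by rewrite -EFinM; congr EFin; ring.
have fin : (\int[leb]_(t in D) \int[eta]_(z in Sp) `|G (t, z)| < +oo)%E.
  apply: (@le_lt_trans _ _ (\int[leb]_(t in D)
     ((C * L2norm f)%:E * (w t * (1 + t `^ (- eps)))%:E))%E); last first.
    rewrite integralZl//; apply: lte_mul_pinfty => //.
      by rewrite lee_fin mulr_ge0 ?L2norm_ge0.
    exact: integrable_lty.
  have mGa : measurable_fun (D `*` Sp) (fun p => `|G p|%E) by exact: measurableT_comp.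
  apply: ge0_le_integral => //.
  - by move=> t Dt; apply: integral_ge0 => z Sz.
  - exact: (@measurable_restricted_tonelli_F _ _ _ eta Sp mSp ksupp_piece erefl
      measurable_ksupp_piece fin_ksupp_piece D mD _ mGa).
  - apply: measurable_funeM; exact: measurable_int w1_int.
  - move=> t Dt.
    have -> : (\int[eta]_(z in Sp) `|G (t, z)| = (w t * inner (k t) (fun z => `|f z|))%:E)%E.
      rewrite -(inn (fun z => `|f z|))//; last exact: L2_norm.
      apply: eq_integral => z /set_mem /ksupp_sub Oz; rewrite /G /= !normrM.
      by rewrite (ger0_norm (k_ge0 (D_pos Dt) Oz)) (ger0_norm (w0 Dt)).
    rewrite -EFinM lee_fin mulrCA ler_wpM2l ?w0//.
    apply: (le_trans (inner_le mO (k_L2 (D_pos Dt)) (L2_norm mO Lf))).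
    by rewrite L2norm_norm mulrAC ler_wpM2r ?L2norm_ge0// k_bnd// D_pos.
rewrite /Defs.inner {1}/Rintegral integral_supp; last first.
  by move=> z Oz nS; rewrite kernel_int_supp// mul0r.
have -> : (\int[eta]_(z in Sp) (kernel_int z * f z)%:E =
   \int[eta]_(z in Sp) \int[leb]_(t in D) G (t, z))%E.
  apply: eq_integral => z /set_mem /ksupp_sub Oz.
  rewrite EFinM /kernel_int /Rintegral fineK; last by apply: integrable_fin_num => //; exact: kw_int.
  by rewrite -integralZr//; exact: kw_int.
rewrite -(@restricted_fubini _ _ _ eta Sp mSp ksupp_piece erefl
  measurable_ksupp_piece fin_ksupp_piece D mD G mG fin).
by congr fine; apply: eq_integral => t /set_mem Dt; rewrite (inn f).
Qed.

End kernel.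

(** * Integrals of powers times exponentials *)

Section weights.
Context {R : realType}.
Implicit Types a b c t : R.
Local Notation leb := (@lebesgue_measure R).

(** With [c = y^2 / 4], the exponent [a = 1 - s] is the weight in [Psi]. Differentiation in [t] or
    in [c] stays in the span of this family and only raises [a]. *)
Definition W a c t : R := t `^ (- a) * expR (- (c / t)).

Lemma W_ge0 a c t : 0 <= W a c t.
Proof. by rewrite mulr_ge0 ?powR_ge0 ?expR_ge0. Qed.

Lemma powR_decr a t : 0 < t -> t `^ (- (a + 1)) = t `^ (- a) / t.
Proof.
move=> t0; rewrite opprD powRD ?powR_inv1 ?(ltW t0)//.
by apply/implyP => _; rewrite gt_eqF.
Qed.

Lemma WS a c t : 0 < t -> W (a + 1) c t = t^-1 * W a c t.
Proof. by move=> t0; rewrite /W powR_decr// mulrAC mulrC. Qed.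

Lemma is_derive_exp_inv c t : 0 < t ->
  is_derive t 1 (fun t : R => expR (- (c / t))) (c / t ^+ 2 * expR (- (c / t))).
Proof.
move=> t0; have tn0 : t != 0 by rewrite gt_eqF.
have h1 : is_derive t 1 (fun t : R => t^-1) (- t ^- 2 *: 1).
  by apply: is_deriveV.
have h2 : is_derive t 1 (fun t : R => - (c / t)) (c / t ^+ 2).
  have h3 := is_deriveN (is_deriveZ c h1).
  apply: is_derive_eq h3 _.
  by rewrite /GRing.scale /= mulr1 mulrN opprK.
have := @is_derive1_comp _ expR (fun t : R => - (c / t)) t _ _ (is_derive_expR _) h2.
by move=> h; apply: is_derive_eq h _; rewrite mulrC.
Qed.

Lemma is_derive_W a c t : 0 < t ->
  is_derive t 1 (W a c) (c * W (a + 1 + 1) c t - a * W (a + 1) c t).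
Proof.
move=> t0; have tn0 : t != 0 by rewrite gt_eqF.
have h1 := is_derive1_powR (- a) t0.
have h2 := is_derive_exp_inv c t0.
have h := is_deriveM h1 h2.
apply: is_derive_eq h _; rewrite /GRing.scale /=.
have e : - a - 1 = - (a + 1) by rewrite opprD.
rewrite !WS// /W e powR_decr//.
by field.
Qed.

Lemma continuous_W a c t : 0 < t -> {for t, continuous (W a c)}.
Proof.
move=> t0; apply/differentiable_continuous/derivable1_diffP.
by have [] := is_derive_W a c t0.
Qed.

Lemma measurable_W a c : measurable_fun (`]0, +oo[%classic : set R) (W a c).
Proof.
apply: open_continuous_measurable_fun; first exact: interval_open.
by move=> t; rewrite inE /= in_itv /= andbT => t0; exact: continuous_W.
Qed.

Lemma cvg_powRN_pinfty b : 0 < b -> t `^ (- b) @[t --> +oo] --> (0 : R).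
Proof.
move=> b0; apply/cvgr0Pnorm_le => e e0; near=> t.
have M0 : 0 < e `^ (- b^-1) by rewrite powR_gt0.
have t0 : e `^ (- b^-1) <= t by near: t; apply: nbhs_pinfty_ge; rewrite num_real.
have tt0 : 0 < t by exact: lt_le_trans t0.
rewrite ger0_norm ?powR_ge0// powRN invf_ple ?posrE ?powR_gt0//.
have -> : e^-1 = (e `^ (- b^-1)) `^ b.
  by rewrite -powRrM mulNr mulVf ?gt_eqF// powR_inv1// ltW.
by rewrite ge0_ler_powR ?nnegrE// ltW.
Unshelve. all: by end_near. Qed.

Lemma W_bounded_near0 a c : 0 < c ->
  exists2 M : R, 0 <= M & forall t, 0 < t -> t <= 1 -> W a c t <= M.
Proof.
(* Raising [a] to [b >= 1] only increases [t^(-a)] for [t <= 1]. The constant [M = (c / b)^(-b)]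
   comes from [ln x <= x] at [x = c / (b t)]. *)
move=> c0; pose b := Num.max a 1.
have b0 : 0 < b by rewrite lt_max ltr01 orbT.
pose M := expR (- b * ln (c / b)).
exists M; first exact: expR_ge0.
move=> t t0 t1; apply: (@le_trans _ _ (W b c t)).
  rewrite /W ler_wpM2r ?expR_ge0//; apply: ger_powR; first by rewrite t0 t1.
  by rewrite lerN2 le_max lexx.
rewrite /W /powR gt_eqF// -expRD ler_expR.
have cb : 0 < c / b by rewrite divr_gt0.
have x0 : 0 < c / b / t by rewrite divr_gt0.
have : ln (c / b / t) <= c / b / t.
  rewrite -{2}(lnK (x := c / b / t)) ?posrE//.
  by apply: le_trans (expR_ge1Dx _); rewrite lerDr.
rewrite lnM ?posrE ?invr_gt0// lnV ?posrE// => h.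
have := ler_wpM2l (ltW b0) h.
rewrite (_ : b * (c / b / t) = c / t); last by field; rewrite !gt_eqF.
lra.
Qed.

(** Near [0] the exponential keeps [W] bounded; on []1, +oo[] it is at most [t^(-a)], integrable
    because [1 < a]. *)
Lemma integrable_W a c : 1 < a -> 0 < c ->
  leb.-integrable `]0, +oo[ (EFin \o W a c).
Proof.
move=> a1 c0.
have -> : `]0, +oo[%classic = `]0, 1] `|` `]1, +oo[ :> set R.
  by rewrite -itv_bndbnd_setU// bnd_simp.
have mW1 : measurable_fun (`]0, 1]%classic : set R) (W a c).
  apply: measurable_funS (measurable_W a c) => //.
  by apply: subset_itvl.
have mW2 : measurable_fun (`]1, +oo[%classic : set R) (W a c).
  apply: measurable_funS (measurable_W a c) => //.
  by apply: subset_itvr; rewrite bnd_simp.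
have [M M0 HM] := W_bounded_near0 a c0.
apply/integrableP; split.
  by apply/measurable_funU => //; split; apply/measurable_EFinP.
rewrite ge0_integral_setU//=; last 2 first.
- apply/measurable_EFinP/measurableT_comp => //.
  by apply/measurable_funU.
- rewrite disj_set2E; apply/eqP/seteqP; split => // t /=.
  rewrite !in_itv /= => -[/andP[_ t1] /andP[]]; by rewrite ltNge t1.
apply: lte_add_pinfty.
- apply: (@le_lt_trans _ _ (\int[leb]_(t in `]0%R, 1%R]) (cst M%:E t))%E).
    apply: ge0_le_integral => //.
    + by do 2 apply: measurableT_comp => //.
    + move=> t /=; rewrite in_itv/= => /andP[t0 t1]; rewrite lee_fin ger0_norm ?W_ge0//.
      exact: HM.
  by rewrite integral_cst//= lebesgue_measure_itv /= lte_fin ltr01 -EFinB -EFinM ltry.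
- apply: (@le_lt_trans _ _ (\int[leb]_(t in `[1%R, +oo[) (t `^ (- a))%:E)%E).
    rewrite -integral_itv_obnd_cbnd; last first.
      apply/measurable_EFinP; apply: measurable_funTS; exact: measurable_powR.
    apply: ge0_le_integral => //.
    + by do 2 apply: measurableT_comp => //.
    + by apply/measurable_EFinP; apply: measurable_funTS; exact: measurable_powR.
    + move=> t /=; rewrite in_itv/= andbT => t1; rewrite lee_fin ger0_norm ?W_ge0//.
      have t0 : 0 < t by exact: lt_trans t1.
      rewrite /W ler_piMr ?powR_ge0// -expR0 ler_expR oppr_le0 divr_ge0// ltW//.
  have an0 : 1 - a != 0 by rewrite subr_eq0 lt_eqF.
  have dF t : 0 < t -> is_derive t 1 (fun t : R => (1 - a)^-1 * t `^ (1 - a)) (t `^ (- a)).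
    move=> t0; have h := is_deriveZ (1 - a)^-1 (is_derive1_powR (1 - a) t0).
    apply: is_derive_eq h _; rewrite /GRing.scale /= mulrA mulVf// mul1r.
    by congr (_ `^ _); ring.
  rewrite (@ge0_continuous_FTC2y _ _ (fun t : R => (1 - a)^-1 * t `^ (1 - a)) 1 0).
  + by rewrite -EFinB ltry.
  + by move=> t _; exact: powR_ge0.
  + apply: continuous_in_subspaceT => t; rewrite inE /= in_itv/= andbT => t1.
    have t0 : 0 < t by exact: lt_le_trans t1.
    apply/differentiable_continuous/derivable1_diffP.
    by have [] := is_derive1_powR (- a) t0.
  + rewrite -[X in _ --> X](mulr0 (1 - a)^-1); apply: cvgMr.
    rewrite (_ : 1 - a = - (a - 1)); last by ring.
    by apply: cvg_powRN_pinfty; rewrite subr_gt0.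
  + by move=> t t1; have [] := dF t (lt_trans ltr01 t1).
  + have c1 : {for 1, continuous (fun t : R => (1 - a)^-1 * t `^ (1 - a))}.
      apply/differentiable_continuous/derivable1_diffP.
      by have [] := dF 1 ltr01.
    by apply: cvg_at_right_filter; exact: c1.
  + move=> t; rewrite in_itv/= andbT => t1; rewrite derive1E.
    by have [_ ->] := dF t (lt_trans ltr01 t1).
Qed.

(** This exhaustion is adapted to the substitution [t -> c / t], which exchanges the intervals for
    [1] with those for [c]. *)
Lemma bigcup_itv_inv c : 0 < c ->
  \bigcup_m `[c / m.+1%:R, c * m.+1%:R]%classic = (`]0, +oo[%classic : set R).
Proof.
move=> c0; apply/seteqP; split => [t [m _] /=|t /=]; rewrite !in_itv /= ?andbT.
  by move=> /andP[h _]; apply: lt_le_trans h; rewrite divr_gt0.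
move=> t0; pose N := Num.truncn (Num.max (c / t) (t / c)).
have := truncnS_gt (Num.max (c / t) (t / c)); rewrite gt_max => /andP[h1 h2].
exists N => //=; rewrite in_itv /= ler_pdivrMr// -ler_pdivrMl// (mulrC t^-1) (ltW h1) /=.
by rewrite mulrC -ler_pdivrMr// ltW.
Qed.

Lemma nondecreasing_itv_inv c : 0 < c ->
  nondecreasing_seq (fun m : nat => `[c / m.+1%:R, c * m.+1%:R]%classic : set R).
Proof.
move=> c0 i j ij; rewrite subsetEset => t /=; rewrite !in_itv/= => /andP[h1 h2].
apply/andP; split.
- by apply: le_trans h1; rewrite ler_pM2l// lef_pV2 ?posrE// ler_nat ltnS.
- by apply: (le_trans h2); rewrite ler_pM2l// ler_nat ltnS.
Qed.

(** [W a c t] is [t] times [W (a + 1) c t], and the latter is bounded near [0]. *)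
Lemma cvg_W_inv a c : 0 < c -> W a c (1 / m.+1%:R) @[m --> \oo] --> (0 : R).
Proof.
move=> c0; have [M M0 HM] := W_bounded_near0 (a + 1) c0.
apply: (@squeeze_cvgr _ _ _ _ (fun=> 0) (fun m => M * m.+1%:R^-1)).
- apply: nearW => m; rewrite W_ge0 /=.
  have t0 : 0 < 1 / m.+1%:R :> R by rewrite divr_gt0.
  have t1 : 1 / m.+1%:R <= 1 :> R by rewrite div1r invf_le1 ?ler1n.
  have := HM _ t0 t1; rewrite WS// => h.
  by move: h; rewrite ler_pdivrMl// => /le_trans; apply; rewrite div1r mulrC.
- exact: cvg_cst.
- rewrite -[X in _ --> X](mulr0 M); apply: cvgMr; exact: cvg_harmonic.
Qed.

Lemma cvg_W_nat a c : 0 < a -> 0 < c -> W a c (1 * m.+1%:R) @[m --> \oo] --> (0 : R).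
Proof.
move=> a0 c0.
apply: (@squeeze_cvgr _ _ _ _ (fun=> 0) (fun m => m.+1%:R `^ (- a))).
- apply: nearW => m; rewrite W_ge0 /= mul1r /W ler_piMr ?powR_ge0//.
  by rewrite -expR0 ler_expR oppr_le0 divr_ge0// ltW.
- exact: cvg_cst.
- have h := cvg_powRN_pinfty a0.
  have h2 : (m.+1%:R : R) @[m --> \oo] --> +oo.
    by rewrite (cvg_shiftS (fun m => m%:R : R)); exact: cvgr_idn.
  exact: (cvg_comp _ _ h2 h).
Qed.

Lemma W_powR a b c t : 0 < t -> W a c t * t `^ (- b) = W (a + b) c t.
Proof.
move=> t0; rewrite /W opprD powRD; last by apply/implyP => _; rewrite gt_eqF.
by rewrite mulrAC.
Qed.

Lemma integrable_W1 a b c : 1 < a -> 0 < b -> 0 < c ->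
  leb.-integrable `]0, +oo[ (fun t => (W a c t * (1 + t `^ (- b)))%:E).
Proof.
move=> a1 b0 c0.
have ab1 : 1 < a + b by lra.
have mI : measurable (`]0, +oo[%classic : set (measurableTypeR R)) by exact: measurable_itv.
apply: eq_integrable (integrableD mI (integrable_W a1 c0) (integrable_W ab1 c0)) => // t.
rewrite inE /= in_itv /= andbT => t0; rewrite -EFinD; congr EFin.
by rewrite mulrDr mulr1 W_powR.
Qed.

Lemma integrable_W2 a b c : 1 < a -> 0 < b -> 0 < c ->
  leb.-integrable `]0, +oo[ (fun t => (W a c t * (1 + t `^ (- b)) ^+ 2)%:E).
Proof.
move=> a1 b0 c0.
have ab1 : 1 < a + b by lra.
have mI : measurable (`]0, +oo[%classic : set (measurableTypeR R)) by exact: measurable_itv.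
apply: eq_integrable (integrableD mI (integrable_W1 a1 b0 c0) (integrable_W1 ab1 b0 c0)) => // t.
rewrite inE /= in_itv /= andbT => t0; rewrite -EFinD; congr EFin.
by rewrite -W_powR//; ring.
Qed.

(** The substitution [r = c / t] turns [r^(-s) e^(-r) dr] into [c^(1-s) t^(s-2) e^(-c/t) dt]. It is
    made on compact intervals, and monotone convergence gives the half-line. *)
Lemma integral_W_Gamma s c : s < 1 -> 0 < c ->
  \int[leb]_(t in `]0, +oo[) W (2 - s) c t = c `^ (s - 1) * Gamma (1 - s).
Proof.
move=> s1 c0.
pose G (r : R) := r `^ (- s) * expR (- r).
have cG (r : R) : 0 < r -> {for r, continuous G}.
  move=> r0; apply/differentiable_continuous/derivable1_diffP.
  have h1 := is_derive1_powR (- s) r0.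
  have h2 : is_derive r 1 (fun r : R => - r) (- 1).
    by apply: is_deriveN; exact: is_derive_id.
  have h3 := @is_derive1_comp _ expR (fun t : R => - t) r _ _ (is_derive_expR _) h2.
  by have [] := is_deriveM h1 h3.
have mG : measurable_fun (`]0, +oo[%classic : set R) G.
  apply: open_continuous_measurable_fun; first exact: interval_open.
  by move=> t; rewrite inE /= in_itv /= andbT => t0; exact: cG.
have sub m d : 0 < d -> `[d / m.+1%:R, d * m.+1%:R] `<=` (`]0, +oo[%classic : set R).
  move=> d0 t /=; rewrite !in_itv /= andbT => /andP[h _].
  by apply: lt_le_trans h; rewrite divr_gt0.
have key m : (\int[leb]_(r in `[(c / m.+1%:R)%R, (c * m.+1%:R)%R]) (G r)%:E =
    \int[leb]_(t in `[(1 / m.+1%:R)%R, (1 * m.+1%:R)%R])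
      ((c `^ (1 - s))%:E * (W (2 - s) c t)%:E))%E.
  pose F (t : R) := c / t.
  have dF (t : R) : 0 < t -> is_derive t 1 F (- c / t ^+ 2).
    move=> t0; have tn0 : t != 0 by rewrite gt_eqF.
    have h1 : is_derive t 1 (fun t : R => t^-1) (- t ^- 2 *: 1) by apply: is_deriveV.
    apply: is_derive_eq (is_deriveZ c h1) _.
    by rewrite /GRing.scale /= mulr1 mulrN mulNr.
  have F'E (t : R) : 0 < t -> (derive1 F) t = - c / t ^+ 2.
    by move=> t0; rewrite derive1E; have [_ ->] := dF t t0.
  have m10 : 0 < 1 / m.+1%:R :> R by rewrite divr_gt0.
  have m20 : 0 < 1 * m.+1%:R :> R by rewrite mulr_gt0.
  have m12 : 1 / m.+1%:R <= 1 * m.+1%:R :> R.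
    by rewrite !mul1r; apply: (@le_trans _ _ 1); rewrite ?invf_le1 ?ler1n.
  have cF' (t : R) : 0 < t -> {for t, continuous (derive1 F)}.
    move=> t0; have tn0 : t != 0 by rewrite gt_eqF.
    have h : {near nbhs t, (fun t : R => - c / t ^+ 2) =1 derive1 F}.
      near=> u; symmetry; apply: F'E; near: u; exact: lt_nbhsr.
    suff : derive1 F u @[u --> t] --> derive1 F t by [].
    rewrite F'E//; move/near_eq_cvg/cvg_trans : h; apply.
    apply: cvgMr; apply: cvgV; first by rewrite expf_neq0.
    exact: exprn_continuous.
  have Fm1 : F (1 / m.+1%:R) = c * m.+1%:R by rewrite /F div1r invrK.
  have Fm2 : F (1 * m.+1%:R) = c / m.+1%:R by rewrite /F mul1r.
  have LR : derivable_oo_LRcontinuous F (1 / m.+1%:R) (1 * m.+1%:R).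
    split.
    - move=> t; rewrite in_itv /= => /andP[t1 _].
      by have [] := dF t (lt_trans m10 t1).
    - apply: cvg_at_right_filter; apply/differentiable_continuous/derivable1_diffP.
      by have [] := dF _ m10.
    - apply: cvg_at_left_filter; apply/differentiable_continuous/derivable1_diffP.
      by have [] := dF _ m20.
  rewrite -Fm1 -Fm2 integration_by_substitution_decreasing//.
  - apply: eq_integral => t; rewrite inE /= in_itv /= => /andP[t1 _].
    have t0 : 0 < t by exact: lt_le_trans t1.
    rewrite -EFinM; congr EFin.
    rewrite [LHS](_ : _ = G (F t) * - (derive1 F t))// F'E// /G /F /W.
    have tn0 : t != 0 by rewrite gt_eqF.
    have e1 : (c / t) `^ (- s) = c `^ (- s) * t `^ s.
      rewrite powRM ?invr_ge0 ?(ltW c0) ?(ltW t0)// -(powR_inv1 (ltW t0)) -powRrM.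
      by rewrite mulN1r opprK.
    have e2 : c `^ (1 - s) = c * c `^ (- s).
      by rewrite powRD ?powRr1 ?(ltW c0)//; apply/implyP => _; rewrite gt_eqF.
    have e3 : t `^ (- (2 - s)) = t `^ s / t ^+ 2.
      rewrite opprB powRD ?powR_invn ?(ltW t0)//; by apply/implyP.
    by rewrite e1 e2 e3; field.
  - move=> t u; rewrite !in_itv /= => /andP[t1 _] /andP[u1 _] tu.
    have u0 : 0 < u by exact: lt_le_trans u1.
    by rewrite /F ltr_pM2l// ltf_pV2 ?posrE// (lt_trans u0).
  - by move=> t; rewrite in_itv /= => /andP[t1 _]; apply/cF'/(lt_trans m10).
  - apply: cvgP; apply: cvg_at_right_filter; exact: cF'.
  - apply: cvgP; apply: cvg_at_left_filter; exact: cF'.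
  - rewrite Fm1 Fm2; apply: continuous_in_subspaceT => t; rewrite inE => /sub.
    by rewrite /= in_itv /= andbT => /(_ c0); exact: cG.
have c1 : (\int[leb]_(r in `[(c / m.+1%:R)%R, (c * m.+1%:R)%R]) (G r)%:E
    @[m --> \oo] --> \int[leb]_(r in `]0%R, +oo[) (G r)%:E)%E.
  rewrite -(bigcup_itv_inv c0); apply: ge0_nondecreasing_set_cvg_integral => //.
  - exact: nondecreasing_itv_inv.
  - by move=> m; apply: measurable_funS (sub m c c0) _ => //; apply/measurable_EFinP.
  - by move=> i r _; rewrite lee_fin mulr_ge0 ?powR_ge0 ?expR_ge0.
have mW := measurable_W (2 - s) c.
have c2 : (\int[leb]_(t in `[(1 / m.+1%:R)%R, (1 * m.+1%:R)%R])
      ((c `^ (1 - s))%:E * (W (2 - s) c t)%:E)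
    @[m --> \oo] --> \int[leb]_(t in `]0%R, +oo[) ((c `^ (1 - s))%:E * (W (2 - s) c t)%:E))%E.
  rewrite -(bigcup_itv_inv ltr01); apply: ge0_nondecreasing_set_cvg_integral => //.
  - exact: nondecreasing_itv_inv.
  - move=> m; apply: measurable_funS (sub m 1 ltr01) _ => //.
    by apply: measurable_funeM; apply/measurable_EFinP.
  - by move=> i r _; rewrite -EFinM lee_fin mulr_ge0 ?powR_ge0 ?W_ge0.
have e : (\int[leb]_(r in `]0%R, +oo[) (G r)%:E =
   (c `^ (1 - s))%:E * \int[leb]_(t in `]0%R, +oo[) (W (2 - s) c t)%:E)%E.
  rewrite -ge0_integralZl//; last 3 first.
  - by apply/measurable_EFinP.
  - by move=> t _; rewrite lee_fin W_ge0.
  - by rewrite lee_fin powR_ge0.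
  rewrite -(cvg_lim _ c1)// -(cvg_lim _ c2)//.
  by congr (limn _); apply/funext => m; exact: key.
have iW : leb.-integrable `]0, +oo[ (EFin \o W (2 - s) c).
  by apply: integrable_W => //; lra.
have -> : Gamma (1 - s) = c `^ (1 - s) * \int[leb]_(t in `]0, +oo[) W (2 - s) c t.
  rewrite /Gamma (_ : 1 - s - 1 = - s); last by ring.
  by rewrite {1}/Rintegral e fineM//; exact: integrable_fin_num.
rewrite mulrA -powRD; last by apply/implyP => _; rewrite gt_eqF.
by rewrite (_ : s - 1 + (1 - s) = 0) ?powRr0 ?mul1r//; ring.
Unshelve. all: by end_near.
Qed.

End weights.

(** * Derivatives of Psi *)

Section Psi_derivatives.
Context {R : realType}.
Variable kap : R -> R.
Implicit Types a c t y : R.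
Local Notation leb := (@lebesgue_measure R).
Hypothesis mkap : measurable_fun (`]0, +oo[%classic : set R) kap.
Hypothesis kap0 : forall t, 0 < t -> 0 <= kap t.

Definition Pint a c : R := \int[leb]_(t in `]0, +oo[) (kap t * W a c t).

(** All [c > 0] at once, because raising the exponent [a] uses convergence at [c / 2]. *)
Definition Pconv a := forall c, 0 < c ->
  leb.-integrable `]0, +oo[ (fun t => (kap t * W a c t)%:E).

(** Half of the exponential absorbs the additional [1 / t]: [x e^(-x) <= 1] at [x = c / (2t)]. *)
Lemma W_succ_le a c t : 0 < c -> 0 < t -> W (a + 1) c t <= 2 / c * W a (c / 2) t.
Proof.
move=> c0 t0; have tn0 : t != 0 by rewrite gt_eqF.
have cn0 : c != 0 by rewrite gt_eqF.
rewrite WS// /W.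
have -> : - (c / t) = - (c / 2 / t) + - (c / 2 / t) by field.
rewrite expRD.
set x := c / 2 / t; have x0 : 0 < x by rewrite !divr_gt0.
have -> : t^-1 = 2 / c * x by rewrite /x; field; rewrite tn0 cn0.
have -> : 2 / c * x * (t `^ (- a) * (expR (- x) * expR (- x))) =
  2 / c * (t `^ (- a) * expR (- x)) * (x * expR (- x)) by ring.
rewrite -[leRHS]mulr1 -mulrA -[leRHS]mulrA ler_pM2l ?divr_gt0//.
rewrite ler_wpM2l ?mulr_ge0 ?powR_ge0 ?expR_ge0//.
rewrite expRN ler_pdivrMr ?expR_gt0// mul1r.
by apply: le_trans (expR_ge1Dx _); rewrite lerDr.
Qed.

Lemma measurable_kapW a c :
  measurable_fun (`]0, +oo[%classic : set R) (fun t => kap t * W a c t).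
Proof. by apply: measurable_funM => //; exact: measurable_W. Qed.

Lemma Pconv_succ a : Pconv a -> Pconv (a + 1).
Proof.
move=> cv c c0; have c20 : 0 < c / 2 by rewrite divr_gt0.
have mI : measurable (`]0, +oo[%classic : set (measurableTypeR R)) by exact: measurable_itv.
apply: (@le_integrable _ _ _ leb _ mI _ (fun t => ((2 / c)%:E * (kap t * W a (c / 2) t)%:E)%E)).
- by apply/measurable_EFinP; exact: measurable_kapW.
- move=> t /=; rewrite in_itv/= andbT => t0.
  have h1 b d : 0 <= kap t * W b d t by rewrite mulr_ge0 ?kap0 ?W_ge0.
  have h2 : 0 <= 2 / c by rewrite divr_ge0// ltW.
  rewrite lee_fin (ger0_norm (h1 _ _)) (ger0_norm (mulr_ge0 h2 (h1 _ _))).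
  by rewrite [leRHS]mulrCA ler_wpM2l ?kap0// W_succ_le.
- exact: (integrableZl mI (2 / c) (cv _ c20)).
Qed.

Lemma W_le_c a c c' t : c <= c' -> 0 < t -> W a c' t <= W a c t.
Proof.
move=> cc t0; rewrite /W ler_wpM2l ?powR_ge0// ler_expR lerN2.
by rewrite ler_pM2r// invr_gt0.
Qed.

Lemma is_derive_Pint a c : Pconv a -> 0 < c ->
  is_derive c 1 (Pint a) (- Pint (a + 1) c).
Proof.
move=> cv c0.
pose f (c t : R) := kap t * W a c t.
(* The derivative in [c] is largest in modulus at the left end [c / 2] of the interval. The absolute
   value makes [G] nonnegative for all real [t], while [kap0] speaks of [t > 0] only. *)
pose G (t : R) := `|kap t| * W (a + 1) (c / 2) t.
have mI : measurable (`]0, +oo[%classic : set (measurableTypeR R)) by exact: measurable_itv.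
have Ic : `](c / 2), (2 * c)[%classic c by rewrite /= in_itv /=; apply/andP; split; lra.
have Ipos x : `](c / 2), (2 * c)[%classic x -> 0 < x /\ c / 2 <= x.
  by rewrite /= in_itv /= => /andP[h _]; split; lra.
have intf x : `](c / 2), (2 * c)[%classic x -> leb.-integrable `]0, +oo[ (EFin \o f x).
  by move=> /Ipos[x0 _]; exact: cv.
have dW (x t : R) : 0 < t -> is_derive x 1 (f^~ t) (- (kap t * W (a + 1) x t)).
  move=> t0; have tn0 : t != 0 by rewrite gt_eqF.
  have h1 : is_derive x 1 (fun x : R => - (x / t)) (- t^-1).
    have := is_deriveZ (- t^-1) (is_derive_id x 1).
    move=> h; have : is_derive x 1 (fun x : R => - t^-1 * x) (- t^-1 * 1) by [].
    rewrite mulr1; congr is_derive; apply/funext => u.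
    by rewrite mulNr mulrC.
  have h2 := @is_derive1_comp _ expR (fun x : R => - (x / t)) x _ _ (is_derive_expR _) h1.
  have h3 := is_deriveZ (kap t * t `^ (- a)) h2.
  have e : (f^~ t) = (kap t * t `^ (- a)) \*: (expR \o (fun x : R => - (x / t))).
    by apply/funext => u; rewrite /f /W /= mulrA.
  rewrite e; apply: is_derive_eq h3 _.
  by rewrite /GRing.scale /= WS// /W; ring.
have derf x t : `](c / 2), (2 * c)[%classic x -> `]0, +oo[%classic t ->
    derivable (f^~ t) x 1.
  by move=> _; rewrite /= in_itv/= andbT => t0; have [] := dW x t t0.
have G0 t : 0 <= G t by rewrite mulr_ge0// W_ge0.
have c20 : 0 < c / 2 by rewrite divr_gt0.
have intG : leb.-integrable `]0, +oo[ (EFin \o G).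
  apply: eq_integrable (Pconv_succ cv c20) => // t; rewrite inE /= in_itv/= andbT => t0.
  by rewrite /G ger0_norm// kap0.
have d1E x t : 0 < t -> partial1of2 f x t = - (kap t * W (a + 1) x t).
  by move=> t0; rewrite partial1of2E; have [_ ->] := dW x t t0.
have G_ub x t : `](c / 2), (2 * c)[%classic x -> `]0, +oo[%classic t ->
    `|partial1of2 f x t| <= G t.
  move=> /Ipos[x0 cx]; rewrite /= in_itv/= andbT => t0; rewrite d1E// normrN normrM.
  by rewrite (ger0_norm (W_ge0 _ _ _)) ler_wpM2l// W_le_c.
apply: DeriveDef.
  exact: (derivable_under_integral mI Ic intf derf G0 intG G_ub).
rewrite -derive1E (differentiation_under_integral mI Ic intf derf G0 intG G_ub).
transitivity (\int[leb]_(t in `]0, +oo[) (-1 * (kap t * W (a + 1) c t))).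
  apply: eq_Rintegral => t; rewrite inE /= in_itv/= andbT => t0.
  by rewrite d1E// mulN1r.
by rewrite RintegralZl// ?mulN1r//; exact: Pconv_succ.
Qed.

End Psi_derivatives.

Section Psi_formulas.
Context {R : realType} {n : nat}.
Variables (K : R -> borelRn R n -> borelRn R n -> R) (s : R).
Variables (x z : borelRn R n).
Hypothesis mK : measurable_fun (`]0, +oo[%classic : set R) (fun t => K t x z).
Hypothesis K0 : forall t : R, 0 < t -> 0 <= K t x z.
Hypothesis cvK : forall y : R, 0 < y -> (@lebesgue_measure R).-integrable `]0, +oo[
      (fun t => (Psi_integrand K s x z y t)%:E).
Local Notation kap := (fun t => K t x z).

Lemma Psi_integrandE (y t : R) :
  Psi_integrand K s x z y t = K t x z * W (1 - s) (y ^+ 2 / 4) t.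
Proof.
rewrite /Psi_integrand /W powRN -!mulrA; congr (_ * _); rewrite mulrC; congr (_ * expR (- _)).
by rewrite invfM mulrA.
Qed.

Lemma PsiE (y : R) : Psi K s x z y = (Gamma s)^-1 * Pint kap (1 - s) (y ^+ 2 / 4).
Proof.
rewrite /Psi; congr (_ * _); apply: eq_Rintegral => t _; exact: Psi_integrandE.
Qed.

Lemma Psi_Pconv : Pconv kap (1 - s).
Proof.
move=> c c0; have y0 : 0 < 2 * Num.sqrt c by rewrite mulr_gt0 ?sqrtr_gt0.
have := cvK y0; congr (integrable _ _ _); apply/funext => t; congr EFin.
rewrite Psi_integrandE exprMn sqr_sqrtr ?(ltW c0)//.
by congr (_ * W _ _ _); field.
Qed.

Lemma is_derive_Pint_sqr a (y : R) : Pconv kap a -> 0 < y ->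
  is_derive y 1 (fun y : R => Pint kap a (y ^+ 2 / 4))
    (- Pint kap (a + 1) (y ^+ 2 / 4) * (y / 2)).
Proof.
move=> cv y0; have c0 : 0 < y ^+ 2 / 4 by rewrite divr_gt0 ?exprn_gt0.
have h1 : is_derive y 1 (fun y : R => y ^+ 2 / 4) (y / 2).
  have h := is_deriveZ (4^-1 : R) (is_deriveM (is_derive_id y 1) (is_derive_id y 1)).
  have e : (fun y : R => y ^+ 2 / 4) = 4^-1 \*: (id * id : R -> R).
    by apply/funext => u; rewrite mulrC.
  rewrite e; apply: is_derive_eq h _; rewrite /GRing.scale /=.
  by field.
exact: (@is_derive1_comp _ (Pint kap a) (fun y : R => y ^+ 2 / 4) y _ _
  (is_derive_Pint mK K0 cv c0) h1).
Qed.

Lemma is_derive_Psi (y : R) : 0 < y -> is_derive y 1 (Psi K s x z)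
  (- (Gamma s)^-1 * (y / 2 * Pint kap (1 - s + 1) (y ^+ 2 / 4))).
Proof.
move=> y0; have h := is_deriveZ (Gamma s)^-1 (is_derive_Pint_sqr Psi_Pconv y0).
have e : Psi K s x z = (Gamma s)^-1 \*: (fun y : R => Pint kap (1 - s) (y ^+ 2 / 4)).
  by apply/funext => u; rewrite PsiE.
rewrite e; apply: is_derive_eq h _; rewrite /GRing.scale /=; ring.
Qed.

Lemma derive1_Psi (y : R) : 0 < y -> derive1 (Psi K s x z) y =
  - (Gamma s)^-1 * (y / 2 * Pint kap (1 - s + 1) (y ^+ 2 / 4)).
Proof. by move=> y0; rewrite derive1E; have [_ ->] := is_derive_Psi y0. Qed.

Lemma is_derive_derive1_Psi (y : R) : 0 < y -> is_derive y 1 (derive1 (Psi K s x z))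
  (- (Gamma s)^-1 * (2^-1 * Pint kap (1 - s + 1) (y ^+ 2 / 4) -
     y ^+ 2 / 4 * Pint kap (1 - s + 1 + 1) (y ^+ 2 / 4))).
Proof.
move=> y0.
pose g (y : R) := - (Gamma s)^-1 * (y / 2 * Pint kap (1 - s + 1) (y ^+ 2 / 4)).
have dg : is_derive y 1 g (- (Gamma s)^-1 * (2^-1 * Pint kap (1 - s + 1) (y ^+ 2 / 4) -
     y ^+ 2 / 4 * Pint kap (1 - s + 1 + 1) (y ^+ 2 / 4))).
  have h1 := is_derive_Pint_sqr (Pconv_succ mK K0 Psi_Pconv) y0.
  have h2 := is_deriveZ (2^-1 : R) (is_derive_id y 1).
  have h := is_deriveZ (- (Gamma s)^-1) (is_deriveM h2 h1).
  have e : g = (- (Gamma s)^-1) \*: ((2^-1 \*: id) *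
    (fun y : R => Pint kap (1 - s + 1) (y ^+ 2 / 4))).
    by apply/funext => u; rewrite /g /= (mulrC u).
  rewrite e; apply: is_derive_eq h _; rewrite /GRing.scale /=; congr (_ * _).
  by rewrite -[2^-1 *: y]/(2^-1 * y); field.
have ne : {near y, g =1 derive1 (Psi K s x z)}.
  by near=> u; rewrite derive1_Psi//; near: u; exact: lt_nbhsr.
by apply: near_eq_is_derive dg.
Unshelve. all: by end_near. Qed.

(** With [a = 1 - s] and [c = y^2 / 4], the combination [c W (a + 2) - a W (a + 1)] is the time
    derivative of [W a c] given by [is_derive_W]: the Bessel operator in [y] acts on the weight as
    [d/dt]. *)
Lemma Psi_operator (y : R) : 0 < y ->
  (1 - 2 * s) / y * derive1 (Psi K s x z) y + derive1 (derive1 (Psi K s x z)) y =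
  (Gamma s)^-1 * (y ^+ 2 / 4 * Pint kap (1 - s + 1 + 1) (y ^+ 2 / 4)
     - (1 - s) * Pint kap (1 - s + 1) (y ^+ 2 / 4)).
Proof.
move=> y0; rewrite [derive1 (derive1 _) _]derive1E.
have [_ ->] := is_derive_derive1_Psi y0; rewrite derive1_Psi//.
by set g := (Gamma s)^-1; field; rewrite gt_eqF.
Qed.

End Psi_formulas.

(** * The equation satisfied by Psi *)

(** Since [f] has no sign, the truncations are dominated by [|f|] instead of being monotone. *)
Lemma cvg_Rintegral_nondecreasing_set d (T : measurableType d) (R : realType)
    (mu : {measure set T -> \bar R}) (F : (set T)^nat) (f : T -> R) :
  nondecreasing_seq F -> (forall i, measurable (F i)) ->
  mu.-integrable (\bigcup_i F i) (EFin \o f) ->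
  \int[mu]_(x in F i) f x @[i --> \oo] --> \int[mu]_(x in \bigcup_i F i) f x.
Proof.
move=> ndF mF fint; set U := \bigcup_i F i.
have mU : measurable U by exact: bigcupT_measurable.
have FU i : F i `<=` U by exact: bigcup_sup.
apply: fine_cvg; rewrite fineK; last exact: integrable_fin_num.
have e i : (\int[mu]_(x in F i) (f x)%:E = \int[mu]_(x in U) (((EFin \o f) \_ (F i)) x))%E.
  by rewrite -integral_mkcondr setIidr.
under eq_fun do rewrite e.
apply: (@dominated_cvg _ _ _ mu U mU _ _ (abse \o (EFin \o f))) => //.
- move=> i; apply/(measurable_restrict _ (mF i) mU).1.
  by apply: measurable_funS (measurable_int mu fint) => //; exact: subIsetl.
- move=> x [m _ Fx]; apply: cvg_near_cst; near=> i.
  rewrite patchE mem_set//.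
  have : F m `<=` F i by rewrite -subsetEset; apply: ndF; near: i; exact: nbhs_infty_ge.
  exact.
- exact: integrable_abse.
- move=> i x Ux; rewrite patchE; case: ifP => // _.
  by rewrite [leLHS]abse0; exact: abse_ge0.
Unshelve. all: by end_near. Qed.

(** * The heat equation tested against the domain of [L] *)

Section heat_kernel_facts.
Context {R : realType} {n : nat} {Omega : set (borelRn R n)}.
Context {eta : {measure set (borelRn R n) -> \bar R}}.
Hypothesis mO : measurable Omega.
Variables (L : operator R n).
Hypothesis hlin : linear_operator Omega eta L.
Hypothesis hself : self_adjoint Omega eta L.
Variable T : R -> (borelRn R n -> R) -> borelRn R n -> R.
Variable K : R -> borelRn R n -> borelRn R n -> R.
Hypothesis hK : heat_kernel Omega eta L T K.
Implicit Types f g h u v phi : borelRn R n -> R.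
Implicit Types x z : borelRn R n.

Local Notation L2 := (L2 Omega eta).
Local Notation inner := (inner Omega eta).
Local Notation L2norm := (L2norm Omega eta).
Local Notation leb := (@lebesgue_measure R).

Lemma dom_L2 u : dom L u -> L2 u. Proof. by case: hlin => h *; exact: h. Qed.

Lemma act_L2 u : dom L u -> L2 (L u). Proof. by case: hlin => _ h *; exact: h. Qed.

Lemma operator_sym u phi : dom L u -> dom L phi -> inner u (L phi) = inner (L u) phi.
Proof.
move=> du dphi.
have := (hself (dom_L2 du) (act_L2 du)).1; apply => //.
by split=> //; exact: aeW.
Qed.

Lemma K_dom (t : R) x : 0 < t -> Omega x -> dom L (K t x).
Proof. by case: hK => _ [h *]; exact: h. Qed.

Lemma K_L2 (t : R) x : 0 < t -> Omega x -> L2 (K t x).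
Proof. by move=> t0 Ox; exact/dom_L2/K_dom. Qed.

Lemma K_ge0 (t : R) x z : 0 < t -> Omega x -> Omega z -> 0 <= K t x z.
Proof. by case: hK => -[_ h _] _; exact: h. Qed.

Lemma K_sym (t : R) x z : 0 < t -> Omega x -> Omega z -> K t x z = K t z x.
Proof. by case: hK => -[_ _ h] _; exact: h. Qed.

Lemma K_cont (t : R) x z : 0 < t -> Omega x -> Omega z ->
  {for t, continuous (fun r => K r x z)}.
Proof.
move=> t0 Ox Oz; apply/differentiable_continuous/derivable1_diffP.
by case: hK => _ [_ h _ _ _]; exact: h.
Qed.

Lemma dtK_L2 (t : R) x : 0 < t -> Omega x -> L2 (dtK K t x).
Proof. by case: hK => _ [_ _ h _ _] t0 Ox; have [] := h t x t0 Ox. Qed.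

Lemma is_derive_inner_K (t : R) x f : 0 < t -> Omega x -> L2 f ->
  is_derive t 1 (fun r : R => inner (K r x) f) (inner (dtK K t x) f).
Proof. by case: hK => _ [_ _ _ h _]; exact: h. Qed.

Lemma continuous_inner_K (t : R) x f : 0 < t -> Omega x -> L2 f ->
  {for t, continuous (fun r : R => inner (K r x) f)}.
Proof.
move=> t0 Ox Lf; apply/differentiable_continuous/derivable1_diffP.
by have [] := is_derive_inner_K t0 Ox Lf.
Qed.

Lemma measurable_inner_K x f : Omega x -> L2 f ->
  measurable_fun (`]0, +oo[%classic : set R) (fun r : R => inner (K r x) f).
Proof.
move=> Ox Lf; apply: open_continuous_measurable_fun; first exact: interval_open.
by move=> t; rewrite inE /= in_itv /= andbT => t0; exact: continuous_inner_K.
Qed.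

Lemma measurable_K x z : Omega x -> Omega z ->
  measurable_fun (`]0, +oo[%classic : set R) (fun t => K t x z).
Proof.
move=> Ox Oz; apply: open_continuous_measurable_fun; first exact: interval_open.
by move=> t; rewrite inE /= in_itv /= andbT => t0; exact: K_cont.
Qed.

(** A more convenient form of the growth hypothesis: [(1 + t^eps) t^(-eps) = 1 + t^(-eps)], with
    [|C|] as a nonnegative constant. *)
Lemma K_bound x : Omega x -> exists C eps : R, [/\ 0 <= C, 0 < eps &
  forall t : R, 0 < t -> L2norm (K t x) <= C * (1 + t `^ (- eps)) /\
                         L2norm (dtK K t x) <= C * (1 + t `^ (- eps))].
Proof.
case: hK => _ [_ _ _ _ h] Ox; have [C [eps [eps0 bnd]]] := h x Ox.
exists `|C|, eps; split=> // t t0.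
have e : C * (1 + t `^ eps) * t `^ (- eps) = C * (1 + t `^ (- eps)).
  rewrite -mulrA mulrDl mul1r -powRD; last by apply/implyP => _; rewrite gt_eqF.
  by rewrite subrr powRr0 (addrC 1).
have := bnd t t0; rewrite e => b.
have k0 : 0 <= L2norm (K t x) by exact: L2norm_ge0.
have d0 : 0 <= L2norm (dtK K t x) by exact: L2norm_ge0.
have w0 : 0 <= 1 + t `^ (- eps) by rewrite addr_ge0// powR_ge0.
have := ler_wpM2r w0 (ler_norm C) => b2.
by split; lra.
Qed.

Variable x : borelRn R n.
Hypothesis Ox : Omega x.
Local Notation Rpos := (`]0, +oo[%classic : set (measurableTypeR R)).

Lemma inner_K_bound (C eps : R) f : L2 f ->
  (forall t : R, 0 < t -> L2norm (K t x) <= C * (1 + t `^ (- eps)) /\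
                         L2norm (dtK K t x) <= C * (1 + t `^ (- eps))) ->
  forall t : R, 0 < t -> `|inner (K t x) f| <= C * L2norm f * (1 + t `^ (- eps)).
Proof.
move=> Lf bnd t t0; apply: (le_trans (L2_CauchySchwarz mO (K_L2 t0 Ox) Lf)).
by rewrite mulrAC ler_wpM2r ?L2norm_ge0//; exact: (bnd t t0).1.
Qed.

Lemma integrable_W_inner_K a c f : 1 < a -> 0 < c -> L2 f ->
  leb.-integrable Rpos (fun t => (W a c t * inner (K t x) f)%:E).
Proof.
move=> a1 c0 Lf; have [C [eps [C0 eps0 bnd]]] := K_bound Ox.
have mI : measurable Rpos by exact: measurable_itv.
apply: (@le_integrable _ _ _ leb _ mI _ _ _ _
  (integrableZl mI (C * L2norm f) (integrable_W1 a1 eps0 c0))).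
- apply/measurable_EFinP; apply: measurable_funM; first exact: measurable_W.
  exact: measurable_inner_K.
- move=> t /=; rewrite in_itv /= andbT => t0.
  rewrite lee_fin normrM (ger0_norm (W_ge0 _ _ _)).
  apply: le_trans (ler_norm _); rewrite mulrCA ler_wpM2l ?W_ge0//.
  exact: inner_K_bound.
Qed.

(** The condition [1 < a] holds for the exponents [2 - s] and [3 - s] of the derivatives of [Psi],
    but not for the exponent [1 - s] of [Psi] itself. *)
Lemma L2_Pint a c : 1 < a -> 0 < c ->
  (forall z, Omega z -> Pconv (fun t => K t x z) a) ->
  L2 (fun z => Pint (fun t => K t x z) a c).
Proof.
move=> a1 c0 cv; have [C [eps [C0 eps0 bnd]]] := K_bound Ox.
apply: (@L2_kernel_int _ _ _ eta mO (fun t => K t x) _ _ _ C eps C0 _ Rpos (W a c)) => //.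
- by move=> t t0; exact: K_L2.
- by move=> t z t0 Oz; exact: K_cont.
- by move=> t z t0 Oz; exact: K_ge0.
- by move=> t t0; exact: (bnd t t0).1.
- by move=> t /=; rewrite in_itv /= andbT.
- exact: measurable_W.
- by move=> t _; exact: W_ge0.
- by move=> z Oz; exact: cv.
- exact: integrable_W.
- exact: integrable_W2.
Qed.

Lemma inner_Pint a c f : 1 < a -> 0 < c -> L2 f ->
  (forall z, Omega z -> Pconv (fun t => K t x z) a) ->
  inner (fun z => Pint (fun t => K t x z) a c) f =
  \int[leb]_(t in `]0, +oo[) (W a c t * inner (K t x) f).
Proof.
move=> a1 c0 Lf cv; have [C [eps [C0 eps0 bnd]]] := K_bound Ox.
apply: (@inner_kernel_int _ _ _ eta mO (fun t => K t x) _ _ _ C eps C0 _ Rpos (W a c)) => //.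
- by move=> t t0; exact: K_L2.
- by move=> t z t0 Oz; exact: K_cont.
- by move=> t z t0 Oz; exact: K_ge0.
- by move=> t t0; exact: (bnd t t0).1.
- by move=> t /=; rewrite in_itv /= andbT.
- exact: measurable_W.
- by move=> t _; exact: W_ge0.
- by move=> z Oz; exact: cv.
- exact: integrable_W1.
Qed.

Local Notation Itv m := (`[(1 / m.+1%:R), (1 * m.+1%:R)]%classic : set (measurableTypeR R)).

Lemma Itv_pos (m : nat) (t : R) : Itv m t -> 0 < t.
Proof. by rewrite /= in_itv /= => /andP[h _]; apply: lt_le_trans h; rewrite divr_gt0. Qed.

(** On a compact interval of positive times all the weights are integrable, so [a] is unrestricted
    and [a = 1 - s] is covered. *)
Lemma inner_Pint_trunc a c f m : 0 < c -> L2 f ->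
  (forall z, Omega z -> Pconv (fun t => K t x z) a) ->
  inner (kernel_int (fun t => K t x) (Itv m) (W a c)) f =
  \int[leb]_(t in Itv m) (W a c t * inner (K t x) f).
Proof.
move=> c0 Lf cv; have [C [eps [C0 eps0 bnd]]] := K_bound Ox.
have mI : measurable (Itv m) by exact: measurable_itv.
have sub : Itv m `<=` Rpos by move=> t /Itv_pos t0; rewrite /= in_itv /= andbT.
apply: (@inner_kernel_int _ _ _ eta mO (fun t => K t x) _ _ _ C eps C0 _ (Itv m) (W a c)) => //.
- by move=> t t0; exact: K_L2.
- by move=> t z t0 Oz; exact: K_cont.
- by move=> t z t0 Oz; exact: K_ge0.
- by move=> t t0; exact: (bnd t t0).1.
- by move=> t; exact: Itv_pos.
- by apply: measurable_funS (measurable_W a c).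
- by move=> t _; exact: W_ge0.
- by move=> z Oz; apply: integrableS (cv z Oz c c0) => //; exact: measurable_itv.
- apply: continuous_compact_integrable; first exact: segment_compact.
  apply: continuous_in_subspaceT => t /set_mem /Itv_pos t0.
  apply: (@continuousM _ _ (W a c) (fun t => 1 + t `^ (- eps))); first exact: continuous_W.
  have cp : {for t, continuous (fun t : R => t `^ (- eps))}.
    apply/differentiable_continuous/derivable1_diffP.
    by have [] := is_derive1_powR (- eps) t0.
  by apply: cvgD; [exact: cvg_cst|exact: cp].
Qed.

(** As [K] is nonnegative, the truncated integrals increase to [Pint], so their products with [g]
    are dominated by [Pint |g|]. *)
Lemma cvg_inner_kernel_int a c g : 0 < c -> L2 g ->
  (forall z, Omega z -> Pconv (fun t => K t x z) a) ->
  eta.-integrable Omega (fun z => (Pint (fun t => K t x z) a c * g z)%:E) ->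
  inner (kernel_int (fun t => K t x) (Itv m) (W a c)) g @[m --> \oo] -->
  inner (fun z => Pint (fun t => K t x z) a c) g.
Proof.
move=> c0 Lg cv Pg; have [C [eps [C0 eps0 bnd]]] := K_bound Ox.
have mR : measurable Rpos by exact: measurable_itv.
have mI m : measurable (Itv m) by exact: measurable_itv.
have sub m : Itv m `<=` Rpos by move=> t /Itv_pos t0; rewrite /= in_itv /= andbT.
have cvz z : Omega z -> leb.-integrable Rpos (EFin \o (fun t => K t x z * W a c t)).
  by move=> Oz; exact: cv.
have kw0 z t : Omega z -> 0 < t -> 0 <= K t x z * W a c t.
  by move=> Oz t0; rewrite mulr_ge0 ?K_ge0 ?W_ge0.
have mk m : measurable_fun Omega (kernel_int (fun t => K t x) (Itv m) (W a c)).
  apply: (@measurable_kernel_int _ _ _ eta mO (fun t => K t x)) => //.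
  - by move=> t t0; exact: K_L2.
  - by move=> t z t0 Oz; exact: K_cont.
  - by move=> t z t0 Oz; exact: K_ge0.
  - by move=> t; exact: Itv_pos.
  - by apply: measurable_funS (measurable_W a c) => //; exact: measurable_itv.
  - by move=> t _; exact: W_ge0.
apply: fine_cvg; rewrite fineK; last exact: integrable_fin_num.
apply: (@dominated_cvg _ _ _ eta Omega mO _ _
  (fun z => `|(Pint (fun t => K t x z) a c * g z)%:E|%E)) => //.
- move=> m; apply/measurable_EFinP; apply: measurable_funM => //; exact: L2_meas Lg.
- move=> z Oz; apply: cvg_EFin; first exact: nearW.
  apply: cvgMl; rewrite /Pint /kernel_int.
  have := @cvg_Rintegral_nondecreasing_set _ _ _ leb (fun m => Itv m)
    (fun t => K t x z * W a c t) (nondecreasing_itv_inv ltr01) mI.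
  by rewrite (bigcup_itv_inv ltr01); apply; exact: cvz.
- exact: integrable_abse.
- move=> m z Oz; rewrite lee_fin /= !normrM ler_wpM2r//.
  rewrite ger0_norm; last by apply: Rintegral_ge0 => t /Itv_pos; exact: kw0.
  apply: le_trans (ler_norm _); rewrite -lee_fin /kernel_int /Pint /Rintegral.
  have f1 := integrable_fin_num mR (cvz z Oz).
  have f2 := integrable_fin_num (mI m) (integrableS mR (mI m) (@sub m) (cvz z Oz)).
  rewrite (fineK f1) (fineK f2); apply: ge0_subset_integral => //.
  + exact: (measurable_int _ (cvz z Oz)).
  + by move=> t /=; rewrite in_itv /= andbT lee_fin; exact: kw0.
Qed.

(** On compact time intervals this is the fundamental theorem of calculus for
    [W (1 - s) c t * <K t x, phi>]. The limits of the two integrals are taken separately, the one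
    with [L phi] not being known to converge absolutely. *)
Lemma weak_equation s c phi : s < 1 -> 0 < c -> dom L phi ->
  (forall z, Omega z -> Pconv (fun t => K t x z) (1 - s)) ->
  eta.-integrable Omega (fun z => (Pint (fun t => K t x z) (1 - s) c * L phi z)%:E) ->
  inner (fun z => Pint (fun t => K t x z) (1 - s) c) (L phi) =
  c * inner (fun z => Pint (fun t => K t x z) (1 - s + 1 + 1) c) phi -
  (1 - s) * inner (fun z => Pint (fun t => K t x z) (1 - s + 1) c) phi.
Proof.
move=> s1 c0 dphi cv Pint_phi.
have Lphi := dom_L2 dphi; have LLphi := act_L2 dphi.
have cv1 z : Omega z -> Pconv (fun t => K t x z) (1 - s + 1).
  move=> Oz; apply: Pconv_succ; [exact: measurable_K| |exact: cv].
  by move=> t t0; exact: K_ge0.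
have cv2 z : Omega z -> Pconv (fun t => K t x z) (1 - s + 1 + 1).
  move=> Oz; apply: Pconv_succ; [exact: measurable_K| |exact: cv1].
  by move=> t t0; exact: K_ge0.
have a1 : 1 < 1 - s + 1 by lra.
have a2 : 1 < 1 - s + 1 + 1 by lra.
have mR : measurable Rpos by exact: measurable_itv.
pose th (t : R) := inner (K t x) phi.
pose ps (t : R) := inner (K t x) (L phi).
(* The equation [dtK = - L K], followed by the symmetry of [L] on its domain. *)
have dth (t : R) : 0 < t -> is_derive t 1 th (- ps t).
  move=> t0; apply: is_derive_eq (is_derive_inner_K t0 Ox Lphi) _.
  have [_ h] : L2 (dtK K t x) /\ ae_eq eta Omega (dtK K t x) (fun z => - L (K t x) z).
    by case: hK => _ [_ _ h _ _]; exact: h.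
  have LLK := act_L2 (K_dom t0 Ox).
  have LNLK : L2 (fun z => - L (K t x) z).
    by apply: L2_eq (L2_scale mO (-1) LLK) => // z _; rewrite mulN1r.
  rewrite (ae_eq_inner mO (dtK_L2 t0 Ox) LNLK Lphi h) /ps operator_sym//; last exact: K_dom.
  rewrite -mulN1r -innerZl//; apply: eq_inner => // z _; by rewrite mulN1r.
pose q (t : R) := c * (W (1 - s + 1 + 1) c t * th t) - (1 - s) * (W (1 - s + 1) c t * th t).
pose H (t : R) := W (1 - s) c t * th t.
have dH (t : R) : 0 < t -> is_derive t 1 H (q t - W (1 - s) c t * ps t).
  move=> t0; have h := is_deriveM (is_derive_W (1 - s) c t0) (dth t t0).
  by apply: is_derive_eq h _; rewrite /GRing.scale /q /=; ring.
have cH' (t : R) : 0 < t -> {for t, continuous (fun t => q t - W (1 - s) c t * ps t)}.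
  move=> t0.
  have cth : {for t, continuous th} by exact: continuous_inner_K.
  have cps : {for t, continuous ps} by exact: continuous_inner_K.
  have cW a : {for t, continuous (W a c)} by exact: continuous_W.
  have cWth a : {for t, continuous (fun t => W a c t * th t)} by exact: continuousM.
  have cWps : {for t, continuous (fun t => W (1 - s) c t * ps t)} by exact: continuousM.
  apply: cvgB; last exact: cWps.
  by apply: cvgB; apply: cvgMr; exact: cWth.
have i2 : leb.-integrable Rpos (EFin \o (fun t => W (1 - s + 1 + 1) c t * th t)).
  exact: integrable_W_inner_K.
have i1 : leb.-integrable Rpos (EFin \o (fun t => W (1 - s + 1) c t * th t)).
  exact: integrable_W_inner_K.
have i2' : leb.-integrable Rpos (EFin \o (fun t => c * (W (1 - s + 1 + 1) c t * th t))).
  by apply: eq_integrable (integrableZl mR c i2) => // t _; rewrite /= EFinM.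
have i1' : leb.-integrable Rpos (EFin \o (fun t => (1 - s) * (W (1 - s + 1) c t * th t))).
  by apply: eq_integrable (integrableZl mR (1 - s) i1) => // t _; rewrite /= EFinM.
have iq : leb.-integrable Rpos (EFin \o q).
  by apply: eq_integrable (integrableB mR i2' i1') => // t _; rewrite /= EFinB.
have FTC m : \int[leb]_(t in Itv m) q t - \int[leb]_(t in Itv m) (W (1 - s) c t * ps t) =
   H (1 * m.+1%:R) - H (1 / m.+1%:R).
  have mI : measurable (Itv m) by exact: measurable_itv.
  have sub : Itv m `<=` Rpos by move=> t /Itv_pos t0; rewrite /= in_itv /= andbT.
  have m10 : 0 < 1 / m.+1%:R :> R by rewrite divr_gt0.
  have m20 : 0 < 1 * m.+1%:R :> R by rewrite mulr_gt0.
  have iWp : leb.-integrable (Itv m) (EFin \o (fun t => W (1 - s) c t * ps t)).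
    apply: continuous_compact_integrable; first exact: segment_compact.
    apply: continuous_in_subspaceT => t /set_mem /Itv_pos t0.
    apply: continuousM; first exact: continuous_W.
    exact: continuous_inner_K.
  have iqm : leb.-integrable (Itv m) (EFin \o q) by apply: integrableS iq.
  rewrite -RintegralB//.
  (* For [m = 0] the interval is the single point [1], which the fundamental theorem excludes; both
     sides are [0]. *)
  have [->|mn0] := eqVneq m 0%N.
    by rewrite divr1 mulr1 subrr set_itv1 Rintegral_set1.
  have m12 : 1 / m.+1%:R < 1 * m.+1%:R :> R.
    rewrite !mul1r; apply: (@lt_trans _ _ 1); rewrite ?invf_lt1 ?ltr1n ?ltnS ?lt0n//.
  rewrite /Rintegral (@continuous_FTC2 _ _ H)//.
  - apply: continuous_in_subspaceT => t /set_mem /Itv_pos; exact: cH'.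
  - split.
    + move=> t; rewrite in_itv /= => /andP[t1 _].
      by have [] := dH t (lt_trans m10 t1).
    + apply: cvg_at_right_filter; apply/differentiable_continuous/derivable1_diffP.
      by have [] := dH _ m10.
    + apply: cvg_at_left_filter; apply/differentiable_continuous/derivable1_diffP.
      by have [] := dH _ m20.
  - move=> t; rewrite in_itv /= => /andP[t1 _]; rewrite derive1E.
    by have [_ ->] := dH t (lt_trans m10 t1).
have [C [eps [C0 eps0 bnd]]] := K_bound Ox.
(* Both boundary terms will vanish: these weights tend to [0] at infinity because [s < 1], and at
   [0] because of the exponential. *)
have Hb (t : R) : 0 < t ->
    `|H t| <= C * L2norm phi * (W (1 - s) c t + W (1 - s + eps) c t).
  move=> t0; have e := @W_powR _ (1 - s) eps c t t0; rewrite normrM (ger0_norm (W_ge0 _ _ _)) -e.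
  have -> : W (1 - s) c t + W (1 - s) c t * t `^ (- eps) =
    W (1 - s) c t * (1 + t `^ (- eps)) by ring.
  by rewrite mulrCA ler_wpM2l ?W_ge0//; exact: inner_K_bound.
have H_inf : H (1 * m.+1%:R) @[m --> \oo] --> 0.
  apply: norm_cvg0.
  apply: (@squeeze_cvgr _ _ _ _ (fun=> 0) (fun m => C * L2norm phi *
    (W (1 - s) c (1 * m.+1%:R) + W (1 - s + eps) c (1 * m.+1%:R)))).
  - by apply: nearW => m; rewrite normr_ge0 /= Hb// mulr_gt0.
  - exact: cvg_cst.
  - rewrite -[X in _ --> X](mulr0 (C * L2norm phi)); apply: cvgMr.
    by rewrite -[X in _ --> X](addr0 0); apply: cvgD; apply: cvg_W_nat => //; lra.
have H_0 : H (1 / m.+1%:R) @[m --> \oo] --> 0.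
  apply: norm_cvg0.
  apply: (@squeeze_cvgr _ _ _ _ (fun=> 0) (fun m => C * L2norm phi *
    (W (1 - s) c (1 / m.+1%:R) + W (1 - s + eps) c (1 / m.+1%:R)))).
  - by apply: nearW => m; rewrite normr_ge0 /= Hb// divr_gt0.
  - exact: cvg_cst.
  - rewrite -[X in _ --> X](mulr0 (C * L2norm phi)); apply: cvgMr.
    by rewrite -[X in _ --> X](addr0 0); apply: cvgD; exact: cvg_W_inv.
have lim1 : H (1 * m.+1%:R) - H (1 / m.+1%:R) @[m --> \oo] --> 0.
  by rewrite -[X in _ --> X](subr0 0); exact: cvgB.
have mI m : measurable (Itv m) by exact: measurable_itv.
have lim2 : \int[leb]_(t in Itv m) q t - \int[leb]_(t in Itv m) (W (1 - s) c t * ps t)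
    @[m --> \oo] --> \int[leb]_(t in Rpos) q t -
      inner (fun z => Pint (fun t => K t x z) (1 - s) c) (L phi).
  apply: cvgB.
    rewrite -(bigcup_itv_inv ltr01); apply: cvg_Rintegral_nondecreasing_set => //.
      exact: nondecreasing_itv_inv.
    by rewrite (bigcup_itv_inv ltr01).
  (* The truncated time integrals are read as pairings of truncations of [Psi] with [L phi], where
     dominated convergence in [z] is available. *)
  under eq_fun do rewrite -inner_Pint_trunc//.
  exact: cvg_inner_kernel_int.
have e : \int[leb]_(t in Rpos) q t -
   inner (fun z => Pint (fun t => K t x z) (1 - s) c) (L phi) = 0.
  have := cvg_lim (@Rhausdorff R) lim2; under eq_fun do rewrite FTC.
  by rewrite (cvg_lim (@Rhausdorff R) lim1) => <-.
move/eqP: e; rewrite subr_eq0 => /eqP <-.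
rewrite RintegralB// RintegralZl// RintegralZl//.
by rewrite !inner_Pint.
Qed.

End heat_kernel_facts.

(** * The limit of the weighted normal derivative *)

Section blocks.
Context {R : realType}.
Local Notation leb := (@lebesgue_measure R).
Implicit Types (f g w : R -> R) (a b t : R).

Lemma integral_blocks f (u : nat -> R) : 0 < u 0%N -> (forall i, u i <= u i.+1) ->
  measurable_fun (`]0, +oo[%classic : set R) f -> (forall t, 0 < t -> 0 <= f t) ->
  forall N, (\int[leb]_(t in `]u 0%N, u N]) (f t)%:E =
             \sum_(i < N) \int[leb]_(t in `]u i, u i.+1]) (f t)%:E)%E.
Proof.
move=> u0 ndu mf f0; have u0i i : u 0%N <= u i.
  by elim: i => // i IH; exact: le_trans IH (ndu i).
elim=> [|N IH]; first by rewrite big_ord0 set_itv_ge ?integral_set0// bnd_simp ltxx.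
rewrite big_ord_recr /= -IH.
have pos a b t : u 0%N <= a -> `]a, b]%classic t -> 0 < t.
  by move=> ua /=; rewrite in_itv /= => /andP[h _]; apply: (lt_trans u0); exact: le_lt_trans h.
rewrite -ge0_integral_setU//=.
- by rewrite -itv_bndbnd_setU// bnd_simp ?u0i ?ndu.
- have sub a b : u 0%N <= a -> `]a, b] `<=` (`]0, +oo[%classic : set R).
    by move=> ua t /(pos _ _ _ ua) t0; rewrite /= in_itv /= andbT.
  apply/measurable_funU => //; split; apply/measurable_EFinP.
  + by apply: measurable_funS mf => //; exact: sub.
  + by apply: measurable_funS mf => //; exact: sub.
- by move=> t [] /pos h; rewrite lee_fin f0// h.
- rewrite disj_set2E; apply/eqP/seteqP; split => // t /=.
  by rewrite !in_itv /= => -[/andP[_ t1] /andP[]]; rewrite ltNge t1.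
Qed.

(** On each cell [g] exceeds its value at the right endpoint by at most [Lp * d]. The range starts
    at [N0 * d > 0], the Lipschitz constant being available only away from [0]. *)
Lemma integral_riemann g (Lp d : R) (N0 N : nat) : 0 < d -> (0 < N0)%N -> 0 <= Lp ->
  measurable_fun (`]0, +oo[%classic : set R) g -> (forall t, 0 < t -> 0 <= g t) ->
  (forall t t', N0%:R * d <= t -> t <= t' -> g t <= g t' + Lp * (t' - t)) ->
  (\int[leb]_(t in `](N0%:R * d)%R, ((N0 + N)%:R * d)%R]) (g t)%:E <=
   (d * \sum_(k < N) g ((N0 + k).+1%:R * d) + Lp * d * (N%:R * d))%:E)%E.
Proof.
move=> d0 N00 Lp0 mg g0 lip.
pose u i := (N0 + i)%:R * d.
have u0 : 0 < u 0%N by rewrite /u addn0 mulr_gt0// ltr0n.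
have nd i : u i <= u i.+1 by rewrite /u ler_pM2r// ler_nat leq_add2l.
have uN0 i : N0%:R * d <= u i by rewrite /u ler_pM2r// ler_nat leq_addr.
have -> : N0%:R * d = u 0%N by rewrite /u addn0.
rewrite -/(u N) (integral_blocks u0 nd mg g0).
have -> : d * \sum_(k < N) g ((N0 + k).+1%:R * d) + Lp * d * (N%:R * d) =
   \sum_(k < N) ((g (u k.+1) + Lp * d) * d).
  rewrite -mulr_suml big_split /= sumr_const card_ord mulrDl mulrC; congr (_ * _ + _).
    by apply: eq_bigr => k _; rewrite /u addnS.
  by rewrite -mulr_natr; ring.
rewrite -sumEFin; apply: lee_sum => i _.
apply: (@le_trans _ _ (\int[leb]_(t in `](u i), (u i.+1)]) (cst (g (u i.+1) + Lp * d)%:E t))%E).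
  apply: ge0_le_integral => //.
  - move=> t /=; rewrite in_itv /= => /andP[t1 _]; rewrite lee_fin g0//.
    by apply: lt_trans t1; apply: lt_le_trans u0 _; rewrite {1}/u addn0.
  - apply/measurable_EFinP; apply: measurable_funS mg => // t /=.
    rewrite !in_itv /= andbT => /andP[t1 _].
    by apply: lt_trans t1; apply: lt_le_trans u0 _; rewrite {1}/u addn0.
  - move=> t /=; rewrite in_itv /= => /andP[t1 t2]; rewrite lee_fin.
    apply: (le_trans (lip t (u i.+1) _ t2)).
      exact: le_trans (uN0 i) (ltW t1).
    rewrite lerD2l ler_wpM2l// lerBlDr.
    apply: (@le_trans _ _ (d + u i)); last by rewrite lerD2l ltW.
    by rewrite /u addnS -natr1 mulrDl mul1r addrC.
rewrite integral_cst//= lebesgue_measure_itv /=.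
have e : u i.+1 - u i = d by rewrite /u addnS -natr1 mulrDl mul1r addrAC subrr add0r.
case: ifP => _; first by rewrite -EFinB e -EFinM.
rewrite mule0 lee_fin mulr_ge0 ?(ltW d0)// addr_ge0 ?mulr_ge0 ?(ltW d0)//.
by apply: g0; apply: lt_le_trans u0 _; rewrite {1}/u addn0.
Qed.

(* On a dyadic block [W a c] is at most [4] times the mean of [W a (c / 2)]. *)
Lemma integral_dyadic_block a c g (l b : R) : 0 < b -> 0 < c -> 1 <= a <= 2 -> 0 <= l ->
  measurable_fun (`]0, +oo[%classic : set R) g -> (forall t, 0 < t -> 0 <= g t) ->
  (\int[leb]_(t in `]b, (2 * b)%R]) (g t)%:E <= (2 * b * l)%:E)%E ->
  (\int[leb]_(t in `]b, (2 * b)%R]) (W a c t * g t)%:E <=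
   (8 * l)%:E * \int[leb]_(t in `]b, (2 * b)%R]) (W a (c / 2) t)%:E)%E.
Proof.
move=> b0 c0 /andP[a1 a2] l0 mg g0 hg.
have pos t : `]b, (2 * b)%R]%classic t -> 0 < t.
  by rewrite /= in_itv /= => /andP[h _]; exact: lt_trans h.
have sub : `]b, (2 * b)%R] `<=` (`]0, +oo[%classic : set R).
  by move=> t /pos t0; rewrite /= in_itv /= andbT.
have mgb : measurable_fun `]b, (2 * b)%R] (EFin \o g).
  by apply/measurable_EFinP; apply: measurable_funS mg.
(* An upper bound for [W a c] on the block: the power at the left end, the exponential at the right
   end. *)
pose M := b `^ (- a) * expR (- (c / (2 * b))).
have M0 : 0 <= M by rewrite mulr_ge0 ?powR_ge0 ?expR_ge0.
have powle u v : 0 < u -> u <= v -> v `^ (- a) <= u `^ (- a).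
  move=> u0 uv; have v0 : 0 < v by exact: lt_le_trans uv.
  rewrite !powRN lef_pV2 ?posrE ?powR_gt0// ge0_ler_powR ?nnegrE ?(ltW u0) ?(ltW v0)//.
  lra.
apply: (@le_trans _ _ (\int[leb]_(t in `]b, (2 * b)%R]) (M%:E * (g t)%:E))%E).
  apply: ge0_le_integral => //.
  - by move=> t /pos t0; rewrite lee_fin mulr_ge0 ?W_ge0 ?g0.
  - apply/measurable_EFinP; apply: measurable_funM; last exact: measurable_funS mg.
    by apply: measurable_funS (measurable_W a c).
  - exact: measurable_funeM.
  - move=> t /[dup] /pos t0 /=; rewrite in_itv /= => /andP[t1 t2].
    rewrite -EFinM lee_fin ler_wpM2r ?g0// /W /M ler_pM ?powR_ge0 ?expR_ge0//.
      by apply: powle => //; exact: ltW.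
    by rewrite ler_expR lerN2 ler_pM2l// lef_pV2 ?posrE ?mulr_gt0.
rewrite ge0_integralZl//; last by move=> t /pos t0; rewrite lee_fin g0.
apply: (@le_trans _ _ (M%:E * (2 * b * l)%:E)%E); first exact: lee_wpmul2l.
have -> : (M%:E * (2 * b * l)%:E = (8 * l)%:E * (M / 4 * b)%:E)%E.
  by rewrite -!EFinM; congr EFin; field.
apply: lee_wpmul2l; first by rewrite lee_fin mulr_ge0.
(* On the block [W a (c / 2)] is at least [M / 4]: [(2b)^(-a) >= b^(-a) / 4] as [a <= 2], and
   halving [c] compensates for the ratio [2] between the endpoints. *)
apply: (@le_trans _ _ (\int[leb]_(t in `]b, (2 * b)%R]) (cst (M / 4)%:E t))%E).
  rewrite integral_cst//= lebesgue_measure_itv /= lte_fin ifT; last by lra.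
  by rewrite -EFinB -EFinM lee_fin; apply: ler_wpM2l; [rewrite divr_ge0|lra].
apply: ge0_le_integral => //.
- by move=> t _; rewrite lee_fin divr_ge0.
- by apply/measurable_EFinP; apply: measurable_funS (measurable_W a (c / 2)).
- move=> t /[dup] /pos t0 /=; rewrite in_itv /= => /andP[t1 t2]; rewrite lee_fin.
  rewrite /M /W mulrAC ler_pM ?mulr_ge0 ?powR_ge0 ?expR_ge0 ?invr_ge0//.
    apply: (@le_trans _ _ ((2 * b) `^ (- a))); last exact: powle.
    rewrite powRM ?(ltW b0)// mulrC ler_wpM2r ?powR_ge0//.
    rewrite powRN lef_pV2 ?posrE ?powR_gt0//.
    apply: (@le_trans _ _ (2 `^ 2)); first by rewrite ler_powR// ler1n.
    by rewrite (powR_mulrn 2)// expr2 -natrM.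
  rewrite ler_expR lerN2.
  have -> : c / (2 * b) = c / 2 / b by rewrite invfM mulrA.
  by rewrite ler_pM2l ?divr_gt0// lef_pV2 ?posrE// ltW.
Qed.

(** A bound on dyadic block means suffices, since [W] at [c] is comparable on each block with [W] at
    [c / 2]. The quotients [2^i / 2^m] run over all integral powers of [2]. *)
Lemma integral_dyadic a c g (l : R) : 0 < c -> 1 < a <= 2 -> 0 <= l ->
  measurable_fun (`]0, +oo[%classic : set R) g -> (forall t, 0 < t -> 0 <= g t) ->
  (forall (i m : nat), (\int[leb]_(t in `](2 ^+ i / 2 ^+ m)%R, (2 * (2 ^+ i / 2 ^+ m))%R])
     (g t)%:E <= (2 * (2 ^+ i / 2 ^+ m) * l)%:E)%E) ->
  (\int[leb]_(t in `]0%R, +oo[) (W a c t * g t)%:E <=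
   (8 * l)%:E * \int[leb]_(t in `]0%R, +oo[) (W a (c / 2) t)%:E)%E.
Proof.
move=> c0 /andP[a1 a2] l0 mg g0 hg.
have a12 : 1 <= a <= 2 by rewrite (ltW a1).
have mWg : measurable_fun (`]0, +oo[%classic : set R) (fun t => W a c t * g t).
  by apply: measurable_funM => //; exact: measurable_W.
have Wg0 t : 0 < t -> 0 <= W a c t * g t by move=> t0; rewrite mulr_ge0 ?W_ge0 ?g0.
have pm (m : nat) : 0 < 2 ^+ m :> R by rewrite exprn_gt0.
(* The interval from [2^(-m)] to [2^m], a union of [2m] dyadic blocks. *)
pose F (m : nat) := `](2 ^+ 0 / 2 ^+ m), (2 ^+ (m + m) / 2 ^+ m)]%classic : set R.
have subF m : F m `<=` (`]0, +oo[%classic : set R).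
  move=> t; rewrite /F /= !in_itv /= andbT => /andP[h _].
  by apply: lt_trans h; rewrite divr_gt0.
have UF : \bigcup_m F m = (`]0, +oo[%classic : set R).
  apply/seteqP; split; first by move=> t [m _] /subF.
  move=> t /=; rewrite in_itv /= andbT => t0.
  pose m := Num.truncn (Num.max t^-1 t); exists m => //.
  have := truncnS_gt (Num.max t^-1 t); rewrite gt_max -/m => /andP[h1 h2].
  have mm : m.+1%:R <= 2 ^+ m :> R.
    by rewrite -natrX ler_nat; exact: ltn_expl.
  rewrite /F /= in_itv /= expr0 exprD mulfK ?gt_eqF// div1r; apply/andP; split.
    rewrite invf_plt ?posrE//; exact: lt_le_trans h1 mm.
  exact/ltW/(lt_le_trans h2 mm).
have ndF : nondecreasing_seq F.
  move=> i j ij; rewrite subsetEset => t; rewrite /F /= !in_itv /= !expr0 !exprD.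
  rewrite !mulfK ?gt_eqF// !div1r => /andP[h1 h2].
  have h : 2 ^+ i <= 2 ^+ j :> R by rewrite ler_eXn2l// ltr1n.
  apply/andP; split; last exact: le_trans h2 h.
  by apply: le_lt_trans h1; rewrite lef_pV2 ?posrE.
have mF m : measurable (F m : set (measurableTypeR R)) by exact: measurable_itv.
have cv : (\int[leb]_(t in F m) (W a c t * g t)%:E @[m --> \oo] -->
    \int[leb]_(t in `]0%R, +oo[) (W a c t * g t)%:E)%E.
  rewrite -UF; apply: ge0_nondecreasing_set_cvg_integral => //.
  - by move=> m; apply/measurable_EFinP; apply: measurable_funS (subF m) mWg => //.
  - move=> m t /subF; rewrite /= in_itv /= andbT lee_fin; exact: Wg0.
rewrite -(cvg_lim _ cv)//; apply: lime_le; first by apply/cvg_ex; eexists; exact: cv.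
apply: nearW => m.
pose u (i : nat) : R := 2 ^+ i / 2 ^+ m.
have u0 : 0 < u 0%N by rewrite divr_gt0.
have uS i : u i.+1 = 2 * u i by rewrite /u exprS mulrA.
have nd i : u i <= u i.+1.
  by rewrite uS ler_peMl ?ler1n// divr_ge0// ltW.
rewrite /F -/(u 0%N) -/(u (m + m)%N) (integral_blocks u0 nd mWg Wg0).
apply: (@le_trans _ _ ((8 * l)%:E * \int[leb]_(t in `](u 0%N), (u (m + m)%N)]) (W a (c / 2) t)%:E)%E).
  rewrite (integral_blocks u0 nd (measurable_W a (c / 2)) (fun t _ => W_ge0 _ _ _)).
  rewrite ge0_sume_distrr; last by move=> i _; apply: integral_ge0 => t _; rewrite lee_fin W_ge0.
  apply: lee_sum => i _; rewrite uS; apply: integral_dyadic_block => //.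
    by rewrite divr_gt0.
  exact: hg.
apply: lee_wpmul2l; first by rewrite lee_fin mulr_ge0.
apply: ge0_subset_integral => //.
- by apply/measurable_EFinP; exact: measurable_W.
- by move=> t _; rewrite lee_fin W_ge0.
- exact: subF.
Qed.

(* The error is split as [e + D * t^b] so that both parts integrate to Gamma
   functions. *)
Lemma cvg_W_approx_identity s g (g0 B : R) : s < 1 ->
  measurable_fun (`]0, +oo[%classic : set R) g -> 
  (forall t, 0 < t -> `|g t| <= B) ->
  g t @[t --> 0^'+] --> g0 ->
  c `^ (1 - s) * \int[leb]_(t in `]0, +oo[) (W (2 - s) c t * g t) @[c --> 0^'+] -->
  Gamma (1 - s) * g0.
Proof.
move=> s1 mg gB gcvg.
have mI : measurable (`]0, +oo[%classic : set (measurableTypeR R)) by exact: measurable_itv.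
(* Small enough that [s + be < 1], so that the integral with the additional [t^be] still
   converges. *)
pose be := (1 - s) / 2; have be0 : 0 < be by rewrite /be; lra.
have sb1 : s + be < 1 by rewrite /be; lra.
have a1 : 1 < 2 - s by lra.
have a1' : 1 < 2 - (s + be) by lra.
have Ga0 r : 0 <= Gamma r :> R.
  by apply: Rintegral_ge0 => t _; rewrite mulr_ge0 ?powR_ge0 ?expR_ge0.
have pw c : 0 < c -> c `^ (1 - s) * (c `^ (s - 1)) = 1.
  move=> c0; rewrite -powRD; last by apply/implyP => _; rewrite gt_eqF.
  by rewrite (_ : 1 - s + (s - 1) = 0) ?powRr0//; ring.
have B0 : 0 <= B by apply: le_trans (gB 1 ltr01); exact: normr_ge0.
have iWg c : 0 < c -> leb.-integrable `]0, +oo[ (EFin \o (fun t => W (2 - s) c t * g t)).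
  move=> c0; apply: (@le_integrable _ _ _ leb _ mI _ _ _ _
    (integrableZl mI B (integrable_W a1 c0))).
  - by apply/measurable_EFinP; apply: measurable_funM => //; exact: measurable_W.
  - move=> t /=; rewrite in_itv /= andbT => t0; rewrite lee_fin normrM [leRHS]normrM mulrC.
    by rewrite ler_wpM2r//; apply: le_trans (ler_norm _); exact: gB.
have key (e : R) : 0 < e -> exists2 D : R, 0 <= D &
    forall c, 0 < c -> `|c `^ (1 - s) * \int[leb]_(t in `]0, +oo[) (W (2 - s) c t * g t)
       - Gamma (1 - s) * g0| <= e * Gamma (1 - s) + D * c `^ be.
  move=> e0; move/cvgrPdist_le : gcvg => /(_ e e0) [d /= d0 hd].
  (* For [t >= d] this makes [D t^be] at least the crude bound [B + |g0|]. *)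
  pose D := (B + `|g0|) / d `^ be.
  have D0 : 0 <= D by rewrite divr_ge0 ?powR_ge0// addr_ge0.
  have ptw t : 0 < t -> `|g t - g0| <= e + D * t `^ be.
    move=> t0; have [td|dt] := ltP t d.
      rewrite distrC -[leLHS]addr0; apply: lerD; last by rewrite mulr_ge0 ?powR_ge0.
      apply: hd => //=; by rewrite sub0r normrN gtr0_norm.
    apply: (@le_trans _ _ (B + `|g0|)).
      by apply: (le_trans (ler_normB _ _)); rewrite lerD2r gB.
    rewrite -[leLHS]add0r; apply: lerD; first exact: ltW.
    rewrite /D mulrAC -mulrA ler_peMr ?addr_ge0//.
    rewrite ler_pdivlMr ?powR_gt0// mul1r ge0_ler_powR ?nnegrE ?(ltW be0) ?(ltW d0)//.
    exact: ltW.
  exists (D * Gamma (1 - (s + be))); first by rewrite mulr_ge0.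
  move=> c c0.
  have iW := integrable_W a1 c0.
  have iW' := integrable_W a1' c0.
  have -> : c `^ (1 - s) * \int[leb]_(t in `]0, +oo[) (W (2 - s) c t * g t)
       - Gamma (1 - s) * g0 =
     c `^ (1 - s) * \int[leb]_(t in `]0, +oo[) (W (2 - s) c t * g t - W (2 - s) c t * g0).
    have iWg0 : leb.-integrable `]0, +oo[ (EFin \o (fun t => W (2 - s) c t * g0)).
      by apply: eq_integrable (integrableZr mI g0 iW).
    rewrite (RintegralB mI (iWg c c0) iWg0) (RintegralZr _ mI iW) integral_W_Gamma// mulrBr; congr (_ - _).
    by rewrite !mulrA pw// mul1r.
  rewrite normrM (ger0_norm (powR_ge0 _ _)).
  apply: (@le_trans _ _ (c `^ (1 - s) *
     \int[leb]_(t in `]0, +oo[) (e * W (2 - s) c t + D * W (2 - (s + be)) c t))); last first.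
    have i1 : leb.-integrable `]0, +oo[ (EFin \o (fun t => e * W (2 - s) c t)).
      by apply: eq_integrable (integrableZl mI e iW).
    have i2 : leb.-integrable `]0, +oo[ (EFin \o (fun t => D * W (2 - (s + be)) c t)).
      by apply: eq_integrable (integrableZl mI D iW').
    rewrite (RintegralD mI i1 i2) (RintegralZl _ mI iW) (RintegralZl _ mI iW') !integral_W_Gamma// mulrDr.
    rewrite (_ : c `^ (1 - s) * (e * (c `^ (s - 1) * Gamma (1 - s))) = e * Gamma (1 - s)); last first.
      transitivity ((c `^ (1 - s) * c `^ (s - 1)) * (e * Gamma (1 - s))); first by ring.
      by rewrite pw// mul1r.
    have -> : c `^ (s + be - 1) = c `^ (s - 1) * c `^ be.
      rewrite -powRD; last by apply/implyP => _; rewrite gt_eqF.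
      by congr (_ `^ _); ring.
    rewrite lerD2l (_ : c `^ (1 - s) * (D * (c `^ (s - 1) * c `^ be * Gamma (1 - (s + be)))) =
      (c `^ (1 - s) * c `^ (s - 1)) * (D * Gamma (1 - (s + be)) * c `^ be)); last by ring.
    by rewrite pw// mul1r.
  rewrite ler_wpM2l ?powR_ge0//.
  have i1 : leb.-integrable `]0, +oo[
      (EFin \o (fun t => W (2 - s) c t * g t - W (2 - s) c t * g0)).
    apply: eq_integrable (integrableB mI (iWg c c0) (integrableZr mI g0 iW)) => // t _.
  apply: (le_trans (le_normr_Rintegral mI i1)).
  apply: le_Rintegral => //.
  - exact: integrable_norm.
  - by apply: eq_integrable (integrableD mI (integrableZl mI e iW) (integrableZl mI D iW')) => // t _.
  - move=> t /=; rewrite in_itv /= andbT => t0.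
    rewrite -mulrBr normrM (ger0_norm (W_ge0 _ _ _)).
    have -> : W (2 - (s + be)) c t = W (2 - s) c t * t `^ be.
      by rewrite -[in RHS](opprK be) W_powR//; congr (W _ _ _); ring.
    rewrite [leRHS](_ : _ = W (2 - s) c t * (e + D * t `^ be)); last by ring.
    by rewrite ler_wpM2l ?W_ge0// ptw.
apply/cvgrPdist_le => e e0.
(* Adding [1] gives a positive divisor from the nonnegativity of [Gamma] alone. *)
have G1 : 0 < Gamma (1 - s) + 1 :> R by rewrite ltr_wpDl.
have e1 : 0 < e / 2 / (Gamma (1 - s) + 1) by rewrite !divr_gt0.
have [D D0 HD] := key _ e1.
have cp : D * c `^ be @[c --> 0^'+] --> D * 0 by apply: cvgMr; exact: powR_cvg0.
rewrite mulr0 in cp.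
have e2 : 0 < e / 2 by rewrite divr_gt0.
move/cvgr0Pnorm_le : cp => /(_ _ e2) ncp.
near=> c.
have c0 : 0 < c by near: c; exact: nbhs_right_gt.
rewrite distrC; apply: (le_trans (HD c c0)).
rewrite [leRHS](_ : e = e / 2 + e / 2); last by lra.
apply: lerD.
  by rewrite -(mulrA (e / 2)) ler_piMr ?(ltW e2)// mulrC ler_pdivrMr// mul1r lerDl.
apply: le_trans (ler_norm _) _.
by near: c.
Unshelve. all: by end_near. Qed.

End blocks.

(** * Almost-everywhere convergence of the weighted time means *)

Section limit.
Context {R : realType} {n : nat} {Omega : set (borelRn R n)}.
Context {eta : {measure set (borelRn R n) -> \bar R}}.
Hypothesis mO : measurable Omega.
Variables (L : operator R n).
Hypothesis hlin : linear_operator Omega eta L.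
Variable T : R -> (borelRn R n -> R) -> borelRn R n -> R.
Variable K : R -> borelRn R n -> borelRn R n -> R.
Hypothesis hK : heat_kernel Omega eta L T K.
Implicit Types f g h u v : borelRn R n -> R.
Implicit Types x z : borelRn R n.

Local Notation L2 := (L2 Omega eta).
Local Notation inner := (inner Omega eta).
Local Notation L2norm := (L2norm Omega eta).
Local Notation leb := (@lebesgue_measure R).

Hypothesis T_L2 : forall (t : R) f, 0 < t -> L2 f -> L2 (T t f).
Hypothesis T_law : forall (t r : R) f g, 0 < t -> 0 < r -> L2 f -> L2 g ->
  inner (T t f) (T r g) = inner (T (t + r) f) g.
Hypothesis T_contraction : forall (t : R) f, 0 < t -> L2 f ->
  L2norm (T t f) <= L2norm f.
Hypothesis T_approx : forall f, L2 f ->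
  inner (fun z => f z - T (m.+1%:R^-1) f z) (fun z => f z - T (m.+1%:R^-1) f z)
    @[m --> \oo] --> 0.

Lemma T_kernel (t : R) f : 0 < t -> L2 f ->
  {ae eta, forall x, Omega x -> T t f x = inner (K t x) f}.
Proof. by case: hK => -[h _ _] _; exact: h. Qed.

Lemma inner_K_ge0 (t : R) x f : 0 < t -> Omega x ->
  (forall z, Omega z -> 0 <= f z) -> 0 <= inner (K t x) f.
Proof.
by move=> t0 Ox f0; apply: Rintegral_ge0 => z Oz; rewrite mulr_ge0 ?f0// (K_ge0 hK).
Qed.

Lemma inner_K_norm (t : R) x f : 0 < t -> Omega x -> L2 f ->
  `|inner (K t x) f| <= inner (K t x) (fun z => `|f z|).
Proof.
move=> t0 Ox Lf; have LK := K_L2 hlin hK t0 Ox.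
apply: (le_trans (le_normr_Rintegral mO (L2_mul_integrable mO LK Lf))).
rewrite le_eqVlt; apply/orP; left; apply/eqP; apply: eq_Rintegral => z /set_mem Oz.
by rewrite normrM (ger0_norm (K_ge0 hK t0 Ox Oz)).
Qed.

Lemma T_pos (t : R) f g : 0 < t -> L2 f -> L2 g ->
  (forall z, Omega z -> 0 <= f z) -> (forall z, Omega z -> 0 <= g z) ->
  0 <= inner (T t f) g.
Proof.
move=> t0 Lf Lg f0 g0; apply: (inner_pos mO) => //; first exact: T_L2.
by apply: filterS (T_kernel t0 Lf) => x h Ox; rewrite h//; exact: inner_K_ge0.
Qed.

Lemma inner_K_lipschitz x h (b : R) : Omega x -> L2 h -> 0 < b ->
  exists2 Lp : R, 0 <= Lp & forall t t' : R, b <= t -> t <= t' ->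
    inner (K t x) h <= inner (K t' x) h + Lp * (t' - t).
Proof.
move=> Ox Lh b0; have [C [eps [C0 eps0 bnd]]] := K_bound hK Ox.
exists (C * (1 + b `^ (- eps)) * L2norm h).
  by rewrite !mulr_ge0 ?L2norm_ge0// addr_ge0 ?powR_ge0.
move=> t t' bt; rewrite le_eqVlt => /predU1P[->|tt']; first by rewrite subrr mulr0 addr0.
pose g (r : R) := inner (K r x) h.
have t0 : 0 < t by exact: lt_le_trans bt.
have dg (r : R) : 0 < r -> is_derive r 1 g (inner (dtK K r x) h).
  by move=> r0; exact: (is_derive_inner_K hK).
have dg' (r : R) : r \in `]t, t'[%R -> is_derive r 1 g (inner (dtK K r x) h).
  by rewrite in_itv /= => /andP[tr _]; apply: dg; exact: lt_trans tr.
have cg : {within `[t, t'], continuous g}.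
  apply: continuous_in_subspaceT => r; rewrite inE /= in_itv /= => /andP[tr _].
  by apply: (continuous_inner_K hK) => //; exact: lt_le_trans tr.
have [r] := MVT tt' dg' cg.
rewrite in_itv /= => /andP[tr _] e; have r0 : 0 < r by exact: lt_trans tr.
have hb : `|inner (dtK K r x) h| <= C * (1 + b `^ (- eps)) * L2norm h.
  apply: (le_trans (L2_CauchySchwarz mO (dtK_L2 hK r0 Ox) Lh)).
  rewrite ler_wpM2r ?L2norm_ge0//; apply: (le_trans (bnd r r0).2).
  rewrite ler_wpM2l// lerD2l !powRN lef_pV2 ?posrE ?powR_gt0//.
  rewrite ge0_ler_powR ?nnegrE ?(ltW eps0) ?(ltW b0) ?(ltW r0)//.
  by apply: (le_trans bt); exact: ltW.
have : - (C * (1 + b `^ (- eps)) * L2norm h) <= inner (dtK K r x) h.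
  by move: hb; rewrite ler_norml => /andP[].
have tt0 : 0 <= t' - t by rewrite subr_ge0 ltW.
move=> /(ler_wpM2r tt0); rewrite -e mulNr /g; lra.
Qed.

(** The discrete inequality is transferred to integrals by letting the mesh [2^(-p)] tend to [0];
    this works because its constant is the same for all meshes. *)
Lemma maximal_kernel h (l : R) : L2 h -> (forall z, Omega z -> 0 <= h z) -> 0 < l ->
  exists A, [/\ measurable A, (eta A <= (36 * inner h h / l ^+ 2)%:E)%E &
  {ae eta, forall x, Omega x -> ~ A x -> forall i m : nat,
    (\int[leb]_(t in `](2 ^+ i / 2 ^+ m)%R, (2 * (2 ^+ i / 2 ^+ m))%R])
       (inner (K t x) h)%:E <= (2 * (2 ^+ i / 2 ^+ m) * l)%:E)%E}].
Proof.
move=> Lh h0 l0.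
pose d (p : nat) : R := (2 ^+ p)^-1.
have pm (p : nat) : 0 < 2 ^+ p :> R by rewrite exprn_gt0.
have d0 p : 0 < d p by rewrite invr_gt0.
(* At mesh [2^(-p)], the averages with [j <= 2p] span lengths from [2^(-p)] to [2^p]; each dyadic
   length is eventually among them. *)
pose G p := Omega `&` [set z | (l <= maxavg T (d p) (p + p).+1 h z)%R].
have mG p : measurable (G p).
  have LM := maxavg_L2 mO T_L2 (d0 p) (p + p).+1 Lh.
  have := L2_meas LM mO (measurable_itv `[l, +oo[).
  congr measurable; congr (_ `&` _).
  by apply/seteqP; split => z /=; rewrite in_itv/= andbT.
have bG p : (eta (G p) <= (36 * inner h h / l ^+ 2)%:E)%E.
  exact: (maxavg_weak mO T_L2 T_law T_contraction T_pos (d0 p)).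
(* The [G p] need not be monotone in [p]. Their lower limit keeps the common bound, and a point off
   it misses [G p] for arbitrarily large [p]. *)
pose C P := \bigcap_q G (P + q)%N.
have mC P : measurable (C P) by exact: bigcapT_measurable.
have ndC : nondecreasing_seq C.
  move=> P P' PP'; rewrite subsetEset => x Cx q _.
  by have := Cx (P' - P + q)%N I; rewrite addnA subnKC.
have mA : measurable (\bigcup_P C P) by exact: bigcupT_measurable.
exists (\bigcup_P C P); split=> //.
  have cv : (eta \o C) P @[P --> \oo] --> eta (\bigcup_P C P).
    exact: nondecreasing_cvg_mu.
  rewrite -(cvg_lim _ cv)//; apply: lime_le; first by apply/cvg_ex; eexists; exact: cv.
  apply: nearW => P; apply: le_trans (bG P); apply: le_measure; rewrite ?inE//.
  by move=> x /(_ 0%N I); rewrite addn0.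
(* One null set serves all the countably many mesh times. *)
have ae1 : {ae eta, forall x, forall p k : nat, Omega x ->
    T (k.+1%:R * d p) h x = inner (K (k.+1%:R * d p) x) h}.
  apply: ae_foralln => p; apply: ae_foralln => k.
  by apply: T_kernel => //; rewrite mulr_gt0.
apply: filterS ae1 => x hx Ox nA i m.
set b := 2 ^+ i / 2 ^+ m; have b0 : 0 < b by rewrite divr_gt0.
pose g (t : R) := inner (K t x) h.
have g0 (t : R) : 0 < t -> 0 <= g t by move=> t0; exact: inner_K_ge0.
have mg : measurable_fun (`]0, +oo[%classic : set R) g by exact: (measurable_inner_K hK).
have [Lp Lp0 lip] := inner_K_lipschitz Ox Lh b0.
apply/lee_addgt0Pr => e e0.
(* For [p >= P0] the Riemann error [Lp * 2^(-p) * b] is at most [e]. *)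
pose P0 := Num.truncn (Lp * b / e).
have [q nG] : exists q, ~ G (m + i + 1 + P0 + q)%N x.
  by apply/existsNP => hq; apply: nA; exists (m + i + 1 + P0)%N.
set p := (m + i + 1 + P0 + q)%N in nG.
have mp : (m <= p)%N by rewrite /p -!addnA leq_addr.
have P0p : (P0 <= p)%N by rewrite /p -addnA addnC -addnA leq_addr.
pose N := (2 ^ (i + (p - m)))%N.
have Nd : N%:R * d p = b.
  rewrite /N /d /b natrX exprD -{2}(subnK mp) exprD; field.
  by rewrite !gt_eqF.
have NNd : (N + N)%:R * d p = 2 * b by rewrite natrD mulrDl Nd; ring.
have N0 : (0 < N)%N by rewrite expn_gt0.
have := @integral_riemann _ g Lp (d p) N N (d0 p) N0 Lp0 mg g0.
rewrite Nd NNd => /(_ lip) /le_trans; apply.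
rewrite -EFinD lee_fin; apply: lerD.
- have NE : (2 ^ (i + (p - m)).+1 = N + N)%N by rewrite expnS mul2n -addnn.
  have avgE : avg T (d p) (i + (p - m)).+1 h x = (N + N)%:R^-1 * \sum_(k < N + N) g (k.+1%:R * d p).
    by rewrite /avg NE; congr (_ * _); apply: eq_bigr => k _; rewrite hx.
  have lt1 : avg T (d p) (i + (p - m)).+1 h x < l.
    apply: le_lt_trans (le_maxavg T (d p) (m := (p + p).+1) h x _) _.
      rewrite ltnS -addSn addnC; apply: leq_add; first exact: leq_subr.
      by rewrite /p; lia.
    by rewrite ltNge; apply/negP => hl; apply: nG; split.
  have s1 : \sum_(k < N) g ((N + k).+1%:R * d p) <= \sum_(k < N + N) g (k.+1%:R * d p).
    apply: le_trans (@ler_sum_shift _ (fun k => g (k.+1%:R * d p)) N N (N + N) _ _) => //.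
    + by rewrite le_eqVlt; apply/orP; left; apply/eqP; apply: eq_bigr => k _; rewrite addnC.
    + by move=> k; apply: g0; rewrite mulr_gt0.
  apply: (@le_trans _ _ (d p * \sum_(k < N + N) g (k.+1%:R * d p))).
    by rewrite ler_pM2l.
  have NN0 : 0 < (N + N)%:R :> R by rewrite ltr0n addn_gt0 N0.
  move: lt1; rewrite avgE ltr_pdivrMl// => /ltW lt1.
  apply: (@le_trans _ _ (d p * ((N + N)%:R * l))); first by rewrite ler_pM2l.
  by rewrite mulrA (mulrC (d p)) NNd.
- have h1 := truncnS_gt (Lp * b / e); rewrite -/P0 in h1.
  have h2 : P0.+1%:R <= 2 ^+ p :> R.
    rewrite -natrX ler_nat; apply: (@leq_trans (2 ^ P0)); first exact: ltn_expl.
    by rewrite leq_exp2l.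
  rewrite mulrAC /d ler_pdivrMr//; move: h1; rewrite ltr_pdivrMr// => /ltW/le_trans; apply.
  by rewrite mulrC ler_pM2l.
Qed.

Variable s : R.
Hypothesis s01 : 0 < s < 1.

Local Notation I f x c := (\int[leb]_(t in `]0, +oo[) (W (2 - s) c t * inner (K t x) f)).

Lemma Gamma_ge0 (r : R) : 0 <= Gamma r.
Proof. by apply: Rintegral_ge0 => t _; rewrite mulr_ge0 ?powR_ge0 ?expR_ge0. Qed.

Lemma integrable_I f x (c : R) : Omega x -> L2 f -> 0 < c ->
  leb.-integrable `]0, +oo[ (EFin \o (fun t => W (2 - s) c t * inner (K t x) f)).
Proof.
move=> Ox Lf c0; apply: (integrable_W_inner_K mO hlin hK Ox) => //.
by case/andP: s01 => _ h; lra.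
Qed.

Lemma maximal_I v (l : R) : L2 v -> 0 < l ->
  exists A, [/\ measurable A, (eta A <= (36 * inner v v / l ^+ 2)%:E)%E &
  {ae eta, forall x, Omega x -> ~ A x -> forall c : R, 0 < c ->
     `|c `^ (1 - s) * I v x c| <= 16 * l * Gamma (1 - s)}].
Proof.
case/andP: (s01) => s0 s1 Lv l0; have Lh := L2_norm mO Lv.
have [A [mA bA hA]] := maximal_kernel Lh (fun z _ => normr_ge0 (v z)) l0.
exists A; split=> //.
  by apply: (le_trans bA); rewrite -!L2norm_sqr L2norm_norm.
apply: filterS hA => x hx Ox nA c c0.
have mI : measurable (`]0, +oo[%classic : set (measurableTypeR R)) by exact: measurable_itv.
pose g (t : R) := inner (K t x) (fun z => `|v z|).
have g0 (t : R) : 0 < t -> 0 <= g t by move=> t0; exact: inner_K_ge0.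
have mg : measurable_fun (`]0, +oo[%classic : set R) g by exact: (measurable_inner_K hK).
have a12 : 1 < 2 - s <= 2 by apply/andP; split; lra.
have := @integral_dyadic _ (2 - s) c g l c0 a12 (ltW l0) mg g0 (hx Ox nA).
have c20 : 0 < c / 2 by rewrite divr_gt0.
have iW : leb.-integrable `]0, +oo[ (EFin \o W (2 - s) (c / 2)).
  by apply: integrable_W => //; lra.
have ih := integrable_I Ox Lh c0.
have iv := integrable_I Ox Lv c0.
rewrite -(fineK (integrable_fin_num mI ih)) -(fineK (integrable_fin_num mI iW)).
rewrite -EFinM lee_fin => hI0.
have hI : I (fun z => `|v z|) x c <= 8 * l * ((c / 2) `^ (s - 1) * Gamma (1 - s)).
  by rewrite -integral_W_Gamma//; exact: hI0.
rewrite normrM (ger0_norm (powR_ge0 _ _)).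
apply: (@le_trans _ _ (c `^ (1 - s) * I (fun z => `|v z|) x c)).
  rewrite ler_wpM2l ?powR_ge0//; apply: (le_trans (le_normr_Rintegral mI iv)).
  apply: le_Rintegral => //; first exact: integrable_norm.
  move=> t /=; rewrite in_itv /= andbT => t0.
  by rewrite normrM (ger0_norm (W_ge0 _ _ _)) ler_wpM2l ?W_ge0// inner_K_norm.
apply: (@le_trans _ _ (c `^ (1 - s) * (8 * l * ((c / 2) `^ (s - 1) * Gamma (1 - s))))).
  by rewrite ler_wpM2l ?powR_ge0.
have e1 : (c / 2) `^ (s - 1) = c `^ (s - 1) * 2 `^ (1 - s).
  rewrite powRM ?invr_ge0 ?(ltW c0)// -(powR_inv1 (ler0n R 2)) -powRrM.
  by congr (_ * _ `^ _); ring.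
have e2 : c `^ (1 - s) * c `^ (s - 1) = 1.
  rewrite -powRD; last by apply/implyP => _; rewrite gt_eqF.
  by rewrite (_ : 1 - s + (s - 1) = 0) ?powRr0//; ring.
have -> : c `^ (1 - s) * (8 * l * ((c / 2) `^ (s - 1) * Gamma (1 - s))) =
   (c `^ (1 - s) * c `^ (s - 1)) * (8 * l * Gamma (1 - s)) * 2 `^ (1 - s).
  by rewrite e1; ring.
rewrite e2 mul1r.
have p2 : 2 `^ (1 - s) <= 2 :> R.
  by apply: ler1_powR; [rewrite ler1n|lra].
have G0 := Gamma_ge0 (1 - s).
have lG : 0 <= 8 * l * Gamma (1 - s) by rewrite !mulr_ge0// ltW.
have := ler_wpM2l lG p2; lra.
Qed.

Lemma T_T (t r : R) f : 0 < t -> 0 < r -> L2 f ->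
  ae_eq eta Omega (T t (T r f)) (T (t + r) f).
Proof.
move=> t0 r0 Lf; have LT := T_L2 r0 Lf.
apply: (ae_eq_of_inner mO); [exact: T_L2|by apply: T_L2 => //; rewrite addr_gt0|].
move=> g Lg; rewrite (T_sym T_law)// T_law//.
by rewrite addrC.
Qed.

Lemma cvg_I_smooth f (r : R) : L2 f -> 0 < r ->
  {ae eta, forall x, Omega x ->
    c `^ (1 - s) * I (T r f) x c @[c --> 0^'+] --> Gamma (1 - s) * T r f x}.
Proof.
case/andP: (s01) => s0 s1 Lf r0; have LT := T_L2 r0 Lf.
have ae1 : {ae eta, forall x, forall m p : nat, Omega x ->
    inner (K (m.+1%:R / p.+1%:R) x) (T r f) = inner (K (m.+1%:R / p.+1%:R + r) x) f}.
  apply: ae_foralln => m; apply: ae_foralln => p.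
  have t0 : 0 < m.+1%:R / p.+1%:R :> R by rewrite divr_gt0.
  have tr0 : 0 < m.+1%:R / p.+1%:R + r by rewrite addr_gt0.
  apply: filterS3 (T_kernel t0 LT) (T_kernel tr0 Lf) (T_T t0 r0 Lf) => x h1 h2 h3 Ox.
  by rewrite -h1// -h2// h3.
apply: filterS2 ae1 (T_kernel r0 Lf) => x h1 h2 Ox.
have shift (t : R) : 0 < t -> inner (K t x) (T r f) = inner (K (t + r) x) f.
  move=> t0; have tr0 : 0 < t + r by rewrite addr_gt0.
  have c1 := cvg_comp _ _ (cvg_grid t0) (continuous_inner_K hK t0 Ox LT).
  have c2' : grid p t + r @[p --> \oo] --> t + r.
    by apply: cvgD; [exact: cvg_grid|exact: cvg_cst].
  have c2 := cvg_comp _ _ c2' (continuous_inner_K hK tr0 Ox Lf).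
  have e : (fun r0 => inner (K r0 x) (T r f)) \o (fun p => grid p t) =
           (fun r0 => inner (K r0 x) f) \o (fun p => grid p t + r).
    by apply/funext => p /=; rewrite /grid h1.
  rewrite e in c1.
  by rewrite -(cvg_lim (@Rhausdorff R) c1) (cvg_lim (@Rhausdorff R) c2).
have [C [eps [C0 eps0 bnd]]] := K_bound hK Ox.
apply: (@cvg_W_approx_identity _ s _ (T r f x) (C * L2norm f * (1 + r `^ (- eps)))) => //.
- exact: (measurable_inner_K hK).
- move=> t t0; have tr0 : 0 < t + r by rewrite addr_gt0.
  rewrite shift//; apply: (le_trans (inner_K_bound mO hlin hK Ox Lf bnd tr0)).
  rewrite ler_wpM2l ?mulr_ge0 ?L2norm_ge0// lerD2l !powRN lef_pV2 ?posrE ?powR_gt0//.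
  by rewrite ge0_ler_powR ?nnegrE ?(ltW eps0) ?(ltW r0) ?(ltW tr0)// lerDr ltW.
- rewrite h2//.
  have c1 : inner (K (t + r) x) f @[t --> 0^'+] --> inner (K r x) f.
    have c2 : (t + r) @[t --> 0^'+] --> r.
      apply: cvg_at_right_filter; rewrite -[X in _ --> X]add0r.
      by apply: cvgD; [exact: cvg_id|exact: cvg_cst].
    exact: (cvg_comp _ _ c2 (continuous_inner_K hK r0 Ox Lf)).
  have ne : {near 0^'+, (fun t => inner (K (t + r) x) f) =1 (fun t => inner (K t x) (T r f))}.
    by near=> t; rewrite shift//; near: t; exact: nbhs_right_gt.
  by move/near_eq_cvg/cvg_trans : ne; apply.
Unshelve. all: by end_near. Qed.

Lemma cvg_I_ae f : L2 f -> {ae eta, forall x, Omega x ->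
  c `^ (1 - s) * I f x c @[c --> 0^'+] --> Gamma (1 - s) * f x}.
Proof.
move=> Lf.
pose r (m : nat) : R := m.+1%:R^-1.
have r0 m : 0 < r m by rewrite invr_gt0.
pose v m z := f z - T (r m) f z.
have LT m : L2 (T (r m) f) by exact: T_L2.
have Lv m : L2 (v m) by exact: L2_sub.
have /choice [A HA] : forall p : nat * nat, exists A : set (borelRn R n),
    [/\ measurable A, (eta A <= (36 * inner (v p.1) (v p.1) / r p.2 ^+ 2)%:E)%E &
    {ae eta, forall x, Omega x -> ~ A x -> forall c : R, 0 < c ->
     `|c `^ (1 - s) * I (v p.1) x c| <= 16 * r p.2 * Gamma (1 - s)}].
  by move=> p; exact: maximal_I.
pose D m q := A (m, q) `|` (Omega `&` [set z | (r q <= `|v m z|)%R]).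
have mV m q : measurable (Omega `&` [set z | (r q <= `|v m z|)%R]).
  have := L2_meas (L2_norm mO (Lv m)) mO (measurable_itv `[r q, +oo[).
  congr measurable; congr (_ `&` _).
  by apply/seteqP; split => z /=; rewrite in_itv/= andbT.
have mAp p : measurable (A p) by have [] := HA p.
have mD m q : measurable (D m q) by exact: measurableU.
have bD m q : (eta (D m q) <= (37 * inner (v m) (v m) / r q ^+ 2)%:E)%E.
  apply: (le_trans (measureU2 _ (mAp (m, q)) (mV m q))).
  have -> : ((37 * inner (v m) (v m) / r q ^+ 2)%:E =
    (36 * inner (v m) (v m) / r q ^+ 2)%:E + (inner (v m) (v m) / r q ^+ 2)%:E)%E.
    by rewrite -EFinD; congr EFin; ring.
  apply: leeD; first by have [] := HA (m, q).
  have := L2_Chebyshev mO (L2_norm mO (Lv m)) (r0 q).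
  by rewrite -!L2norm_sqr L2norm_norm.
pose Z q := \bigcap_m D m q.
have mZ q : measurable (Z q) by exact: bigcapT_measurable.
have Z0 q : eta (Z q) = 0%E.
  apply/eqP; rewrite -measure_le0; apply/lee_addgt0Pr => e e0; rewrite add0e.
  have e1 : 0 < e * r q ^+ 2 / 37 by rewrite divr_gt0// mulr_gt0// exprn_gt0.
  have /cvgr0Pnorm_le /(_ _ e1) [m _ /(_ m (leqnn m)) /= hm] := T_approx Lf.
  apply: (@le_trans _ _ (eta (D m q))).
    by apply: le_measure; rewrite ?inE// => x; apply.
  apply: (le_trans (bD m q)); rewrite lee_fin ler_pdivrMr ?exprn_gt0//.
  have := le_trans (ler_norm _) hm; rewrite -/(r m) -/(v m) ler_pdivlMr//.
  by rewrite mulrC.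
have ae1 : {ae eta, forall x, forall q : nat, ~ Z q x}.
  apply: ae_foralln => q; exists (Z q); split=> // x /= /contrapT //.
have ae2 : {ae eta, forall x, forall m q : nat, Omega x -> ~ A (m, q) x ->
    forall c : R, 0 < c -> `|c `^ (1 - s) * I (v m) x c| <= 16 * r q * Gamma (1 - s)}.
  by apply: ae_foralln => m; apply: ae_foralln => q; have [] := HA (m, q).
have ae3 : {ae eta, forall x, forall m : nat, Omega x ->
    c `^ (1 - s) * I (T (r m) f) x c @[c --> 0^'+] --> Gamma (1 - s) * T (r m) f x}.
  by apply: ae_foralln => m; exact: cvg_I_smooth.
apply: filterS3 ae1 ae2 ae3 => x h1 h2 h3 Ox.
apply/cvgrPdist_le => e e0.
have G0 := Gamma_ge0 (1 - s).
pose M := 17 * Gamma (1 - s) + 1; have M0 : 0 < M by rewrite /M; lra.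
pose q := Num.truncn (M / e).
have rM : r q * M <= e.
  rewrite /r ler_pdivrMl// mulrC -ler_pdivrMl// mulrC.
  exact/ltW/truncnS_gt.
have [m nD] : exists m, ~ D m q x.
  by apply/existsNP => hD; apply: (h1 q) => m _; exact: hD.
have nA : ~ A (m, q) x by move=> hA; apply: nD; left.
have vr : `|v m x| <= r q.
  by rewrite leNgt; apply/negP => hv; apply: nD; right; split => //=; exact: ltW.
have /cvgrPdist_le /(_ _ (r0 q)) nc := h3 m Ox.
near=> c.
have c0 : 0 < c by near: c; exact: nbhs_right_gt.
have b1 := h2 m q Ox nA c c0.
have b2 : `|Gamma (1 - s) * T (r m) f x - c `^ (1 - s) * I (T (r m) f) x c| <= r q.
  by near: c.
have mI : measurable (`]0, +oo[%classic : set (measurableTypeR R)) by exact: measurable_itv.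
have eI : I f x c = I (T (r m) f) x c + I (v m) x c.
  rewrite -(RintegralD mI (integrable_I Ox (LT m) c0) (integrable_I Ox (Lv m) c0)).
  apply: eq_Rintegral => t; rewrite inE /= in_itv /= andbT => t0.
  rewrite -mulrDr innerBr//; first by congr (_ * _); rewrite addrC subrK.
  exact: (K_L2 hlin hK).
have -> : Gamma (1 - s) * f x - c `^ (1 - s) * I f x c =
  (Gamma (1 - s) * T (r m) f x - c `^ (1 - s) * I (T (r m) f) x c) +
  (Gamma (1 - s) * v m x - c `^ (1 - s) * I (v m) x c).
  by rewrite eI /v; ring.
apply: (le_trans (ler_normD _ _)); apply: le_trans rM.
have b3 : `|Gamma (1 - s) * v m x - c `^ (1 - s) * I (v m) x c| <=
   Gamma (1 - s) * r q + 16 * r q * Gamma (1 - s).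
  apply: (le_trans (ler_normB _ _)); apply: lerD => //.
  by rewrite normrM (ger0_norm G0) ler_wpM2l.
apply: (le_trans (lerD b2 b3)); rewrite le_eqVlt; apply/orP; left; apply/eqP.
by rewrite /M; ring.
Unshelve. all: by end_near. Qed.

End limit.

Lemma cvg_right_sqr (R : realType) (F : R -> R) (l : R) :
  F c @[c --> 0^'+] --> l -> F (y ^+ 2 / 4) @[y --> 0^'+] --> l.
Proof.
move=> h; apply/cvgrPdist_le => e e0.
move/cvgrPdist_le : h => /(_ e e0) [d /= d0 hd].
near=> y.
have y0 : 0 < y by near: y; exact: nbhs_right_gt.
have y1 : y < 1 by near: y; apply: nbhs_right_lt.
have yd : y < d by near: y; apply: nbhs_right_lt.
have c0 : 0 < y ^+ 2 / 4 by rewrite divr_gt0// exprn_gt0.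
apply: hd => //=; rewrite sub0r normrN gtr0_norm//.
by apply: lt_trans yd; nra.
Unshelve. all: by end_near. Qed.

Theorem proposition2p3 (R : realType) (n : nat) (hn : (1 <= n)%N)
    (Omega : set (borelRn R n)) (hOmega : @open 'rV[R]_n Omega)
    (eta : {measure set (borelRn R n) -> \bar R})
    (L : operator R n)
    (hlin : linear_operator Omega eta L)
    (hpdo : second_order_pdo Omega eta L)
    (hdense : densely_defined Omega eta L)
    (hself : self_adjoint Omega eta L)
    (hnonneg : nonnegative Omega eta L)
    (T : R -> (borelRn R n -> R) -> borelRn R n -> R)
    (hT : heat_semigroup Omega eta L T)
    (K : R -> borelRn R n -> borelRn R n -> R)
    (hK : heat_kernel Omega eta L T K)
    (s : R) (hs0 : 0 < s) (hs1 : s < 1) :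
  (* the equation in the variables (z, y) *)
  (forall x, Omega x -> Psi_converges K s Omega x ->
    (forall z (y : R), Omega z -> 0 < y ->
       derivable (Psi K s x z) y 1 /\ derivable (derive1 (Psi K s x z)) y 1) /\
    (forall y : R, 0 < y ->
       (* in the sense of the operator L, as soon as Psi is in L^2 *)
       (L2 Omega eta (fun z => Psi K s x z y) ->
          dom L (fun z => Psi K s x z y) /\
          {ae eta, forall z, Omega z ->
             - L (fun z' => Psi K s x z' y) z
             + (1 - 2 * s) / y * derive1 (Psi K s x z) y
             + derive1 (derive1 (Psi K s x z)) y = 0}) /\
       (* in the weak sense, also when Psi is not in L^2 *)
       L2 Omega eta (fun z => (1 - 2 * s) / y * derive1 (Psi K s x z) y
                              + derive1 (derive1 (Psi K s x z)) y) /\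
       (forall phi, dom L phi ->
          eta.-integrable Omega (fun z => (Psi K s x z y * L phi z)%:E) ->
          - inner Omega eta (fun z => Psi K s x z y) (L phi)
          + inner Omega eta (fun z => (1 - 2 * s) / y * derive1 (Psi K s x z) y
                                      + derive1 (derive1 (Psi K s x z)) y) phi = 0))) /\
  (* symmetry *)
  (forall x z (y : R), Omega x -> Omega z -> 0 < y ->
     Psi K s x z y = Psi K s z x y) /\
  (* limit of the weighted normal derivative *)
  (forall f, L2 Omega eta f ->
    {ae eta, forall x, Omega x -> Psi_converges K s Omega x ->
       (forall y : R, 0 < y -> L2 Omega eta (fun z => derive1 (Psi K s x z) y)) /\
       inner Omega eta
         (fun z => (2 * s)^-1 * y `^ (1 - 2 * s) * derive1 (Psi K s x z) y) f
         @[y --> 0^'+] --> Gamma_opp s / (4 `^ s * Gamma s) * f x}).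
Proof.
have mO : measurable Omega by exact: measurable_open_borelRn.
have mK x z : Omega x -> Omega z ->
    measurable_fun (`]0, +oo[%classic : set R) (fun t => K t x z).
  exact: (measurable_K hK).
have K0 x z : Omega x -> Omega z -> forall t : R, 0 < t -> 0 <= K t x z.
  by move=> Ox Oz t t0; exact: (K_ge0 hK).
have PC x z : Omega x -> Psi_converges K s Omega x -> Omega z ->
    Pconv (fun t => K t x z) (1 - s).
  by move=> Ox cv Oz; apply: Psi_Pconv => y; exact: cv.
have PC1 x z : Omega x -> Psi_converges K s Omega x -> Omega z ->
    Pconv (fun t => K t x z) (1 - s + 1).
  by move=> Ox cv Oz; apply: (Pconv_succ (mK _ _ Ox Oz) (K0 _ _ Ox Oz)); exact: PC.
have PC2 x z : Omega x -> Psi_converges K s Omega x -> Omega z ->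
    Pconv (fun t => K t x z) (1 - s + 1 + 1).
  by move=> Ox cv Oz; apply: (Pconv_succ (mK _ _ Ox Oz) (K0 _ _ Ox Oz)); exact: PC1.
have a1 : 1 < 1 - s + 1 by lra.
have a2 : 1 < 1 - s + 1 + 1 by lra.
split; [|split].
- move=> x Ox cv; split.
    move=> z y Oz y0; have cvz r : 0 < r -> _ := cv z r Oz; split.
      by have [] := is_derive_Psi (mK _ _ Ox Oz) (K0 _ _ Ox Oz) cvz y0.
    by have [] := is_derive_derive1_Psi (mK _ _ Ox Oz) (K0 _ _ Ox Oz) cvz y0.
  move=> y y0; have c0 : 0 < y ^+ 2 / 4 by rewrite divr_gt0// exprn_gt0.
  pose P a z := Pint (fun t => K t x z) a (y ^+ 2 / 4).
  have L1 : L2 Omega eta (P (1 - s + 1)).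
    by apply: (L2_Pint mO hlin hK Ox a1 c0) => z; exact: PC1.
  have L3 : L2 Omega eta (P (1 - s + 1 + 1)).
    by apply: (L2_Pint mO hlin hK Ox a2 c0) => z; exact: PC2.
  pose Q z := y ^+ 2 / 4 * P (1 - s + 1 + 1) z - (1 - s) * P (1 - s + 1) z.
  have LQ : L2 Omega eta Q by apply: L2_sub => //; exact: L2_scale.
  have QE z : Omega z -> (Gamma s)^-1 * Q z =
      (1 - 2 * s) / y * derive1 (Psi K s x z) y + derive1 (derive1 (Psi K s x z)) y.
    by move=> Oz; rewrite (Psi_operator (mK _ _ Ox Oz) (K0 _ _ Ox Oz) (fun r => cv z r Oz) y0).
  have LG := L2_scale mO (Gamma s)^-1 LQ.
  have weak phi : dom L phi ->
      eta.-integrable Omega (fun z => (Psi K s x z y * L phi z)%:E) ->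
      inner Omega eta (fun z => Psi K s x z y) (L phi) =
      inner Omega eta (fun z => (Gamma s)^-1 * Q z) phi.
    move=> dphi int.
    have Lphi := dom_L2 hlin dphi.
    have [G0|Gn0] := eqVneq (Gamma s)^-1 0.
      rewrite (@eq_inner _ _ Omega eta _ (fun=> 0) _ (L phi))//; last first.
        by move=> z _; rewrite PsiE G0 mul0r.
      rewrite [RHS](@eq_inner _ _ Omega eta _ (fun=> 0) _ phi)//; last first.
        by move=> z _; rewrite G0 mul0r.
      by rewrite !inner0l.
    have intP : eta.-integrable Omega (fun z => (P (1 - s) z * L phi z)%:E).
      apply: eq_integrable (integrableZl mO (Gamma s)^-1^-1 int) => // z _.
      by rewrite -EFinM PsiE; congr EFin; rewrite !mulrA mulVf// mul1r.
    have w := weak_equation mO hlin hself hK Ox hs1 c0 dphi (fun z => PC x z Ox cv) intP.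
    have -> : inner Omega eta (fun z => Psi K s x z y) (L phi) =
        (Gamma s)^-1 * inner Omega eta (P (1 - s)) (L phi).
      rewrite -[RHS](RintegralZl _ mO intP); apply: eq_Rintegral => z _.
      by rewrite PsiE mulrA.
    rewrite w innerZl// innerBl//; try exact: L2_scale.
    by rewrite !innerZl.
  split; [|split].
  + move=> LPsi.
    have LP phi : dom L phi ->
        eta.-integrable Omega (fun z => (Psi K s x z y * L phi z)%:E).
      by move=> dphi; apply: (L2_mul_integrable mO LPsi); exact: (act_L2 hlin dphi).
    have [dPsi LPsiE] := (hself _ _ LPsi LG).2 (fun phi dphi => weak phi dphi (LP phi dphi)).
    split=> //; apply: filterS LPsiE => z h Oz.
    by rewrite h// -addrA -QE// addNr.
  + exact: (L2_eq mO QE LG).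
  + move=> phi dphi int; rewrite weak//.
    by rewrite (@eq_inner _ _ Omega eta _ _ phi phi QE)// addNr.
- move=> x z y Ox Oz y0; congr (_ * _); apply: eq_Rintegral => t.
  rewrite inE /= in_itv /= andbT => t0.
  by rewrite /Psi_integrand (K_sym hK t0 Ox Oz).
- move=> f Lf.
  have [E [nu [hE hT']]] := hT.
  have T_L2 (t : R) g : 0 < t -> L2 Omega eta g -> L2 Omega eta (T t g).
    by move=> t0 Lg; have [] := hT' t g (ltW t0) Lg.
  have T_law (t r : R) g h : 0 < t -> 0 < r -> L2 Omega eta g -> L2 Omega eta h ->
      inner Omega eta (T t g) (T r h) = inner Omega eta (T (t + r) g) h.
    by move=> t0 r0 Lg Lh; apply: (heat_semigroup_law mO hE hT') => //; exact: ltW.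
  have T_contr (t : R) g : 0 < t -> L2 Omega eta g ->
      L2norm Omega eta (T t g) <= L2norm Omega eta g.
    by move=> t0 Lg; apply: (heat_contraction mO hE hT') => //; exact: ltW.
  have T_approx g : L2 Omega eta g -> inner Omega eta
      (fun z => g z - T (m.+1%:R^-1) g z) (fun z => g z - T (m.+1%:R^-1) g z)
      @[m --> \oo] --> 0.
    move=> Lg; apply: (cvg_heat_L2norm mO hE hT') => //.
    exact: cvg_harmonic.
  have s01 : 0 < s < 1 by rewrite hs0.
  have lim := cvg_I_ae mO hlin hK T_L2 T_law T_contr T_approx s01 Lf.
  apply: filterS lim => x lim Ox cv.
  have dPsi y z : 0 < y -> Omega z -> derive1 (Psi K s x z) y =
      - (Gamma s)^-1 * (y / 2) * Pint (fun t => K t x z) (1 - s + 1) (y ^+ 2 / 4).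
    move=> y0 Oz; rewrite -mulrA.
    exact: (derive1_Psi (mK _ _ Ox Oz) (K0 _ _ Ox Oz) (fun r => cv z r Oz) y0).
  have LP y : 0 < y ->
      L2 Omega eta (fun z => Pint (fun t => K t x z) (1 - s + 1) (y ^+ 2 / 4)).
    move=> y0; have c0 : 0 < y ^+ 2 / 4 by rewrite divr_gt0// exprn_gt0.
    by apply: (L2_Pint mO hlin hK Ox a1 c0) => z; exact: PC1.
  split.
    move=> y y0; apply: (L2_eq mO _ (L2_scale mO (- (Gamma s)^-1 * (y / 2)) (LP y y0))).
    by move=> z Oz; rewrite dPsi.
  have -> : Gamma_opp s / (4 `^ s * Gamma s) * f x =
      - (Gamma s)^-1 / (4 * s) * 4 `^ (1 - s) * (Gamma (1 - s) * f x).
    have -> : 4 `^ (1 - s) = 4 / 4 `^ s :> R.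
      rewrite powRB ?powRr1//; apply/implyP => _; by rewrite pnatr_eq0.
    have p4 : 4 `^ s != 0 :> R by rewrite powR_eq0 pnatr_eq0.
    have sn0 : s != 0 by rewrite gt_eqF.
    rewrite /Gamma_opp invfM; set gi := (Gamma s)^-1; field.
    by rewrite p4 sn0.
  set A := - (Gamma s)^-1 / (4 * s) * 4 `^ (1 - s).
  pose H (y : R) := A * ((y ^+ 2 / 4) `^ (1 - s) * \int[@lebesgue_measure R]_(t in `]0, +oo[)
    (W (2 - s) (y ^+ 2 / 4) t * inner Omega eta (K t x) f)).
  have limH : H y @[y --> 0^'+] --> A * (Gamma (1 - s) * f x).
    by apply: cvgMr; exact: (cvg_right_sqr (lim Ox)).
  suff ne : {near 0^'+, H =1 (fun y => inner Omega eta
      (fun z => (2 * s)^-1 * y `^ (1 - 2 * s) * derive1 (Psi K s x z) y) f)}.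
    by move/near_eq_cvg/cvg_trans : ne; apply.
  near=> y.
  have y0 : 0 < y by near: y; exact: nbhs_right_gt.
  have c0 : 0 < y ^+ 2 / 4 by rewrite divr_gt0// exprn_gt0.
  rewrite [RHS](@eq_inner _ _ Omega eta _
    (fun z => (2 * s)^-1 * y `^ (1 - 2 * s) * (- (Gamma s)^-1 * (y / 2)) *
       Pint (fun t => K t x z) (1 - s + 1) (y ^+ 2 / 4)) f f)//; last first.
    by move=> z Oz; rewrite dPsi// mulrA.
  rewrite innerZl//; last exact: LP.
  rewrite (inner_Pint mO hlin hK Ox a1 c0 Lf); last by move=> z; exact: PC1.
  have -> : 1 - s + 1 = 2 - s by ring.
  have e : 4 `^ (1 - s) * (y ^+ 2 / 4) `^ (1 - s) = y `^ (1 - 2 * s) * y.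
    rewrite -powRM// ?(ltW c0)// mulrCA divff// mulr1 -[y ^+ 2]powR_mulrn ?(ltW y0)//.
    rewrite -powRrM -{3}(powRr1 (ltW y0)) -powRD; last by apply/implyP => _; rewrite gt_eqF.
    by congr (_ `^ _); ring.
  rewrite /H /A; set J := \int[_]_(t in _) _; set gi := (Gamma s)^-1.
  rewrite [LHS](_ : _ = - gi / (4 * s) *
    (4 `^ (1 - s) * (y ^+ 2 / 4) `^ (1 - s)) * J); last by ring.
  have sn0 : s != 0 by rewrite gt_eqF.
  by rewrite e; field.
Unshelve. all: by end_near.
Qed.
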